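(* Let $\overline{\mathbb D}=\{i,k\}$ be a two-state set ($i\neq k$). For every $\varepsilon\in(0,1]$ let $(\eta_{\varepsilon,n},\kappa_{\varepsilon,n})_{n\ge 0}$ be a Markov renewal process on $\mathbb X\times[0,\infty)$, and let $v_{\varepsilon,r}\in[1,\infty)$, $r\in\overline{\mathbb D}$, be normalisation functions. Assume: (A) $F_{\varepsilon,r}(0)<1$ for all $r\in\mathbb X$, $\varepsilon\in(0,1]$. (B) For every $r\in\overline{\mathbb D}$, $j\in\mathbb X$, either $p_{\varepsilon,rj}>0$ for all $\varepsilon\in(0,1]$ or $p_{\varepsilon,rj}=0$ for all $\varepsilon\in(0,1]$; and for every $r\in\overline{\mathbb D}$ there is a chain $r=j_0,j_1,\dots,j_n$ with $j_1,\dots,j_{n-1}\in\overline{\mathbb D}$, $j_n\in\mathbb D$ and $\prod_{l=1}^n p_{1,j_{l-1}j_l}>0$. (C) $p_{\varepsilon,rj}\to p_{0,rj}$ as $\varepsilon\to0$, for $r\in\overline{\mathbb D}$, $j\in\mathbb X$. (D) For $r\in\overline{\mathbb D}$, $j\in\mathbb Y_{1,r}$: $F_{\varepsilon,rj}(\cdot\, v_{\varepsilon,r})\Rightarrow F_{0,rj}(\cdot)$ as $\varepsilon\to0$, where $F_{0,rj}$ is a proper distribution function with $F_{0,rj}(0)<1$; and $v_{\varepsilon,r}\to v_{0,r}\in[1,\infty]$. (E) For $r\in\overline{\mathbb D}$, $j\in\mathbb Y_{1,r}$: $e_{\varepsilon,rj}<\infty$ for all $\varepsilon\in(0,1]$ and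 $e_{\varepsilon,rj}/v_{\varepsilon,r}\to e_{0,rj}=\int_0^\infty t\,F_{0,rj}(dt)<\infty$ as $\varepsilon\to0$. ($\tilde{\rm C}$) $\tilde p_{\varepsilon,rj}\to\tilde p_{0,rj}\in[0,1]$ as $\varepsilon\to0$, for $r\in\overline{\mathbb D}$, $j\in\mathbb X$. (${}_k\tilde{\rm C}$) ${}_k\tilde p_{\varepsilon,ij}\to{}_k\tilde p_{0,ij}\in[0,1]$ as $\varepsilon\to0$, for $j\in\mathbb X\setminus\{k\}$. (${}_k\hat{\rm C}$) ${}_k\hat q_{\varepsilon,ij}=\tilde p_{\varepsilon,ij}/{}_kp_{\varepsilon,ij}\to{}_k\hat q_{0,ij}\in[0,1]$ as $\varepsilon\to0$, for $j\in{}_k\mathbb Y_{1,i}$. (${}_k\hat{\rm F}$) $\tilde v_{\varepsilon,k}/\tilde v_{\varepsilon,i}\to\tilde w_{0,ki}\in[0,\infty)$ as $\varepsilon\to0$. Define ${}_k\tilde v_{\varepsilon,i}=(1-{}_kp_{\varepsilon,ii})^{-1}(1-p_{\varepsilon,ii})^{-1}v_{\varepsilon,i}$ and $${}_k\check v_{\varepsilon,k}=\begin{cases}{}_k\tilde v_{\varepsilon,i},&\tilde p_{0,ki}>0,\\ \tilde v_{\varepsilon,k},&\tilde p_{0,ki}=0.\end{cases}$$ Then for every $j\in\mathbb D$ $$G_{\varepsilon,\mathbb D,kj}(\cdot\;{}_k\check v_{\varepsilon,k})\Rightarrow G_{0,\mathbb D,kj}(\cdot)\quad\text{as }\varepsilon\to0,$$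 where $G_{0,\mathbb D,kj}$ has Laplace transform $$\Psi_{0,\mathbb D,kj}(s)=\begin{cases}\tilde\phi_{0,kj}(cs)\,\tilde p_{0,kj}+\Psi_{0,\mathbb D,ij}(s)\,\tilde\phi_{0,ki}(cs)\,\tilde p_{0,ki},&\tilde p_{0,ki}>0,\\ \tilde\phi_{0,kj}(s)\,\tilde p_{0,kj},&\tilde p_{0,ki}=0,\end{cases}\qquad s\ge0,$$ with $c=(1-{}_kp_{0,ii})\tilde w_{0,ki}$ and $\Psi_{0,\mathbb D,ij}(s)={}_k\tilde\phi_{0,ij}(s)\,{}_k\tilde p_{0,ij}$ (terms with a zero probability factor are $0$).
   Context: $\mathbb X=\{1,\dots,M\}$; $\mathbb D$ is a nonempty proper subset of $\mathbb X$ and $\overline{\mathbb D}=\mathbb X\setminus\mathbb D$. For each $\varepsilon\in(0,1]$, a Markov renewal process $(\eta_{\varepsilon,n},\kappa_{\varepsilon,n})_{n\ge0}$ is a homogeneous Markov chain on $\mathbb X\times[0,\infty)$ whose transition probabilities $Q_{\varepsilon,ij}(t)=\mathsf P\{\eta_{\varepsilon,1}=j,\kappa_{\varepsilon,1}\le t\mid\eta_{\varepsilon,0}=i,\kappa_{\varepsilon,0}=s\}$ do not depend on $s$. Notation: $p_{\varepsilon,ij}=Q_{\varepsilon,ij}(\infty)$; $F_{\varepsilon,i}(t)=\sum_{j}Q_{\varepsilon,ij}(t)$; $F_{\varepsilon,ij}=Q_{\varepsilon,ij}/p_{\varepsilon,ij}$ if $p_{\varepsilon,ij}>0$; $e_{\varepsilon,ij}=\int_0^\infty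 tF_{\varepsilon,ij}(dt)$; $\mathbb Y_{1,r}=\{j\in\mathbb X:p_{1,rj}>0\}$; $\phi_{0,rj}(s)=\int_0^\infty e^{-st}F_{0,rj}(dt)$. Hitting times: $\nu_{\varepsilon,\mathbb D}=\min(n\ge1:\eta_{\varepsilon,n}\in\mathbb D)$, $\tau_{\varepsilon,\mathbb D}=\sum_{n=1}^{\nu_{\varepsilon,\mathbb D}}\kappa_{\varepsilon,n}$, $G_{\varepsilon,\mathbb D,kj}(t)=\mathsf P\{\tau_{\varepsilon,\mathbb D}\le t,\ \eta_{\varepsilon,\nu_{\varepsilon,\mathbb D}}=j\mid\eta_{\varepsilon,0}=k\}$. Weak convergence $\Rightarrow$ of possibly improper distribution functions means convergence at continuity points of the limit together with convergence of total masses (equivalently, pointwise convergence of Laplace transforms for all $s\ge0$). Removing virtual transitions. For $r\in\overline{\mathbb D}$: $\tilde p_{\varepsilon,rj}=\mathrm I(j\ne r)\,p_{\varepsilon,rj}/(1-p_{\varepsilon,rr})$, $\tilde v_{\varepsilon,r}=(1-p_{\varepsilon,rr})^{-1}v_{\varepsilon,r}$, $\tilde{\mathbb Y}_{1,r}=\mathbb Y_{1,r}\setminus\{r\}$. For $j\in\tilde{\mathbb Y}_{1,r}$, $$\tilde\phi_{0,rj}(s)=\begin{cases}\phi_{0,rj}(s),& r\notin\mathbb Y_{1,r},\\ \frac{(1-p_{0,rr})\phi_{0,rj}((1-p_{0,rr})s)}{1-p_{0,rr}\phi_{0,rr}((1-p_{0,rr})s)},& r\in\mathbb Y_{1,r},\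 p_{0,rr}<1,\\ (1+e_{0,rr}s)^{-1},&p_{0,rr}=1,\end{cases}\qquad \tilde e_{0,rj}=\begin{cases}e_{0,rj},& r\notin\mathbb Y_{1,r},\\(1-p_{0,rr})e_{0,rj}+p_{0,rr}e_{0,rr},& r\in\mathbb Y_{1,r}.\end{cases}$$ Excluding state $k$. For $j\in\mathbb X\setminus\{k\}$: ${}_kp_{\varepsilon,ij}=\tilde p_{\varepsilon,ij}+\tilde p_{\varepsilon,ik}\tilde p_{\varepsilon,kj}$ for $\varepsilon\in(0,1]$, with limits ${}_kp_{0,ij}=\tilde p_{0,ij}+\tilde p_{0,ik}\tilde p_{0,kj}$; ${}_k\mathbb Y_{1,i}=\{j\in\mathbb X\setminus\{k\}:{}_kp_{1,ij}>0\}$; ${}_k\tilde{\mathbb Y}_{1,i}={}_k\mathbb Y_{1,i}\setminus\{i\}$; ${}_k\tilde p_{\varepsilon,ij}=\mathrm I(j\ne i)\,{}_kp_{\varepsilon,ij}/(1-{}_kp_{\varepsilon,ii})$. (Condition (B) implies $p_{\varepsilon,rr}<1$ and ${}_kp_{\varepsilon,ii}<1$ for $\varepsilon\in(0,1]$.) For $j\in{}_k\mathbb Y_{1,i}$, $${}_k\phi_{0,ij}(s)=\begin{cases}\tilde\phi_{0,ij}(s)\,{}_k\hat q_{0,ij}+\tilde\phi_{0,ik}(s)\tilde\phi_{0,kj}(\tilde w_{0,ki}s)(1-{}_k\hat q_{0,ij}),& j,k\in\tilde{\mathbb Y}_{1,i},\ j\in\tilde{\mathbb Y}_{1,k},\\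 \tilde\phi_{0,ij}(s),& j\in\tilde{\mathbb Y}_{1,i},\ \text{and } k\notin\tilde{\mathbb Y}_{1,i}\text{ or }j\notin\tilde{\mathbb Y}_{1,k},\\ \tilde\phi_{0,ik}(s)\tilde\phi_{0,kj}(\tilde w_{0,ki}s),& j\notin\tilde{\mathbb Y}_{1,i}\ (\text{in particular } j=i),\end{cases}$$ and, if $i\in{}_k\mathbb Y_{1,i}$, ${}_ke_{0,ii}=\tilde e_{0,ik}+\tilde w_{0,ki}\tilde e_{0,ki}$. Finally, for $j\in{}_k\tilde{\mathbb Y}_{1,i}$, $${}_k\tilde\phi_{0,ij}(s)=\begin{cases}{}_k\phi_{0,ij}(s),& i\notin{}_k\mathbb Y_{1,i},\\ \frac{(1-{}_kp_{0,ii})\,{}_k\phi_{0,ij}((1-{}_kp_{0,ii})s)}{1-{}_kp_{0,ii}\,{}_k\phi_{0,ii}((1-{}_kp_{0,ii})s)},& i\in{}_k\mathbb Y_{1,i},\ {}_kp_{0,ii}<1,\\ (1+{}_ke_{0,ii}s)^{-1},&{}_kp_{0,ii}=1.\end{cases}$$ *)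

(* Defs.v *)
From HB Require Import structures.
From mathcomp Require Import all_boot all_order all_algebra.
From mathcomp Require Import all_classical all_reals all_analysis.

Set Implicit Arguments.
Unset Strict Implicit.
Unset Printing Implicit Defensive.

Import Order.TTheory GRing.Theory Num.Theory.
Import numFieldNormedType.Exports.

Local Open Scope classical_set_scope.
Local Open Scope ring_scope.

(* Distributions on [0, oo[, proper or not, are finite measures on R that do not
   charge ]-oo, 0[; their distribution functions live on the whole line, so that
   an atom at 0 makes 0 a discontinuity point. *)

Definition dfun (R : realType) (mu : {measure set (measurableTypeR R) -> \bar R})
  (t : R) : R := fine (mu `]-oo, t]%classic).

Definition laplace (R : realType)
    (mu : {measure set (measurableTypeR R) -> \bar R}) (s : R) : R :=
  \int[mu]_(t in `[0, +oo[%classic) expR (- (s * t)).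

Definition mean (R : realType)
    (mu : {measure set (measurableTypeR R) -> \bar R}) : \bar R :=
  (\int[mu]_(t in `[0%R, +oo[%classic) t%:E)%E.

Definition total_mass (R : realType) (F : R -> R) : R := lim (F t @[t --> +oo]).

Definition weak_cvg (R : realType) (F : R -> R -> R) (F0 : R -> R) : Prop :=
  (forall t, {for t, continuous F0} -> F e t @[e --> 0^'+] --> F0 t) /\
  total_mass (F e) @[e --> 0^'+] --> total_mass F0.

(* The state space is 'I_M. [mrp_Q x y] is the measure B |-> P{eta_1 = y,
   kappa_1 \in B | eta_0 = x, kappa_0 = s}; [mrp_markov] is the Markov property
   together with homogeneity, the past being tested on rectangles (a pi-system
   generating the sigma-algebra of the past). The initial law is arbitrary. *)
Record markov_renewal_process (R : realType) (M : nat) := MarkovRenewalProcess {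
  mrp_disp : measure_display ;
  mrp_space : measurableType mrp_disp ;
  mrp_prob : probability mrp_space R ;
  mrp_eta : nat -> mrp_space -> 'I_M ;
  mrp_kappa : nat -> mrp_space -> R ;
  mrp_Q : 'I_M -> 'I_M -> {measure set (measurableTypeR R) -> \bar R} ;
  mrp_eta_measurable : forall n x, measurable [set w | mrp_eta n w = x] ;
  mrp_kappa_measurable : forall n, measurable_fun setT (mrp_kappa n) ;
  mrp_kappa_ge0 : forall n w, 0 <= mrp_kappa n w ;
  mrp_Q_ge0 : forall x y, mrp_Q x y `]-oo, 0[%classic = 0%E ;
  mrp_Q_total : forall x, (\sum_(y < M) mrp_Q x y setT)%E = 1%E ;
  mrp_markov : forall (n : nat) (x : nat -> 'I_M) (B : nat -> set R)
      (y : 'I_M) (t : R),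
    (forall l, measurable (B l)) ->
    let past := [set w | forall l, (l <= n)%N ->
                   mrp_eta l w = x l /\ B l (mrp_kappa l w)] in
    mrp_prob (past `&`
              [set w | mrp_eta n.+1 w = y /\ mrp_kappa n.+1 w <= t]) =
    (mrp_prob past * mrp_Q (x n) y `]-oo, t]%classic)%E
}.

Section Process.
Context (R : realType) (M : nat) (X : markov_renewal_process R M).
Implicit Types (D : {set 'I_M}) (x y : 'I_M) (t : R).

Definition jump_prob x y : R := fine (mrp_Q X x y setT).

Definition sojourn_dfun x t : R := \sum_(y < M) dfun (mrp_Q X x y) t.

(* Q_{xy} / p_{xy} if p_{xy} > 0; the Dirac mass is a dummy value otherwise. *)
Definition cond_sojourn x y : probability (measurableTypeR R) R :=
  mnormalize (mrp_Q X x y) (@dirac _ (measurableTypeR R) 0 R).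

(* nu_D(w) = n, i.e. n is the least n >= 1 with eta_n(w) in D *)
Definition hits_at D (n : nat) (w : mrp_space X) : Prop :=
  [/\ (0 < n)%N, mrp_eta n w \in D &
      forall m, (0 < m < n)%N -> mrp_eta m w \notin D].

Definition starts_from x : set (mrp_space X) := [set w | mrp_eta 0 w = x].

(* {tau_D <= t, eta_{nu_D} = y} *)
Definition hitting_event D y t : set (mrp_space X) :=
  [set w | exists n, [/\ hits_at D n w, mrp_eta n w = y &
                         \sum_(1 <= m < n.+1) mrp_kappa m w <= t]].

(* P{tau_D <= t, eta_{nu_D} = y | eta_0 = x}, for P{eta_0 = x} > 0 *)
Definition hitting_dfun D x y t : R :=
  fine (mrp_prob X (hitting_event D y t `&` starts_from x)) /
  fine (mrp_prob X (starts_from x)).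

End Process.

Section Reduction.
Context (R : realType) (M : nat).
Implicit Types (p : 'I_M -> 'I_M -> R) (i j k r : 'I_M).

Definition remove_virtual p r j : R := (j != r)%:R * p r j / (1 - p r r).

(* [p] is here a matrix without virtual transitions *)
Definition exclude p k i j : R := p i j + p i k * p k j.

Definition reachable p r j : bool := 0 < p r j.

Definition reachable_neq p r j : bool := (j != r) && reachable p r j.

(* Limiting transform from r to j after removal of the virtual transitions of r:
   [self] says whether r is reachable from itself in one step, [p] is the
   limiting probability of r -> r, [phi] and [phi_self] are the transforms of
   r -> j and r -> r, [e_self] is the mean of r -> r. *)
Definition remove_virtual_laplace (self : bool) (p e_self : R)
    (phi phi_self : R -> R) (s : R) : R :=
  if ~~ self then phi s
  else if p < 1 then
    (1 - p) * phi ((1 - p) * s) / (1 - p * phi_self ((1 - p) * s))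
  else (1 + e_self * s)^-1.

End Reduction.

(* [p1] is the transition matrix at epsilon = 1; [pt0], [kpt0], [q0], [w0] are the
   limits of tilde p, of row i of {}_k tilde p, of row i of {}_k hat q and of
   tilde v_k / tilde v_i. They are separate data as they need not be determined
   by p0. *)
Section Limit.
Context (R : realType) (M : nat) (p1 p0 : 'I_M -> 'I_M -> R)
  (F0 : 'I_M -> 'I_M -> probability (measurableTypeR R) R).

Definition phi0 r j (s : R) : R := laplace (F0 r j) s.

Definition e0 r j : R := fine (mean (F0 r j)).

Definition phit0 r j (s : R) : R :=
  remove_virtual_laplace (reachable p1 r r) (p0 r r) (e0 r r)
    (phi0 r j) (phi0 r r) s.

Definition et0 r j : R :=
  if reachable p1 r r then (1 - p0 r r) * e0 r j + p0 r r * e0 r r else e0 r j.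

Context (pt0 : 'I_M -> 'I_M -> R) (kpt0 q0 : 'I_M -> R) (w0 : R) (i k : 'I_M).

Let kp1 : 'I_M -> 'I_M -> R := exclude (remove_virtual p1) k.
Let kp0 : 'I_M -> 'I_M -> R := exclude pt0 k.

Definition kphi0 j (s : R) : R :=
  if reachable_neq p1 i j then
    if reachable_neq p1 i k && reachable_neq p1 k j then
      phit0 i j s * q0 j + phit0 i k s * phit0 k j (w0 * s) * (1 - q0 j)
    else phit0 i j s
  else phit0 i k s * phit0 k j (w0 * s).

Definition ke0 : R := et0 i k + w0 * et0 k i.

Definition kphit0 j (s : R) : R :=
  remove_virtual_laplace (reachable kp1 i i) (kp0 i i) ke0
    (kphi0 j) (kphi0 i) s.

Definition Psi_i0 j (s : R) : R := kphit0 j s * kpt0 j.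

Definition Psi_k0 j (s : R) : R :=
  let c := (1 - kp0 i i) * w0 in
  if 0 < pt0 k i then
    phit0 k j (c * s) * pt0 k j + Psi_i0 j s * phit0 k i (c * s) * pt0 k i
  else phit0 k j s * pt0 k j.

End Limit.

(* Main.v *)
(** The law of the hitting time is a sum over paths, and its Laplace transform is
    the solution of a two-state linear system in the transforms of [mrp_Q]. Solving
    it for [k] amounts to removing the virtual transitions, excluding [k], and
    removing the virtual transitions of [i] again. Each of these operations passes
    to the limit if convergence of transforms is taken continuously (arguments
    move with epsilon) and is accompanied by convergence of the slopes at 0, which
    are the means; the slopes give the exponential limits in the degenerate case
    where a self-transition probability tends to 1. Finally the limit is
    continuous at 0, so pointwise convergence of the transforms gives weak
    convergence: indicators of intervals are approximated by exponential sums. *)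

Require Import Defs.
From HB Require Import structures.
From mathcomp Require Import all_boot all_order all_algebra.
From mathcomp Require Import all_classical all_reals all_analysis.
From mathcomp Require Import measurable_realfun ring lra.

Set Implicit Arguments.
Unset Strict Implicit.
Unset Printing Implicit Defensive.

Import Order.TTheory GRing.Theory Num.Theory.
Import numFieldNormedType.Exports.

Local Open Scope classical_set_scope.
Local Open Scope ring_scope.

(** * Laplace transforms of finite measures *)

(** The Markov property speaks of events, with half-lines in the last sojourn time; expectations of
    products of kernels are reached by exchanging indicators for kernels one at a time. The filter
    of the limit calculus is abstract because it is used twice: with epsilon alone, and with the
    pair of epsilon and [s] on a product filter. The second use gives continuity of the limit at 0
    without inspecting its formula: the transforms approach the value at 0 jointly, and sending
    epsilon to 0 at fixed [s] carries the estimate over to the limit. The means enter twice: as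
    Lipschitz constants, which upgrade pointwise to continuous convergence, and as slopes. Weak
    convergence alone does not control them, hence condition (E). Reachability is decided at epsilon
    = 1 and (B) makes it valid for every epsilon, so the case distinctions of the limiting formulas
    can be copied before the limit. If [pt0 k i = 0], time is measured on the scale of [k], on which
    the transform from [i] need not converge; its bound by 1 is used against a factor tending to
    0. *)

Lemma exponential_law (R : realType) (s : R) : 0 < s ->
  exists E : probability (measurableTypeR R) R,
    (forall t, 0 <= t -> E `[t, +oo[%classic = (expR (- (s * t)))%:E) /\
    (forall N, countable N -> measurable N -> E N = 0%E).
Proof.
move=> s0.
have [E EE] : exists E : probability (measurableTypeR R) R,
    forall V, E V = exponential_prob s V.
  by exists (exponential_distribution_exponential_prob__canonical__probability_measure_Probability s0).
have mpdf D : measurable_fun D (EFin \o exponential_pdf s).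
  by apply/measurable_funTS/measurable_EFinP; exact: measurable_exponential_pdf.
exists E; split; last first.
  (* Absolute continuity of [E]; it later makes the discontinuities of a distribution function
     negligible. *)
  move=> N cN mN; rewrite EE /exponential_prob null_set_integral//.
  - exact: mpdf.
  - exact: countable_lebesgue_measure0.
move=> t t0.
have E0 : E `]-oo, 0[%classic = 0%E.
  rewrite EE /exponential_prob integral0_eq// => x /=.
  by rewrite in_itv/= => x0; rewrite lt0_exponential_pdf.
have Et : E `]-oo, t[%classic = (1 - (expR (- (s * t)))%:E)%E.
  have [->|tn0] := eqVneq t 0.
    by rewrite E0 mulr0 oppr0 expR0 subee.
  have {tn0}t0 : 0 < t by rewrite lt_neqAle eq_sym tn0.
  have -> : `]-oo, t[%classic = `]-oo, 0[%classic `|` `[0, t[%classic :> set R.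
    apply/seteqP; split => x /=; rewrite !in_itv/=.
      by move=> xt; case: (ltP x 0) => ?; [left|right].
    by move=> [x0|/andP[]//]; exact: lt_trans t0.
  have -> : E (`]-oo, 0%R[%classic `|` `[0%R, t[%classic) =
      (E `]-oo, 0%R[%classic + E `[0%R, t[%classic)%E.
    apply: measureU => //; apply/seteqP; split => x //=.
    by rewrite !in_itv/= => -[]; case: ltP.
  rewrite E0 add0e EE /exponential_prob integral_itv_bndo_bndc//.
  by rewrite [LHS]exponential_prob_itv0c// mulNr.
have -> : `[t, +oo[%classic = ~` `]-oo, t[%classic :> set R.
  by apply/seteqP; split => x /=; rewrite !in_itv/= andbT leNgt => /negP.
rewrite probability_setC// Et (_ : 1 - (expR _)%:E = (1 - expR (- (s * t)))%:E)%E//.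
by rewrite -EFinB; congr EFin; lra.
Qed.

Section FiniteMeasureOf.
Context d (T : measurableType d) (R : realType) (mu : {measure set T -> \bar R}).

(** The finiteness proof is an argument of this alias of [mu] so that the finite measure structure,
    which Fubini asks for, can be inferred from the term. *)
Definition finite_measure_of (_ : (mu setT < +oo)%E) : set T -> \bar R := mu.

Context (mufin : (mu setT < +oo)%E).

HB.instance Definition _ := Measure.copy (finite_measure_of mufin) mu.

Lemma finite_measure_of_fin : fin_num_fun (finite_measure_of mufin).
Proof.
move=> A mA; rewrite ge0_fin_numE//; apply: le_lt_trans mufin.
by apply: le_measure; rewrite ?inE.
Qed.

HB.instance Definition _ := Measure_isFinite.Build _ _ _
  (finite_measure_of mufin) finite_measure_of_fin.

End FiniteMeasureOf.

(* [exp (- s t)] is the tail of the exponential law at [t], so Fubini trades the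
   Laplace kernel for indicators, which is all that the Markov property sees. *)
Lemma integral_expR_exponential d (T : measurableType d) (R : realType)
    (mu : {measure set T -> \bar R}) (W kap : T -> R) (s : R)
    (E : probability (measurableTypeR R) R) :
  (forall t, 0 <= t -> E `[t, +oo[%classic = (expR (- (s * t)))%:E) ->
  (mu setT < +oo)%E ->
  measurable_fun setT W -> measurable_fun setT kap ->
  (forall w, 0 <= W w) -> (forall w, W w = 0 \/ 0 <= kap w) ->
  (\int[mu]_w (W w * expR (- (s * kap w)))%:E =
   \int[E]_u \int[mu]_w (W w * (kap w <= u)%R%:R)%:E)%E.
Proof.
move=> Eexp mufin mW mk W0 Wk.
pose m : {finite_measure set T -> \bar R} := finite_measure_of mufin.
change (\int[m]_w (W w * expR (- (s * kap w)))%:E =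
   \int[E]_u \int[m]_w (W w * (kap w <= u)%R%:R)%:E)%E.
rewrite -(fubini_tonelli (fun z : T * measurableTypeR R =>
  (W z.1 * (kap z.1 <= z.2)%R%:R)%:E))/=; last 2 first.
- apply/measurable_EFinP; apply: measurable_funM.
    by apply: measurableT_comp.
  pose U := [set z : T * measurableTypeR R | kap z.1 <= z.2].
  have -> : (fun z : T * measurableTypeR R => (kap z.1 <= z.2)%R%:R) = \1_U :> (_ -> R).
    by apply/funext => z; rewrite indicE; congr (nat_of_bool _)%:R; apply/idP/idP;
      rewrite inE.
  apply: measurable_indic.
  have : measurable_fun setT (fun z : T * measurableTypeR R => kap z.1 <= z.2).
    apply: measurable_fun_ler => //; exact: measurableT_comp.
  by move=> /(_ measurableT [set true]); rewrite setTI; exact.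
- by move=> z; rewrite lee_fin mulr_ge0.
apply: eq_integral => w _.
under eq_integral do rewrite EFinM.
rewrite ge0_integralZl//; last 2 first.
- apply/measurable_EFinP.
  apply: (eq_measurable_fun (\1_(`[kap w, +oo[%classic) : R -> R)).
    move=> u _; rewrite indicE; congr (nat_of_bool _)%:R; apply/idP/idP;
      by rewrite inE/= in_itv/= andbT.
  exact: measurable_indic.
- by rewrite lee_fin.
(* The tail formula of [E] concerns nonnegative arguments; where [kap w] may be negative the weight
   is 0 and both sides vanish. *)
rewrite EFinM; have [->|kw] := Wk w; first by rewrite !mul0e.
congr (_ * _)%E; rewrite -Eexp//.
rewrite -[X in E X]setIT -integral_indic//; apply: eq_integral => u _.
rewrite indicE; congr (_%:R)%:E; congr (nat_of_bool _).
by apply/idP/idP; rewrite inE/= in_itv/= andbT.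
Qed.

Section LaplaceTransform.
Context (R : realType) (mu : {measure set (measurableTypeR R) -> \bar R}).
Hypothesis mufin : (mu setT < +oo)%E.
Implicit Types s x y t : R.

Local Notation Rp := (`[0%R, +oo[%classic : set R).

Lemma fin_num_finite_measure (A : set R) : measurable A -> mu A \is a fin_num.
Proof. exact: (finite_measure_of_fin mufin). Qed.

Lemma integrable_bounded (f : R -> R) (c : R) :
  measurable_fun setT f -> (forall t, 0 <= t -> `|f t| <= c) ->
  mu.-integrable Rp (EFin \o f).
Proof.
move=> mf fc; apply: measurable_bounded_integrable => //.
- by rewrite -ge0_fin_numE//; exact: fin_num_finite_measure.
- exact: measurable_funTS.
- exists c; split; first exact: num_real.
  move=> c' cc' t /=; rewrite in_itv/= andbT => t0.
  exact: le_trans (fc _ t0) (ltW cc').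
Qed.

Lemma measurable_laplace_kernel s :
  measurable_fun [set: R] (fun t : R => expR (- (s * t))).
Proof.
apply: continuous_measurable_fun => t.
apply: continuous_comp; last exact: continuous_expR.
by apply: continuousN; apply: continuousM => //; exact: cst_continuous.
Qed.

Lemma integrable_laplace s : 0 <= s ->
  mu.-integrable Rp (EFin \o (fun t => expR (- (s * t)))).
Proof.
move=> s0; apply: (@integrable_bounded _ 1); first exact: measurable_laplace_kernel.
move=> t t0; rewrite ger0_norm ?expR_ge0// -expR0 ler_expR.
by rewrite oppr_le0 mulr_ge0.
Qed.

Lemma laplaceE s : 0 <= s ->
  (laplace mu s)%:E = (\int[mu]_(t in Rp) (expR (- (s * t)))%:E)%E.
Proof.
move=> s0; rewrite /laplace /Rintegral fineK//.
exact: (integrable_fin_num _ (integrable_laplace s0)).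
Qed.

Lemma laplace_ge0 s : 0 <= laplace mu s.
Proof. by apply: Rintegral_ge0 => t _; exact: expR_ge0. Qed.

Lemma laplace0 : laplace mu 0 = fine (mu Rp).
Proof.
rewrite /laplace /Rintegral; congr fine.
rewrite (eq_integral (cst 1%E))/=.
  by rewrite integral_cst// mul1e.
by move=> t _; rewrite mul0r oppr0 expR0.
Qed.

Lemma laplace_sum (l : seq (R * R)) : all (fun a => 0 <= a.2) l ->
  mu.-integrable Rp (EFin \o (fun t => \sum_(a <- l) a.1 * expR (- (a.2 * t)))) /\
  \int[mu]_(t in Rp) (\sum_(a <- l) a.1 * expR (- (a.2 * t))) =
  \sum_(a <- l) a.1 * laplace mu a.2.
Proof.
elim: l => [_|[c s] l IH /= /andP[s0 /IH[il El]]].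
  split.
    apply: eq_integrable (integrable0 _ _) => // t _ /=.
    by rewrite big_nil.
  rewrite big_nil; transitivity (\int[mu]_(t in Rp) (cst 0 t)).
    by apply: eq_Rintegral => t _ /=; rewrite big_nil.
  by rewrite Rintegral_cst// mul0r.
have is_ := integrableZl _ c (integrable_laplace s0).
have {}is_ : mu.-integrable Rp (EFin \o (fun t => c * expR (- (s * t)))).
  exact: is_.
split.
  apply: eq_integrable (integrableD _ is_ il) => // t _ /=.
  by rewrite big_cons.
rewrite big_cons/= -El /laplace -RintegralZl//; last exact: integrable_laplace.
rewrite -RintegralD//; apply: eq_Rintegral => t _.
by rewrite big_cons.
Qed.

(** Pointwise inequalities between exponential sums on [[0, +oo[] integrate to inequalities between
    transforms; monotonicity and the chord inequality are instances. *)
Lemma laplace_sum_ge0 (l : seq (R * R)) : all (fun a => 0 <= a.2) l ->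
  (forall t, 0 <= t -> 0 <= \sum_(a <- l) a.1 * expR (- (a.2 * t))) ->
  0 <= \sum_(a <- l) a.1 * laplace mu a.2.
Proof.
move=> l0 f0; rewrite -(laplace_sum l0).2; apply: Rintegral_ge0 => t /=.
by rewrite in_itv/= andbT; exact: f0.
Qed.

Lemma laplace_decr x y : 0 <= x <= y -> laplace mu y <= laplace mu x.
Proof.
move=> /andP[x0 xy]; have y0 : 0 <= y by exact: le_trans xy.
have := @laplace_sum_ge0 [:: (1, x); (-1, y)].
rewrite /= x0 y0 !big_cons !big_nil/= => /(_ isT).
suff H t : 0 <= t -> 0 <= 1 * expR (- (x * t)) + (-1 * expR (- (y * t)) + 0).
  move=> h; have : 0 <= 1 * laplace mu x + (-1 * laplace mu y + 0).
    by apply: h => t t0; rewrite !big_cons big_nil; exact: H.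
  by lra.
move=> t0; suff : expR (- (y * t)) <= expR (- (x * t)) by lra.
by rewrite ler_expR lerN2 ler_wpM2r.
Qed.

(** Convexity of the kernel in its parameter: the slope of the chord from 0 shrinks as the endpoint
    moves away. It bounds slopes at points tending to 0 from below by the slope at one fixed
    point. *)
Lemma laplace_chord x y : 0 <= x -> x <= y ->
  x * (laplace mu 0 - laplace mu y) <= y * (laplace mu 0 - laplace mu x).
Proof.
move=> x0 xy; have y0 : 0 <= y by exact: le_trans xy.
have := @laplace_sum_ge0 [:: (y - x, 0); (- y, x); (x, y)].
rewrite /= x0 y0 lexx !big_cons !big_nil/= => /(_ isT).
suff H t : 0 <= t -> 0 <= (y - x) * expR (- (0 * t)) +
    (- y * expR (- (x * t)) + (x * expR (- (y * t)) + 0)).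
  move=> h; have : 0 <= (y - x) * laplace mu 0 + (- y * laplace mu x +
      (x * laplace mu y + 0)).
    by apply: h => t t0; rewrite !big_cons big_nil; exact: H.
  by lra.
move=> t0; rewrite mul0r oppr0 expR0.
(* tangent line of the exponential at [- x t] *)
set A := expR (- (x * t)).
have A0 : 0 <= A by exact: expR_ge0.
have h1 : A * (1 + x * t) <= 1.
  rewrite [leRHS](_ : 1 = A * expR (x * t)).
    by rewrite ler_wpM2l// expR_ge1Dx.
  by rewrite -expRD addNr expR0.
have h2 : A * (1 - (y - x) * t) <= expR (- (y * t)).
  have -> : - (y * t) = - (x * t) + - ((y - x) * t) by ring.
  by rewrite expRD ler_wpM2l// expR_ge1Dx.
have h3 : (y - x) * (A * (1 + x * t)) <= (y - x) * 1.
  by rewrite ler_wpM2l// subr_ge0.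
have h4 : x * (A * (1 - (y - x) * t)) <= x * expR (- (y * t)).
  by rewrite ler_wpM2l.
suff -> : (y - x) * 1 + (- y * A + (x * expR (- (y * t)) + 0)) =
  ((y - x) * 1 - (y - x) * (A * (1 + x * t))) +
  (x * expR (- (y * t)) - x * (A * (1 - (y - x) * t))) by lra.
by ring.
Qed.

Lemma measurable_dfun : measurable_fun [set: R] (dfun mu).
Proof.
apply: nondecreasing_measurable => // x y xy.
rewrite /dfun fine_le ?fin_num_finite_measure//.
by apply: le_measure; rewrite ?inE//; apply: subitvPr.
Qed.

Lemma dfun_nd x y : x <= y -> dfun mu x <= dfun mu y.
Proof.
move=> xy; rewrite /dfun fine_le ?fin_num_finite_measure//.
by apply: le_measure; rewrite ?inE//; apply: subitvPr.
Qed.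

Lemma dfun_ge0 x : 0 <= dfun mu x.
Proof. by rewrite /dfun fine_ge0. Qed.

Lemma dfun_le x : dfun mu x <= fine (mu setT).
Proof.
rewrite /dfun fine_le ?fin_num_finite_measure//.
by apply: le_measure; rewrite ?inE.
Qed.

Lemma measure_setI_ge0 (A : set R) : mu `]-oo, 0[%classic = 0%E -> measurable A ->
  mu A = mu (A `&` Rp).
Proof.
move=> mu0 mA; rewrite (measureDI mu mA (measurable_itv `[0%R, +oo[)).
rewrite [X in (X + _)%E](_ : _ = 0%E) ?add0e//.
apply/eqP; rewrite -measure_le0 -mu0; apply: le_measure; rewrite ?inE//.
  exact: measurableD.
move=> t [_] /=; rewrite !in_itv/= andbT => /negP; by rewrite -ltNge.
Qed.

(** Integration by parts in probabilistic form: the transform is the mean of the distribution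
    function at an independent exponential time of rate [s]. Convergence of distribution functions
    thereby passes to transforms by dominated convergence. *)
Lemma laplace_dfun (E : probability (measurableTypeR R) R) s (v : R) :
  0 <= s -> 0 < v ->
  (forall t, 0 <= t -> E `[t, +oo[%classic = (expR (- (s * t)))%:E) ->
  mu `]-oo, 0[%classic = 0%E ->
  (laplace mu (s / v))%:E = (\int[E]_u (dfun mu (u * v))%:E)%E.
Proof.
move=> s0 v0 Eexp mu0.
rewrite laplaceE ?divr_ge0 ?(ltW v0)// integral_mkcond.
transitivity (\int[mu]_t (\1_Rp t * expR (- (s * (t / v))))%:E)%E.
  apply: eq_integral => t _; rewrite patchE indicE.
  by case: ifPn => _; rewrite ?mul1r ?mul0r// mulrAC mulrA.
rewrite (integral_expR_exponential Eexp)//; last 2 first.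
- exact: measurable_funM.
- move=> t; rewrite indicE; case: (boolP (t \in Rp)) => /=; last by left.
  by rewrite inE/= in_itv/= andbT => t0; right; rewrite divr_ge0// ltW.
apply: eq_integral => u _; rewrite /dfun fineK ?fin_num_finite_measure//.
rewrite measure_setI_ge0// -[X in mu X]setIT -integral_indic//; last first.
  exact: measurableI.
apply: eq_integral => t _; rewrite !indicE in_setI mulrC; congr EFin.
rewrite -natrM mulnb; congr (nat_of_bool _)%:R; congr (_ && _).
by rewrite ler_pdivrMr//; apply/idP/idP; rewrite inE/= in_itv.
Qed.

Lemma dfun_cvg_mass : dfun mu t @[t --> +oo] --> fine (mu setT).
Proof.
have cvgN : dfun mu n%:R @[n --> \oo] --> fine (mu setT).
  have -> : setT = \bigcup_n `]-oo, n%:R]%classic :> set R.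
    apply/seteqP; split => // x _; exists (Num.bound `|x|) => //=.
    by rewrite in_itv/=; apply/ltW/(le_lt_trans (ler_norm _)); exact: archi_boundP.
  apply: fine_cvg.
  rewrite fineK; last by apply: fin_num_finite_measure; exact: bigcup_measurable.
  apply: (@nondecreasing_cvg_mu _ _ _ mu (fun n => `]-oo, n%:R]%classic)) => //.
    exact: bigcup_measurable.
  by move=> m n mn; apply/subsetPset; apply: subitvPr; rewrite /= bnd_simp ler_nat.
apply/cvgrPdist_le => e e0.
move/cvgrPdist_le : cvgN => /(_ _ e0)[N _ /(_ N (leqnn _))] /=.
rewrite ger0_norm ?subr_ge0 ?dfun_le// => hN.
near=> t; rewrite ger0_norm ?subr_ge0 ?dfun_le//.
apply: le_trans hN; rewrite lerD2l lerN2; apply: dfun_nd.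
by near: t; exact: nbhs_pinfty_ge.
Unshelve. all: by end_near. Qed.

Lemma total_mass_dfun : total_mass (dfun mu) = fine (mu setT).
Proof. exact/cvg_lim/dfun_cvg_mass. Qed.

Hypothesis mean_fin : (mean mu < +oo)%E.

Lemma integrable_mean : mu.-integrable Rp (EFin \o id).
Proof.
apply/integrableP; split; first exact/measurable_funTS/measurable_EFinP.
suff -> : (\int[mu]_(t in Rp) `|(EFin \o id) t|)%E = mean mu by [].
apply: eq_integral => t; rewrite inE/= in_itv/= andbT => t0.
by rewrite /= ger0_norm.
Qed.

Lemma mean_ge0 : 0 <= fine (mean mu).
Proof.
by apply/fine_ge0/integral_ge0 => t /=; rewrite in_itv/= andbT lee_fin.
Qed.

Lemma expR_sub_le x y t : 0 <= x -> x <= y -> 0 <= t ->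
  expR (- (x * t)) - expR (- (y * t)) <= (y - x) * t.
Proof.
move=> x0 xy t0.
have -> : - (y * t) = - (x * t) + - ((y - x) * t) by ring.
rewrite expRD -{1}[expR (- (x * t))]mulr1 -mulrBr.
have h : 1 - expR (- ((y - x) * t)) <= (y - x) * t.
  by have := expR_ge1Dx (- ((y - x) * t)); lra.
apply: le_trans h; apply: ler_piMl.
  rewrite subr_ge0 -expR0 ler_expR oppr_le0 mulr_ge0// subr_ge0//.
by rewrite -expR0 ler_expR oppr_le0 mulr_ge0.
Qed.

(** The kernel at [t] is [t]-Lipschitz in its parameter; integrating, the mean bounds every slope
    from above. *)
Lemma laplace_lipschitz x y : 0 <= x -> x <= y ->
  laplace mu x - laplace mu y <= (y - x) * fine (mean mu).
Proof.
move=> x0 xy.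
have ix := integrable_laplace x0.
have iy := integrable_laplace (le_trans x0 xy).
have -> : fine (mean mu) = \int[mu]_(t in Rp) t by [].
rewrite /laplace -RintegralB// -RintegralZl//; last exact: integrable_mean.
apply: le_Rintegral => //.
- exact: (integrableB _ ix iy).
- exact: (integrableZl _ _ integrable_mean).
- by move=> t /=; rewrite in_itv/= andbT; exact: expR_sub_le.
Qed.

(** The difference quotients of the kernel at 0 converge to [t] and are dominated by [t], which is
    integrable; dominated convergence along a sequence of steps tending to 0 gives the mean as
    limit. *)
Lemma laplace_slope_ge (eta : R) : 0 < eta ->
  exists2 d : R, 0 < d & fine (mean mu) - eta <= (laplace mu 0 - laplace mu d) / d.
Proof.
move=> eta0.
have [d d0 dcvg] : exists2 d : nat -> R, forall n, 0 < d n &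
    d n @[n --> \oo] --> (0 : R).
  by exists (@harmonic R) => [n|]; [exact: harmonic_gt0|exact: cvg_harmonic].
pose f n t := (expR (- (0 * t)) - expR (- (d n * t))) * (d n)^-1.
have intf n : \int[mu]_(t in Rp) f n t = (laplace mu 0 - laplace mu (d n)) / d n.
  rewrite RintegralZr// ?RintegralB//; try exact: integrable_laplace.
  - by apply: integrable_laplace; exact: ltW.
  - exact: (integrableB _ (integrable_laplace (lexx 0)) (integrable_laplace (ltW (d0 n)))).
have fbnd n t : 0 <= t -> t - d n * t ^+ 2 <= f n t <= t.
  move=> t0; rewrite /f ler_pdivlMr// ler_pdivrMr//; apply/andP; split; last first.
    by have := @expR_sub_le 0 (d n) t (lexx _) (ltW (d0 n)) t0; lra.
  rewrite mul0r oppr0 expR0; set x := d n * t.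
  have x0 : 0 <= x by rewrite mulr_ge0// ltW.
  have -> : (t - d n * t ^+ 2) * d n = x - x ^+ 2 by rewrite /x; ring.
  have h : expR (- x) * (1 + x) <= 1.
    rewrite [leRHS](_ : 1 = expR (- x) * expR x); last by rewrite -expRD addNr expR0.
    by rewrite ler_wpM2l ?expR_ge0// expR_ge1Dx.
  (* [1 - exp (- x) >= x / (1 + x) >= x - x ^+ 2]. *)
  have := expR_ge0 (- x); nra.
have : (\int[mu]_(t in Rp) f n t) @[n --> \oo] --> fine (mean mu).
  apply: fine_cvg; rewrite fineK; last first.
    exact: (integrable_fin_num _ integrable_mean).
  apply: (@dominated_cvg _ (measurableTypeR R) R mu Rp _
    (fun n => EFin \o f n) (EFin \o id) (EFin \o id)) => //.
  - move=> n; apply/measurable_funTS/measurable_EFinP; apply: measurable_funM => //.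
    by apply: measurable_funB => //; exact: measurable_laplace_kernel.
  - move=> t /=; rewrite in_itv/= andbT => t0; apply: cvg_EFin; first by near=> n.
    rewrite /=.
    apply: (@squeeze_cvgr _ _ _ _ (fun n => t - d n * t ^+ 2) (cst t)).
    + by near=> n; exact: fbnd.
    + rewrite -[X in _ --> X](subr0 t); apply: cvgB; first exact: cvg_cst.
      rewrite -(mul0r (t ^+ 2)); apply: cvgM; last exact: cvg_cst.
      exact: dcvg.
    + exact: cvg_cst.
  - exact: integrable_mean.
  - move=> n t /=; rewrite in_itv/= andbT => t0; have /andP[h1 h2] := fbnd n t t0.
    rewrite lee_fin ger0_norm//.
    rewrite divr_ge0 ?(ltW (d0 n))// subr_ge0 ler_expR lerN2 ler_wpM2r// ltW//.
move/cvgrPdist_le => /(_ _ eta0)[N _ /(_ N (leqnn _))] /=.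
rewrite intf => hN; exists (d N) => //.
by have := ler_norm (fine (mean mu) - (laplace mu 0 - laplace mu (d N)) / d N); lra.
Unshelve. all: by end_near. Qed.

End LaplaceTransform.

Lemma laplace_cvg0 (R : realType) (mu : {measure set (measurableTypeR R) -> \bar R}) :
  (mu setT < +oo)%E -> laplace mu x @[x --> 0^'+] --> laplace mu 0.
Proof.
move=> mufin; apply/cvg_at_rightP => u [u0 ucvg].
apply: fine_cvg; rewrite -/(Rintegral _ _ _) -/(laplace _ _) laplaceE//.
apply: (@dominated_cvg _ (measurableTypeR R) R mu `[0%R, +oo[%classic _
  (fun n t => (expR (- (u n * t)))%:E) (fun t => (expR (- (0 * t)))%:E) (EFin \o cst 1)) => //.
- by move=> n; apply/measurable_funTS/measurable_EFinP; exact: measurable_laplace_kernel.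
- move=> t _; apply: cvg_EFin; first by near=> n.
  apply: (@cvg_comp _ _ _ (fun n => - (u n * t)) expR _ (nbhs (- (0 * t)))).
    by apply: cvgN; apply: cvgM => //; exact: cvg_cst.
  exact: continuous_expR.
- apply: (@integrable_bounded _ _ mufin (cst 1) 1) => // t _.
  by rewrite normr1.
- move=> n t /=; rewrite in_itv/= andbT => t0.
  rewrite lee_fin ger0_norm ?expR_ge0// -expR0 ler_expR oppr_le0 mulr_ge0// ltW//.
Unshelve. all: by end_near. Qed.

(** A monotone function has one-sided limits everywhere and [F t] lies between them, so failure of
    continuity means that they differ; such jumps are countable on each bounded interval. *)
Lemma countable_noncontinuity (R : realType) (F : R -> R) :
  {homo F : x y / x <= y} -> countable [set t | ~ {for t, continuous F}].
Proof.
move=> ndF.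
pose A n := [set x | (x \in `](- n%:R : R), n%:R[%R) /\ discontinuity F x].
apply: (@sub_countable _ _ _ (\bigcup_n A n)); last first.
  apply: bigcup_countable => // n _; apply: discontinuity_countable => x y _ _.
  exact: ndF.
apply: subset_card_le => t nct.
have cl : cvg (F x @[x --> t^'-]).
  apply: nondecreasing_at_left_is_cvgr; near=> x; first by move=> ? ? _ _; exact: ndF.
  exists (F t) => z [y /=]; rewrite in_itv/= => /andP[_ yt] <-; exact/ndF/ltW.
have cr : cvg (F x @[x --> t^'+]).
  apply: nondecreasing_at_right_is_cvgr; near=> x; first by move=> ? ? _ _; exact: ndF.
  exists (F t) => z [y /=]; rewrite in_itv/= => /andP[ty _] <-; exact/ndF/ltW.
exists (Num.bound `|t|) => //; split.
  have := archi_boundP (normr_ge0 t); rewrite in_itv/= ltr_norml => /andP[-> ->]//.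
split => //; apply/eqP => lr; apply: nct.
have lF : lim (F x @[x --> t^'-]) <= F t.
  apply: limr_le => //; near=> x; apply: ndF; apply: ltW; near: x; exact: nbhs_left_lt.
have Fr : F t <= lim (F x @[x --> t^'+]).
  apply: limr_ge => //; near=> x; apply: ndF; apply: ltW; near: x; exact: nbhs_right_gt.
have E : lim (F x @[x --> t^'-]) = F t by apply/le_anti; rewrite lF lr Fr.
apply/left_right_continuousP; split.
  by apply: cvg_trans cl _; rewrite E.
by apply: cvg_trans cr _; rewrite -lr E.
Unshelve. all: by end_near. Qed.

(** * From weak convergence to convergence of transforms *)

Section WeakToLaplace.
Context (R : realType).
Implicit Types (mu : {measure set (measurableTypeR R) -> \bar R}).

Lemma le1_lty mu : (mu setT <= 1)%E -> (mu setT < +oo)%E.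
Proof. by move=> h; exact: le_lt_trans h (ltry _). Qed.

Lemma dfun_le1 mu t : (mu setT <= 1)%E -> dfun mu t <= 1.
Proof.
move=> mu1; apply: le_trans (dfun_le (le1_lty mu1) t) _.
by rewrite -lee_fin fineK// fin_num_finite_measure// le1_lty.
Qed.

(** By [laplace_dfun] both transforms are integrals of distribution functions against the
    exponential law, which ignores the countably many points where convergence may fail; the
    constant 1 dominates. *)
Lemma weak_cvg_laplace_seq (mu_ : nat -> {measure set (measurableTypeR R) -> \bar R})
    mu0 (v : nat -> R) (s : R) :
  (forall n, mu_ n setT <= 1)%E -> (mu0 setT <= 1)%E ->
  (forall n, mu_ n `]-oo, 0[%classic = 0%E) -> mu0 `]-oo, 0[%classic = 0%E ->
  (forall n, 0 < v n) -> 0 < s ->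
  (forall t, {for t, continuous (dfun mu0)} ->
     dfun (mu_ n) (t * v n) @[n --> \oo] --> dfun mu0 t) ->
  laplace (mu_ n) (s / v n) @[n --> \oo] --> laplace mu0 s.
Proof.
move=> mu1 mu01 muN mu0N v0 s0 wc.
have [E [Eexp Ecount]] := exponential_law s0.
have mufin n := le1_lty (mu1 n).
have -> : laplace mu0 s = fine (\int[E]_u (dfun mu0 (u * 1))%:E).
  by rewrite -(laplace_dfun (le1_lty mu01) (ltW s0) ltr01 Eexp mu0N)//= divr1.
have -> : (fun n => laplace (mu_ n) (s / v n)) =
    (fun n => fine (\int[E]_u (dfun (mu_ n) (u * v n))%:E)).
  by apply/funext => n; rewrite -(laplace_dfun (mufin n) (ltW s0) (v0 n) Eexp (muN n)).
apply: fine_cvg; rewrite fineK; last first.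
  by rewrite -(laplace_dfun (le1_lty mu01) (ltW s0) ltr01 Eexp mu0N).
have mscale mu (c : R) : (mu setT < +oo)%E ->
    measurable_fun [set: R] (fun u => (dfun mu (u * c))%:E).
  move=> fmu; apply/measurable_EFinP.
  by apply: (measurableT_comp (measurable_dfun fmu)); exact: measurable_funM.
have cD := countable_noncontinuity (dfun_nd (le1_lty mu01)).
have [] // := @dominated_convergence _ (measurableTypeR R) R E setT measurableT
  (fun n u => (dfun (mu_ n) (u * v n))%:E) (fun u => (dfun mu0 (u * 1))%:E)
  (EFin \o cst 1).
- by move=> n; exact: mscale.
- by apply: mscale; exact: le1_lty.
- exists [set t | ~ {for t, continuous (dfun mu0)}]; split.
  + exact: countable_measurable.
  + by apply: Ecount => //; exact: countable_measurable.
  + move=> u /= nu cu; apply: nu => _; rewrite mulr1.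
    by apply: cvg_EFin; [near=> n|exact: wc].
- exact: finite_measure_integrable_cst.
- apply: aeW => u n _; rewrite lee_fin ger0_norm ?dfun_ge0//.
  exact: dfun_le1.
Unshelve. all: by end_near. Qed.

Lemma weak_cvg_laplace (mu_ : R -> {measure set (measurableTypeR R) -> \bar R})
    mu0 (v : R -> R) (s : R) :
  (forall e, 0 < e <= 1 -> [/\ (mu_ e setT <= 1)%E,
     mu_ e `]-oo, 0[%classic = 0%E & 0 < v e]) ->
  (mu0 setT <= 1)%E -> mu0 `]-oo, 0[%classic = 0%E -> 0 < s ->
  (forall t, {for t, continuous (dfun mu0)} ->
     dfun (mu_ e) (t * v e) @[e --> 0^'+] --> dfun mu0 t) ->
  laplace (mu_ e) (s / v e) @[e --> 0^'+] --> laplace mu0 s.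
Proof.
move=> H mu01 mu0N s0 wc; apply/cvg_at_rightP => u [u0 ucvg].
have [N _ uN] : \forall n \near \oo, u n <= 1.
  by apply: (@cvgr_le _ _ _ _ _ _ ucvg); exact: ltr01.
(* The measures are controlled for [0 < e <= 1] only, so the sequence starts where [u n <= 1]. *)
rewrite -(cvg_shiftn N).
have H' n : 0 < u (n + N)%N <= 1 by rewrite u0/= uN//= leq_addl.
apply: (weak_cvg_laplace_seq (mu_ := fun n => mu_ (u (n + N)%N))
  (v := fun n => v (u (n + N)%N))) => //.
- by move=> n; have [] := H _ (H' n).
- by move=> n; have [] := H _ (H' n).
- by move=> n; have [] := H _ (H' n).
- move=> t /wc /cvg_at_rightP /(_ u (conj u0 ucvg)).
  by rewrite -(cvg_shiftn N).
Qed.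

End WeakToLaplace.

(** * Paths of a Markov renewal process *)

Section MarkovPaths.
Context (R : realType) (M : nat) (X : markov_renewal_process R M).
Local Notation P := (mrp_prob X).
Local Notation eta := (mrp_eta (m := X)).
Local Notation kappa := (mrp_kappa (m := X)).
Local Notation Q := (mrp_Q X).
Implicit Types (x : nat -> 'I_M) (t : nat -> R) (s : R).

Lemma mrp_Q_le1 a b : (Q a b setT <= 1)%E.
Proof.
rewrite -(mrp_Q_total X a) (bigD1 b)//= leeDl// sume_ge0//.
Qed.

Lemma mrp_Q_lty a b : (Q a b setT < +oo)%E.
Proof. exact/le1_lty/mrp_Q_le1. Qed.

Lemma measurable_eta_pred l (A : pred 'I_M) :
  measurable_fun setT (fun w => (A (eta l w))%:R : R).
Proof.
pose B := \bigcup_(a in [set a | A a]) [set w | eta l w = a].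
have -> : (fun w => (A (eta l w))%:R : R) = \1_B.
  apply/funext => w; rewrite indicE; congr (nat_of_bool _)%:R.
  apply/idP/idP => [Aw|]; rewrite inE; first by exists (eta l w).
  by move=> [a /= Aa]; rewrite /= => ->.
apply: measurable_indic; apply: fin_bigcup_measurable => // a _.
exact: mrp_eta_measurable.
Qed.

Definition path_weight x n w : R := \prod_(l < n.+1) (eta l w == x l)%:R.

Lemma measurable_path_weight x n : measurable_fun setT (path_weight x n).
Proof.
apply: measurable_prod => l _.
exact: (measurable_eta_pred l (pred1 (x l))).
Qed.

(** Iterated Markov property on half-lines. The test set for [kappa 0] is [setT], because the
    initial time does not count; the threshold [t l] belongs to [kappa l.+1]. *)
Lemma prob_path x t n :
  P [set w | forall l, (l <= n)%N -> eta l w = x l /\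
       (if l is l'.+1 then `]-oo, t l']%classic else setT : set R) (kappa l w)] =
  (fine (P (starts_from (x 0%N))) *
    \prod_(l < n) dfun (Q (x l) (x l.+1)) (t l))%:E.
Proof.
elim: n => [|n IH].
  rewrite big_ord0 mulr1 fineK; last by apply: fin_num_measure; exact: mrp_eta_measurable.
  congr (P _); apply/seteqP; split => w /=; first by case/(_ 0%N isT).
  by move=> w0 [|//] _.
rewrite big_ord_recr/= mulrA EFinM -IH /dfun fineK; last first.
  by apply: fin_num_finite_measure => //; exact: mrp_Q_lty.
rewrite -(@mrp_markov _ _ X n x
  (fun l => if l is l'.+1 then `]-oo, t l']%classic else setT)); last by case.
congr (P _); apply/seteqP; split => w /=.
  move=> h; split => [l ln|]; first by apply: h; exact: leqW.
  by have [-> ] := h n.+1 (leqnn _); rewrite /= in_itv.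
move=> [h1 h2] l; rewrite leq_eqVlt ltnS => /orP[/eqP ->|]; last exact: h1.
by rewrite /= in_itv.
Qed.

(* Interpolates between indicators and Laplace kernels: the first [m] sojourn
   times carry the kernel. *)
Definition mixed_weight s m t n w : R :=
  \prod_(l < n) (if (l < m)%N then expR (- (s * kappa l.+1 w))
                 else (kappa l.+1 w <= t l)%R%:R).

(** The predicate [A] allows a factor to be left out, as happens when one sojourn time is singled
    out for Fubini. *)
Lemma measurable_mixed_weight s m t n (A : pred 'I_n) : measurable_fun setT
  (fun w => \prod_(l < n | A l) (if (l < m)%N then expR (- (s * kappa l.+1 w))
                 else (kappa l.+1 w <= t l)%R%:R) : R).
Proof.
under eq_fun do rewrite big_mkcond/=.
apply: measurable_prod => l _; case: (A l) => //; case: (l < m)%N.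
  exact: (measurableT_comp (measurable_laplace_kernel s) (mrp_kappa_measurable _)).
pose B := kappa l.+1 @^-1` `]-oo, t l]%classic.
rewrite (_ : (fun _ => _) = \1_B); last first.
  apply/funext => w; rewrite indicE; congr (nat_of_bool _)%:R.
  by apply/idP/idP; rewrite inE/= /B /= in_itv.
apply: measurable_indic; rewrite -[B]setTI.
exact: mrp_kappa_measurable.
Qed.

Lemma path_weight_ge0 x n w : 0 <= path_weight x n w.
Proof. exact: prodr_ge0. Qed.

(** Induction on the number [m] of kernels, starting from [prob_path]. In the step, Fubini turns the
    kernel of index [m] into an indicator with threshold [u]; the induction hypothesis evaluates the
    inner integral, and [laplace_dfun] integrates the factor [dfun] in [u] back to a transform. *)
Lemma integral_mixed_weight s m x t n : 0 < s ->
  (\int[P]_w (path_weight x n w * mixed_weight s m t n w)%:E =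
   (fine (P (starts_from (x 0%N))) *
     \prod_(l < n) (if (l < m)%N then laplace (Q (x l) (x l.+1)) s
                    else dfun (Q (x l) (x l.+1)) (t l)))%:E)%E.
Proof.
move=> s0; elim: m t => [|m IH] t.
  rewrite (eq_bigr (fun l : 'I_n => dfun (Q (x l) (x l.+1)) (t l)))//.
  rewrite -prob_path; set S := (X in P X).
  have SE : (fun w => path_weight x n w * mixed_weight s 0 t n w) = \1_S.
    apply/funext => w; rewrite indicE; have [/set_mem Sw|Sw] := boolP (w \in S).
      rewrite /path_weight /mixed_weight !big1 ?mulr1//.
        by move=> l _ /=; have /= [_] := Sw l.+1 (ltn_ord l); rewrite in_itv/= => ->.
      by move=> l _; have [-> _] := Sw l (ltn_ord l); rewrite eqxx.
    apply/eqP; apply: contraNT Sw; rewrite mulf_eq0 negb_or => /andP[h1 h2].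
    rewrite inE => -[|l] ln; split => //.
    - have /prodf_neq0 /(_ ord0 isT) := h1.
      by rewrite pnatr_eq0 eqb0 negbK => /eqP.
    - have /prodf_neq0 /(_ (Ordinal (ln : (l.+1 < n.+1)%N)) isT) := h1.
      by rewrite pnatr_eq0 eqb0 negbK => /eqP.
    - have /prodf_neq0 /(_ (Ordinal ln : 'I_n) isT) := h2.
      by rewrite /= pnatr_eq0 eqb0 negbK in_itv.
  have mS : measurable S.
    apply/(@measurable_indicP _ _ R); rewrite -SE; apply: measurable_funM.
      exact: measurable_path_weight.
    exact: (@measurable_mixed_weight s 0 t n predT).
  rewrite -[X in P X]setIT -integral_indic//.
  by apply: eq_integral => w _; congr EFin; exact: (congr1 (@^~ w) SE).
(* From length [n] on, every factor already carries a kernel. *)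
have [nm|mn] := leqP n m.
  have E (T : Type) (a b : T) (l : 'I_n) : (if (l < m.+1)%N then a else b) =
      (if (l < m)%N then a else b).
    by rewrite (ltn_trans (ltn_ord l)) ?ltnS// (leq_trans (ltn_ord l)).
  rewrite /mixed_weight; under eq_integral do under eq_bigr do rewrite E.
  by rewrite IH; under [in RHS]eq_bigr do rewrite E.
have [E [Eexp _]] := exponential_law s0.
pose V w : R := path_weight x n w * \prod_(l < n | l != Ordinal mn)
   (if (l < m)%N then expR (- (s * kappa l.+1 w)) else (kappa l.+1 w <= t l)%R%:R).
transitivity (\int[P]_w (V w * expR (- (s * kappa m.+1 w)))%:E)%E.
  apply: eq_integral => w _; congr EFin.
  rewrite /V /mixed_weight (bigD1 (Ordinal mn))//= leqnn -mulrA; congr (_ * _).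
  rewrite mulrC; congr (_ * _); apply: eq_bigr => l lm.
  by rewrite ltnS leq_eqVlt -val_eqE/= in lm *; rewrite (negbTE lm).
rewrite (integral_expR_exponential Eexp).
- pose t' u l := if l == m then u else t l.
  transitivity (\int[E]_u (\int[P]_w (path_weight x n w * mixed_weight s m (t' u) n w)%:E))%E.
    apply: eq_integral => u _; apply: eq_integral => w _; congr EFin.
    rewrite /V /mixed_weight -mulrA; congr (_ * _).
    rewrite [RHS](bigD1 (Ordinal mn))//= ltnn /t' eqxx mulrC; congr (_ * _).
    by apply: eq_bigr => l; rewrite -val_eqE/= => /negbTE ->.
  under eq_integral => u _.
    rewrite IH (bigD1 (Ordinal mn))//= ltnn /t' eqxx mulrCA mulrC.
    rewrite (eq_bigr (fun l : 'I_n => if (l < m)%N then laplace (Q (x l) (x l.+1)) s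
      else dfun (Q (x l) (x l.+1)) (t l))); last first.
      by move=> l; rewrite -val_eqE/= => /negbTE ->.
    over.
  pose c := fine (P (starts_from (x 0%N))) * \prod_(l < n | l != Ordinal mn)
    (if (l < m)%N then laplace (Q (x l) (x l.+1)) s
     else dfun (Q (x l) (x l.+1)) (t l)).
  rewrite -/c; have c0 : 0 <= c.
    rewrite mulr_ge0 ?fine_ge0// prodr_ge0// => l _.
    by case: ifPn => _; [exact: laplace_ge0|exact: dfun_ge0].
  under eq_integral do rewrite EFinM.
  rewrite ge0_integralZl//; last 2 first.
  + by apply/measurable_EFinP; apply: measurable_dfun; exact: mrp_Q_lty.
  + by move=> u _; rewrite lee_fin dfun_ge0.
  under eq_integral do rewrite -[u in dfun _ u]mulr1.
  rewrite -(laplace_dfun (mrp_Q_lty _ _) (ltW s0) ltr01 Eexp (mrp_Q_ge0 _ _ _)).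
  rewrite -EFinM divr1; congr EFin; rewrite /c [in RHS](bigD1 (Ordinal mn))//= leqnn.
  rewrite mulrCA mulrC; congr (_ * (_ * _)); apply: eq_bigr => l.
  by rewrite -val_eqE/= => /negbTE lm; rewrite [in RHS]ltnS [in RHS](leq_eqVlt l m) lm.
- by rewrite (le_lt_trans (probability_le1 _ _))// ltry.
- apply: measurable_funM; first exact: measurable_path_weight.
  exact: measurable_mixed_weight.
- exact: mrp_kappa_measurable.
- move=> w; rewrite mulr_ge0 ?path_weight_ge0// prodr_ge0// => l _.
  by case: ifPn => _//; exact: expR_ge0.
- by move=> w; right; exact: mrp_kappa_ge0.
Qed.

Lemma integral_path_weight s x n : 0 < s ->
  (\int[P]_w (path_weight x n w *
       expR (- (s * \sum_(1 <= l < n.+1) kappa l w)))%:E =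
   (fine (P (starts_from (x 0%N))) *
     \prod_(l < n) laplace (Q (x l) (x l.+1)) s)%:E)%E.
Proof.
(* All [n] factors carry the kernel, so the thresholds are dummies. *)
move=> s0; have := @integral_mixed_weight s n x (fun=> 0) n s0.
rewrite [in RHS](eq_bigr (fun l : 'I_n => laplace (Q (x l) (x l.+1)) s)); last first.
  by move=> l _; rewrite ltn_ord.
move=> <-; apply: eq_integral => w _; congr (_ * _)%:E.
rewrite /mixed_weight big_add1/= big_mkord mulr_sumr -sumrN expR_sum.
by apply: eq_bigr => l _; rewrite ltn_ord.
Qed.

End MarkovPaths.

(** * Sums over the paths that avoid the domain *)

Section AvoidingPaths.
Context (R : realType) (M : nat) (X : markov_renewal_process R M)
  (D : {set 'I_M}) (k : 'I_M) (s : R).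
Local Notation P := (mrp_prob X).
Local Notation eta := (mrp_eta (m := X)).
Local Notation kappa := (mrp_kappa (m := X)).
Local Notation Q := (mrp_Q X).
Implicit Types (x : nat -> 'I_M).

(* The first [m] states avoid [D] and the next [n.+1] follow [x]; the free tail
   makes the induction on [m] go through. *)
Definition avoid_weight m n x w : R :=
  (eta 0 w == k)%:R * \prod_(l < m) (eta l w \notin D)%:R *
  \prod_(l < n.+1) (eta (m + l)%N w == x l)%:R.

(** Transform of the time spent on the paths of length [m] from [k] to [y] whose states before the
    last lie outside [D]; the last state [y] is unrestricted. *)
Fixpoint avoid_laplace (m : nat) (y : 'I_M) : R :=
  if m is m'.+1 then
    \sum_(x | x \notin D) avoid_laplace m' x * laplace (Q x y) s
  else (y == k)%:R.

Lemma avoid_weight_ge0 m n x w : 0 <= avoid_weight m n x w.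
Proof. by rewrite !mulr_ge0// prodr_ge0. Qed.

Lemma measurable_avoid_weight m n x : measurable_fun setT (avoid_weight m n x).
Proof.
apply: measurable_funM; first apply: measurable_funM.
- exact: (measurable_eta_pred 0 (pred1 k)).
- apply: measurable_prod => l _.
  exact: (measurable_eta_pred l (fun a => a \notin D)).
- apply: measurable_prod => l _.
  exact: (measurable_eta_pred (m + l) (pred1 (x l))).
Qed.

Lemma measurable_sum_kappa n :
  measurable_fun setT (fun w => \sum_(1 <= l < n.+1) kappa l w).
Proof. by apply: measurable_sum => l; exact: mrp_kappa_measurable. Qed.

(** Splitting according to the state [y] at time [m] moves this state from the avoiding stretch to
    the head of the prescribed path. *)
Lemma avoid_weightS m n x w : avoid_weight m.+1 n x w =
  \sum_(y | y \notin D)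
    avoid_weight m n.+1 (fun l => if l is l'.+1 then x l' else y) w.
Proof.
rewrite /avoid_weight big_ord_recr/=.
under [RHS]eq_bigr do rewrite big_ord_recl/= addn0.
have E : (eta m w \notin D)%:R = \sum_(y | y \notin D) (eta m w == y)%:R :> R.
  rewrite big_mkcond (bigD1 (eta m w))//= eqxx big1 ?addr0; first by case: (_ \notin _).
  by move=> y /negbTE ym; rewrite eq_sym ym; case: ifP.
rewrite E mulrA mulr_sumr mulr_suml; apply: eq_bigr => y _.
rewrite -!mulrA; congr (_ * (_ * (_ * _))); apply: eq_bigr => l _.
by rewrite /= /bump/= add1n addnS.
Qed.

Lemma integral_avoid_weight m n x : 0 < s ->
  (\int[P]_w (avoid_weight m n x w *
       expR (- (s * \sum_(1 <= l < (m + n).+1) kappa l w)))%:E =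
   (fine (P (starts_from k)) * avoid_laplace m (x 0%N) *
     \prod_(l < n) laplace (Q (x l) (x l.+1)) s)%:E)%E.
Proof.
move=> s0; elim: m n x => [|m IH] n x.
  have [xk|xk] := eqVneq (x 0%N) k.
    rewrite /= xk eqxx mulr1 -xk -integral_path_weight//; apply: eq_integral => w _.
    congr (_ * _)%:E; rewrite /avoid_weight big_ord0 mulr1 /path_weight !big_ord_recl/=.
    by rewrite mulrA -xk; case: (_ == _); rewrite ?mul1r ?mul0r.
  rewrite /= (negbTE xk) mulr0 mul0r integral0_eq// => w _.
  rewrite /avoid_weight big_ord0 mulr1 big_ord_recl/=.
  have [->|] := eqVneq (eta 0 w) k; last by rewrite !mul0r.
  by rewrite eq_sym (negbTE xk) !(mul0r, mulr0).
under eq_integral do rewrite avoid_weightS mulr_suml -sumEFin addSnnS -big_filter.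
rewrite ge0_integral_sum//; last 2 first.
- move=> y; apply/measurable_EFinP; apply: measurable_funM.
    exact: measurable_avoid_weight.
  exact: (measurableT_comp (measurable_laplace_kernel s) (measurable_sum_kappa _)).
- by move=> y w _; rewrite lee_fin mulr_ge0 ?avoid_weight_ge0// expR_ge0.
rewrite big_filter; under eq_bigr do rewrite IH big_ord_recl/= mulrA.
rewrite sumEFin; congr EFin; rewrite -mulr_suml; congr (_ * _).
by rewrite mulr_sumr; apply: eq_bigr => y _; rewrite !mulrA.
Qed.

End AvoidingPaths.

(** [W] is a real-valued indicator, and [m] is the law of [S] on the event that [W] is 1. A single
    measure has to yield both the probabilities of the hitting events and the integrals over
    paths. *)
Lemma weighted_law d (T : measurableType d) (R : realType) (P : probability T R)
    (W S : T -> R) :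
  measurable_fun setT W -> measurable_fun setT S ->
  (forall w, W w = 0 \/ W w = 1) -> (forall w, 0 <= S w) ->
  exists m : {measure set (measurableTypeR R) -> \bar R},
    (forall B, measurable B -> m B = P [set w | W w = 1 /\ B (S w)]) /\
    (forall s, (\int[m]_(t in `[0%R, +oo[) (expR (- (s * t)))%:E =
       \int[P]_w (W w * expR (- (s * S w)))%:E)%E).
Proof.
move=> mW mS W01 S0.
(* [-1] discards the points of weight 0 from the image in [0, +oo[ *)
pose S' w : R := if 0 < W w then S w else -1.
have mS' : measurable_fun setT (S' : T -> measurableTypeR R).
  by apply: measurable_fun_ifT => //; exact: measurable_fun_ltr.
pose m : {measure set (measurableTypeR R) -> \bar R} :=
  mrestr (measure_function_pushforward__canonical__measure_function_Measure P mS')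
         (measurable_itv `[0%R, +oo[).
exists m; split => [B mB|s].
  rewrite /m /mrestr/= /pushforward; congr (P _); apply/seteqP; split => w /=.
    rewrite /S'; have [->|->] := W01 w; rewrite ?ltxx ?ltr01 in_itv/= andbT.
      by move=> [_]; rewrite ler0N1.
    by move=> [].
  by move=> [W1 BS]; rewrite /S' W1 ltr01 in_itv/= andbT S0.
rewrite (@eq_measure_integral _ _ _ _ (measure_function_pushforward__canonical__measure_function_Measure P mS')); last first.
  by move=> A mA AD; rewrite -[in RHS](setIidl AD).
rewrite ge0_integral_pushforward//; last first.
- by apply/measurable_funTS/measurable_EFinP; exact: measurable_laplace_kernel.
rewrite integral_mkcond; apply: eq_integral => w _; rewrite patchE.
have [W1|W1] := W01 w.
  rewrite ifF ?W1 ?mul0r//; apply/negP; rewrite inE/= /S' W1 ltxx in_itv/= andbT.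
  by rewrite ler0N1.
by rewrite ifT ?W1 ?mul1r/= /S' ?W1 ?ltr01// inE/= W1 ltr01 in_itv/= S0.
Qed.

(** * The hitting law as a measure *)

Section HittingLaw.
Context (R : realType) (M : nat) (X : markov_renewal_process R M)
  (D : {set 'I_M}) (k j : 'I_M).
Local Notation P := (mrp_prob X).
Local Notation eta := (mrp_eta (m := X)).
Local Notation kappa := (mrp_kappa (m := X)).
Local Notation Q := (mrp_Q X).
Hypotheses (kD : k \notin D) (jD : j \in D).
Hypothesis k_gt0 : (0 < P (starts_from k))%E.

(** Hitting [D] in [j] at time [n.+1]. The shift accounts for hitting times being at least 1; that
    state 0 also avoids [D] is consistent with a start at [k]. *)
Let W n := avoid_weight (X := X) D k n.+1 0 (fun=> j).
Let S n w := \sum_(1 <= m < n.+2) kappa m w.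

Let W01 n w : W n w = 0 \/ W n w = 1.
Proof.
rewrite /W /avoid_weight; case: (_ == k); last by left; rewrite !mul0r.
rewrite mul1r big_ord1; case: (_ == j); last by left; rewrite mulr0.
rewrite mulr1; elim/big_ind : _ => [|x y [->|->] [->|->]|l _].
- by right.
- by left; rewrite mul0r.
- by left; rewrite mul0r.
- by left; rewrite mulr0.
- by right; rewrite mulr1.
- by case: (_ \notin _); [right|left].
Qed.

Let W1E n w : W n w = 1 <->
  [/\ starts_from k w, hits_at D n.+1 w & eta n.+1 w = j].
Proof.
rewrite /W /avoid_weight big_ord1 addn0; split.
  have [e0|] := eqVneq (eta 0 w) k; last by rewrite !mul0r => _ /eqP; rewrite eq_sym oner_eq0.
  have [en|] := eqVneq (eta n.+1 w) j; last by rewrite mulr0 => _ /eqP; rewrite eq_sym oner_eq0.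
  rewrite mul1r mulr1 => h; split => //; split => //; first by rewrite en.
  move=> m /andP[_ mn]; have : \prod_(l < n.+1) (eta l w \notin D)%:R != 0 :> R.
    by rewrite h oner_eq0.
  by move/prodf_neq0 => /(_ (Ordinal mn) isT); rewrite pnatr_eq0 eqb0 negbK.
move=> [e0 [_ _ h] en]; rewrite e0 en !eqxx mul1r mulr1 big1// => -[[|l] ln] _ /=.
  by rewrite e0 kD.
by rewrite h.
Qed.

(** The events of hitting at time [n.+1] are disjoint, so the law is the series of the measures of
    [weighted_law], scaled by the inverse of the probability of starting at [k]. That factor cancels
    in the transforms given by [integral_avoid_weight]. *)
Lemma hitting_law : exists H : {measure set (measurableTypeR R) -> \bar R},
  [/\ (H setT <= 1)%E, H `]-oo, 0[%classic = 0%E,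
      forall t, dfun H t = hitting_dfun X D k j t &
      forall s, 0 < s -> (laplace H s)%:E =
        (\sum_(0 <= n <oo) (avoid_laplace X D k s n.+1 j)%:E)%E].
Proof.
have mW n : measurable_fun setT (W n) := @measurable_avoid_weight _ _ X D k n.+1 0 (fun=> j).
have mS n : measurable_fun setT (S n) := @measurable_sum_kappa _ _ X n.+1.
have S0 n w : 0 <= S n w by apply: sumr_ge0 => m _; exact: mrp_kappa_ge0.
have [m_ m_E] := choice (fun n => weighted_law P (mW n) (mS n) (W01 n) (S0 n)).
have pfin : P (starts_from k) \is a fin_num.
  by apply: fin_num_measure; exact: mrp_eta_measurable.
have p0 : 0 < fine (P (starts_from k)) by rewrite fine_gt0// k_gt0 ltey_eq pfin.
set p := fine _ in p0.
have pV0 : 0 <= p^-1 by rewrite invr_ge0 ltW.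
pose H : {measure set (measurableTypeR R) -> \bar R} := mscale (NngNum pV0) (mseries m_ 0).
have HE B : measurable B -> H B =
    (p^-1%:E * P (\bigcup_n [set w | W n w = 1%R /\ B (S n w)]))%E.
  move=> mB; rewrite /H /mscale/= /mseries; congr (_ * _)%E.
  have mE n : measurable [set w | W n w = 1 /\ B (S n w)].
    rewrite (_ : [set _ | _] = (W n @^-1` [set 1]) `&` (S n @^-1` B))//.
    by apply: measurableI; rewrite -[X in measurable X]setTI; [exact: mW|exact: mS].
  rewrite measure_semi_bigcup//; last 2 first.
  - apply/trivIsetP => n1 n2 _ _ n12; apply/seteqP; split => // w /=.
    move=> [[/W1E[_ [_ h1 h1'] _] _] [/W1E[_ [_ h2 h2'] _] _]].
    move: n12; rewrite neq_ltn => /orP[n12|n21].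
    + by have := h2' n1.+1; rewrite h1 /= ltnS n12 => /(_ isT).
    + by have := h1' n2.+1; rewrite h2 /= ltnS n21 => /(_ isT).
  - exact: bigcup_measurable.
  by apply: eq_eseriesr => n _; rewrite (m_E n).1.
exists H; have H1 : (H setT <= 1)%E.
  rewrite HE// [leRHS](_ : 1 = p^-1%:E * p%:E)%E; last first.
    by rewrite -EFinM mulVf// gt_eqF.
  rewrite lee_pmul2l ?lte_fin ?invr_gt0//.
  rewrite fineK//; apply: le_measure; rewrite ?inE.
  - apply: bigcup_measurable => n _.
    rewrite (_ : [set _ | _] = W n @^-1` [set 1]); last first.
      by apply/seteqP; split => w //= -[].
    by rewrite -[X in measurable X]setTI; exact: mW.
  - exact: mrp_eta_measurable.
  - by move=> w [n _ /= [/W1E[]]].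
split => //.
- rewrite HE// (_ : \bigcup_n _ = set0) ?measure0 ?mule0//.
  apply/seteqP; split => // w [n _ /= [_]]; rewrite in_itv/=.
  by rewrite ltNge S0.
- move=> t; rewrite /dfun HE// fineM//; last first.
    apply: fin_num_measure; apply: bigcup_measurable => n _.
    rewrite (_ : [set _ | _] = (W n @^-1` [set 1]) `&` (S n @^-1` `]-oo, t]%classic))//.
    by apply: measurableI; rewrite -[X in measurable X]setTI; [exact: mW|exact: mS].
  rewrite /hitting_dfun mulrC -/p; congr (fine (P _) * _).
  apply/seteqP; split => w.
    move=> [n _ /= [/W1E[h0 h1 h2]]]; rewrite in_itv/= => h3.
    by split => //; exists n.+1.
  move=> [[[|n] [h1 h2 h3] h0]]; first by case: h1.
  by exists n => //=; split; [apply/W1E|rewrite in_itv].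
- move=> s s0; rewrite laplaceE ?(ltW s0) ?le1_lty//.
  have mf : measurable_fun (`[0%R, +oo[%classic : set (measurableTypeR R))
      (fun t => (expR (- (s * t)))%:E).
    by apply/measurable_funTS/measurable_EFinP; exact: measurable_laplace_kernel.
  rewrite ge0_integral_mscale//.
  rewrite ge0_integral_measure_series//.
  rewrite -nneseriesZl; last first.
    by move=> n _; apply: integral_ge0 => t _; rewrite lee_fin expR_ge0.
  apply: eq_eseriesr => n _; rewrite (m_E n).2.
  have := @integral_avoid_weight _ _ X D k s n.+1 0 (fun=> j) s0.
  rewrite addn0 => ->; rewrite big_ord0 mulr1 -EFinM; congr EFin.
  by rewrite mulrA mulVf ?gt_eqF// mul1r.
Qed.

End HittingLaw.

(** * Hitting laws with two transient states *)

(** The partial sums [A] and [B] obey the same recursion with a source term 1 in [B]. Monotonicity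
    turns the recursion into linear inequalities, which bound the sums since the determinant is
    positive; their limits solve the linear system. *)
Lemma two_state_series (R : realType) (a b : nat -> R) (qii qik qki qkk c d : R) :
  a 0%N = 0 -> b 0%N = 1 ->
  (forall n, a n.+1 = a n * qii + b n * qki) ->
  (forall n, b n.+1 = a n * qik + b n * qkk) ->
  0 <= qii -> 0 <= qik -> 0 <= qki -> 0 <= qkk -> 0 <= c -> 0 <= d ->
  qii < 1 -> qkk < 1 -> 0 < (1 - qii) * (1 - qkk) - qik * qki ->
  (\sum_(0 <= n <oo) (a n * c + b n * d)%:E)%E =
  ((qki * c + (1 - qii) * d) / ((1 - qii) * (1 - qkk) - qik * qki))%:E.
Proof.
move=> a0 b0 aS bS hii hik hki hkk hc hd ii1 kk1 D0.
set Delta := (1 - qii) * _ - _ in D0 *.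
have [an bn] : (forall n, 0 <= a n) /\ (forall n, 0 <= b n).
  apply: all_and2; elim => [|n [IHa IHb]]; first by rewrite a0 b0.
  by rewrite aS bS !addr_ge0 ?mulr_ge0.
pose A n := \sum_(0 <= m < n) a m; pose B n := \sum_(0 <= m < n) b m.
have Arec n : A n.+1 = A n + a n by rewrite /A big_nat_recr.
have Brec n : B n.+1 = B n + b n by rewrite /B big_nat_recr.
have AS n : A n.+1 = A n * qii + B n * qki.
  elim: n => [|n IH]; first by rewrite /A /B big_nat1 !big_geq// a0 !mul0r addr0.
  by rewrite (Arec n.+1) {1}IH aS (Arec n) (Brec n); ring.
have BS n : B n.+1 = 1 + (A n * qik + B n * qkk).
  elim: n => [|n IH]; first by rewrite /A /B big_nat1 !big_geq// b0 !mul0r !addr0.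
  by rewrite (Brec n.+1) {1}IH bS (Arec n) (Brec n); ring.
have A0 n : 0 <= A n by apply: sumr_ge0.
have B0 n : 0 <= B n by apply: sumr_ge0.
have An n : A n <= A n.+1 by rewrite /A big_nat_recr//= lerDl.
have Bn n : B n <= B n.+1 by rewrite /B big_nat_recr//= lerDl.
(* Eliminating [A n] from the two inequalities leaves [B n * Delta <= 1 - qii]. *)
have Bbnd n : B n <= (1 - qii) / Delta.
  rewrite ler_pdivlMr//.
  have h1 : A n * (1 - qii) <= B n * qki by have := An n; rewrite AS; lra.
  have h2 : B n * (1 - qkk) <= 1 + A n * qik by have := Bn n; rewrite BS; lra.
  have h3 : qik * (A n * (1 - qii)) <= qik * (B n * qki) by rewrite ler_wpM2l.
  have h4 : (1 - qii) * (B n * (1 - qkk)) <= (1 - qii) * (1 + A n * qik).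
    by rewrite ler_wpM2l// subr_ge0 ltW.
  by rewrite /Delta; lra.
have Abnd n : A n <= (1 - qii) / Delta * qki / (1 - qii).
  rewrite ler_pdivlMr ?subr_gt0//.
  apply: le_trans (_ : B n * qki <= _); last by rewrite ler_wpM2r.
  by have := An n; rewrite AS; lra.
have cA : cvg (A n @[n --> \oo]).
  apply: nondecreasing_is_cvgn; first exact/nondecreasing_seqP.
  by exists ((1 - qii) / Delta * qki / (1 - qii)) => _ [n _ <-].
have cB : cvg (B n @[n --> \oo]).
  apply: nondecreasing_is_cvgn; first exact/nondecreasing_seqP.
  by exists ((1 - qii) / Delta) => _ [n _ <-].
set la := lim (A n @[n --> \oo]) in cA *; set lb := lim (B n @[n --> \oo]) in cB *.
have Ela : la = la * qii + lb * qki.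
  apply: (@cvg_unique _ _ (A n.+1 @[n --> \oo])) => //.
    by move: cA; rewrite /= -(cvg_shiftS A).
  rewrite /=; under eq_fun do rewrite AS.
  by apply: cvgD; apply: cvgM => //; exact: cvg_cst.
have Elb : lb = 1 + (la * qik + lb * qkk).
  apply: (@cvg_unique _ _ (B n.+1 @[n --> \oo])) => //.
    by move: cB; rewrite /= -(cvg_shiftS B).
  rewrite /=; under eq_fun do rewrite BS.
  apply: cvgD; first exact: cvg_cst.
  by apply: cvgD; apply: cvgM => //; exact: cvg_cst.
have -> : (qki * c + (1 - qii) * d) / Delta = la * c + lb * d.
  have elb : lb * Delta = 1 - qii.
    have -> : lb * Delta = (1 - qii) * (lb - lb * qkk) - qik * (lb * qki).
      by rewrite /Delta; ring.
    have -> : lb * qki = la * (1 - qii) by lra.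
    have -> : lb - lb * qkk = 1 + la * qik by lra.
    by ring.
  have ela : la * Delta = qki.
    apply: (@mulfI _ (1 - qii)); first by rewrite subr_eq0 gt_eqF.
    rewrite mulrA mulrC (_ : (1 - qii) * la = lb * qki); last by lra.
    by rewrite -elb; ring.
  by apply: (canLR (mulfK _)); [rewrite gt_eqF|rewrite -ela -elb; ring].
apply/cvg_lim => //.
have -> : (fun n => (\sum_(0 <= i < n) (a i * c + b i * d)%:E)%E) =
    EFin \o (fun n => A n * c + B n * d).
  apply/funext => n /=; rewrite sumEFin; congr EFin.
  by rewrite /A /B !mulr_suml -big_split.
apply: cvg_EFin; first by near=> n.
by apply: cvgD; apply: cvgM => //; exact: cvg_cst.
Unshelve. all: by end_near. Qed.

Section TwoStates.
Context (R : realType) (M : nat) (X : markov_renewal_process R M)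
  (D : {set 'I_M}) (i k j : 'I_M).
Local Notation Q := (mrp_Q X).
Hypotheses (ik : i != k) (DC : ~: D = [set i; k]%SET) (jD : j \in D).
Hypothesis k_gt0 : (0 < mrp_prob X (starts_from k))%E.

Lemma notin_two_states y : (y \notin D) = (y == i) || (y == k).
Proof. by rewrite -finset.in_setC DC !inE. Qed.

(** Cramer's rule for the unknown of [k] in [x_r = q r j + q r i * x_i + q r k * x_k], with [r] in
    [i], [k]. *)
Definition hitting_laplace (q : 'I_M -> 'I_M -> R) : R :=
  (q k i * q i j + (1 - q i i) * q k j) /
  ((1 - q i i) * (1 - q k k) - q i k * q k i).

Hypotheses (ii1 : jump_prob X i i < 1) (kk1 : jump_prob X k k < 1).
Hypothesis det_gt0 : 0 < (1 - jump_prob X i i) * (1 - jump_prob X k k) -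
  jump_prob X i k * jump_prob X k i.

Lemma laplace_le_jump_prob a b s : 0 <= s -> laplace (Q a b) s <= jump_prob X a b.
Proof.
move=> s0; have fQ := mrp_Q_lty X a b.
apply: (@le_trans _ _ (laplace (Q a b) 0)).
  by apply: laplace_decr => //; rewrite lexx.
rewrite laplace0 fine_le// ?fin_num_finite_measure//.
by apply: le_measure; rewrite ?inE.
Qed.

(** Transforms are dominated by the jump probabilities, so the determinant at [s] is at least
    [det_gt0]'s. *)
Lemma det_laplace_gt0 s : 0 <= s ->
  [/\ laplace (Q i i) s < 1, laplace (Q k k) s < 1 &
   0 < (1 - laplace (Q i i) s) * (1 - laplace (Q k k) s) -
       laplace (Q i k) s * laplace (Q k i) s].
Proof.
move=> s0; have le a b := laplace_le_jump_prob a b s0.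
have ge a b : 0 <= laplace (Q a b) s := laplace_ge0 _ _.
split; [exact: le_lt_trans (le i i) ii1|exact: le_lt_trans (le k k) kk1|].
apply: lt_le_trans det_gt0 _; apply: lerB; last exact: ler_pM.
by apply: ler_pM; rewrite ?subr_ge0 ?lerD2l ?lerN2 ?le// ltW.
Qed.

Lemma hitting_law_two_states : exists H : {measure set (measurableTypeR R) -> \bar R},
  [/\ (H setT <= 1)%E, H `]-oo, 0[%classic = 0%E,
      forall t, dfun H t = hitting_dfun X D k j t &
      forall s, 0 <= s ->
        laplace H s = hitting_laplace (fun a b => laplace (Q a b) s)].
Proof.
have kD : k \notin D by rewrite notin_two_states eqxx orbT.
have [H [H1 H0 Hd Hs]] := hitting_law kD jD k_gt0.
exists H; split => //.
have main s : 0 < s -> laplace H s = hitting_laplace (fun a b => laplace (Q a b) s).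
  move=> s0; apply: EFin_inj; rewrite Hs//.
  have [q1 q2 q3] := det_laplace_gt0 (ltW s0).
  have bS m y : avoid_laplace X D k s m.+1 y =
      avoid_laplace X D k s m i * laplace (Q i y) s +
      avoid_laplace X D k s m k * laplace (Q k y) s.
    rewrite /= (eq_bigl (fun y => (y == i) || (y == k))); last first.
      by move=> x; rewrite notin_two_states.
    rewrite (bigD1 i) ?eqxx//= (bigD1 k)/=; last by rewrite eqxx orbT eq_sym.
    rewrite big1 ?addr0// => x; case: (x == i); case: (x == k) => //=.
  under eq_eseriesr do rewrite bS.
  apply: two_state_series => //; try exact: laplace_ge0.
  - by rewrite /= (negbTE ik).
  - by rewrite /= eqxx.
move=> s; rewrite le_eqVlt => /orP[/eqP <-|]; last exact: main.
(* at [s = 0] the identity follows by continuity from [s > 0] *)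
apply: (@cvg_unique _ _ (laplace H x @[x --> 0^'+])) => //.
  exact/laplace_cvg0/le1_lty.
have [q1 q2 q3] := det_laplace_gt0 (lexx 0).
have cq a b : laplace (Q a b) x @[x --> 0^'+] --> laplace (Q a b) 0.
  exact/laplace_cvg0/mrp_Q_lty.
apply: (@cvg_trans _ ((hitting_laplace (fun a b => laplace (Q a b) x)) @[x --> 0^'+])).
  apply: near_eq_cvg; near=> x; rewrite main//.
apply: cvgM.
  apply: cvgD; first exact: cvgM.
  by apply: cvgM => //; apply: cvgB => //; exact: cvg_cst.
apply: cvgV; first by rewrite gt_eqF.
apply: cvgB; last exact: cvgM.
by apply: cvgM; apply: cvgB => //; exact: cvg_cst.
Unshelve. all: by end_near. Qed.

End TwoStates.

(** * Limits of transforms along a filter *)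

Section LimitCalculus.
Context (R : realType) (T : Type) (F : set_system T) {FF : ProperFilter F}.
Implicit Types (phi psi : T -> R -> R) (d s p w : T -> R).

(* Continuous convergence: in the reduction formulas the argument of every
   transform moves with the parameter as well. *)
Definition laplace_cvg phi (phi0 : R -> R) : Prop :=
  forall s (s0 : R), (\forall x \near F, 0 <= s x) -> s x @[x --> F] --> s0 ->
  phi x (s x) @[x --> F] --> phi0 s0.

(* A continuous form of convergence of the first moments; it decides the limit
   where [1 - p x] tends to 0. *)
Definition slope_cvg phi (m : R) : Prop :=
  forall d s (s0 : R), (\forall x \near F, 0 < d x) -> d x @[x --> F] --> (0 : R) ->
  (\forall x \near F, 0 <= s x) -> s x @[x --> F] --> s0 ->
  (1 - phi x (d x * s x)) / d x @[x --> F] --> m * s0.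

Lemma cvg_ge0_lim s (s0 : R) : (\forall x \near F, 0 <= s x) ->
  s x @[x --> F] --> s0 -> 0 <= s0.
Proof.
move=> s_ge0 cs; rewrite -(cvg_lim (@Rhausdorff R) cs); apply: limr_ge => //.
by apply/cvg_ex; exists s0.
Qed.

(** * Rescaled transforms of convergent laws *)

Section Raw.
Context (mu_ : T -> {measure set (measurableTypeR R) -> \bar R})
  (mu0 : {measure set (measurableTypeR R) -> \bar R}) (v : T -> R).
Hypothesis mu_ok : \forall x \near F, [/\ (mu_ x setT < +oo)%E,
  laplace (mu_ x) 0 = 1, (mean (mu_ x) < +oo)%E & 0 < v x].
Hypothesis mu0_ok : [/\ (mu0 setT < +oo)%E, laplace mu0 0 = 1 & (mean mu0 < +oo)%E].
Hypothesis mu_cvg : forall t : R, 0 < t ->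
  laplace (mu_ x) (t / v x) @[x --> F] --> laplace mu0 t.
Hypothesis mean_cvg : fine (mean (mu_ x)) / v x @[x --> F] --> fine (mean mu0).

(** The rescaled transforms are Lipschitz with constants [mean / v], which converge; replacing [s x]
    by [s0] therefore costs a vanishing error. *)
Lemma laplace_cvg_raw : laplace_cvg (fun x t => laplace (mu_ x) (t / v x)) (laplace mu0).
Proof.
move=> s s0 s_ge0 cs.
have s00 := cvg_ge0_lim s_ge0 cs.
have c0 : laplace (mu_ x) (s0 / v x) @[x --> F] --> laplace mu0 s0.
  (* At [s0 = 0] all transforms equal 1; elsewhere [mu_cvg] applies. *)
  move: s00; rewrite le_eqVlt => /orP[/eqP <-|]; last exact: mu_cvg.
  case: mu0_ok => _ -> _; apply: cvg_near_cst; near=> x.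
  rewrite mul0r; have [_ -> _ _] // : [/\ (mu_ x setT < +oo)%E,
    laplace (mu_ x) 0 = 1, (mean (mu_ x) < +oo)%E & 0 < v x] by near: x.
have -> : laplace mu0 s0 = 0 + laplace mu0 s0 by rewrite add0r.
apply: (@cvg_trans _ ((laplace (mu_ x) (s x / v x) - laplace (mu_ x) (s0 / v x)) +
    laplace (mu_ x) (s0 / v x) @[x --> F])).
  by apply: near_eq_cvg; near=> x; rewrite subrK.
apply: cvgD => //.
apply/norm_cvg0P.
apply: (@squeeze_cvgr _ _ _ _ (cst 0) (fun x => `|s x - s0| * (fine (mean (mu_ x)) / v x))).
- near=> x; rewrite normr_ge0/=.
  have [m1 m2 m3 v0] : [/\ (mu_ x setT < +oo)%E,
    laplace (mu_ x) 0 = 1, (mean (mu_ x) < +oo)%E & 0 < v x] by near: x.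
  have sx : 0 <= s x by near: x.
  have vV : 0 <= (v x)^-1 by rewrite invr_ge0 ltW.
  have lip a b : 0 <= a -> a <= b -> `|laplace (mu_ x) (a / v x) - laplace (mu_ x) (b / v x)| <=
      (b - a) * (fine (mean (mu_ x)) / v x).
    move=> a0 ab; rewrite ger0_norm; last first.
      by rewrite subr_ge0 laplace_decr// mulr_ge0//= ler_wpM2r.
    apply: le_trans (laplace_lipschitz m1 m3 _ _) _; rewrite ?mulr_ge0// ?ler_wpM2r//.
    by rewrite -mulrBl -!mulrA (mulrC (v x)^-1).
  have [ss0|s0s] := leP (s x) s0.
    rewrite (distrC (s x)) (ger0_norm (_ : 0 <= s0 - s x)) ?subr_ge0//.
    exact: lip.
  rewrite distrC (ger0_norm (_ : 0 <= s x - s0)) ?subr_ge0 ?(ltW s0s)//.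
  by apply: lip => //; exact: ltW.
- exact: cvg_cst.
- rewrite -(mul0r (fine (mean mu0))); apply: cvgM => //.
  by apply/norm_cvg0P; rewrite -(subrr s0); apply: cvgB => //; exact: cvg_cst.
Unshelve. all: by end_near. Qed.

(** From above, the Lipschitz bound gives [s x] times the rescaled mean. From below, the chord
    inequality compares with the slope at a fixed [dl], which converges to that of [mu0], itself
    close to the mean of [mu0]. *)
Lemma slope_cvg_raw : slope_cvg (fun x t => laplace (mu_ x) (t / v x)) (fine (mean mu0)).
Proof.
move=> d s s0 d_gt0 cd s_ge0 cs.
have s00 := cvg_ge0_lim s_ge0 cs.
have [m01 m02 m03] := mu0_ok.
have ub : s x * (fine (mean (mu_ x)) / v x) @[x --> F] --> s0 * fine (mean mu0).
  exact: cvgM.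
apply/cvgrPdist_le => e e0.
have e20 : 0 < e / 2 by rewrite divr_gt0.
(* Multiplied by [s0] this is at most [e / 2]; the summand 1 covers [s0 = 0]. *)
have eta0 : 0 < e / 2 / (s0 + 1) by rewrite divr_gt0// ltr_wpDl.
have [dl dl0 hdl] := laplace_slope_ge m01 m03 eta0.
have lb : s x * ((1 - laplace (mu_ x) (dl / v x)) / dl) @[x --> F] -->
    s0 * ((1 - laplace mu0 dl) / dl).
  apply: cvgM => //; apply: cvgM; last exact: cvg_cst.
  by apply: cvgB; [exact: cvg_cst|exact: mu_cvg].
have cds : d x * s x @[x --> F] --> (0 : R) by rewrite -(mul0r s0); exact: cvgM.
have h0 : s0 * fine (mean mu0) - e / 2 <= s0 * ((1 - laplace mu0 dl) / dl).
  apply: le_trans (_ : s0 * (fine (mean mu0) - e / 2 / (s0 + 1)) <= _); last first.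
    by rewrite ler_wpM2l// -[X in X - laplace _ _]m02.
  rewrite mulrBr lerD2l lerN2 mulrCA ler_piMr ?(ltW e20)//.
  by rewrite ler_pdivrMr ?ltr_wpDl// mul1r lerDl.
near=> x.
have [m1 m2 m3 v0] : [/\ (mu_ x setT < +oo)%E,
    laplace (mu_ x) 0 = 1, (mean (mu_ x) < +oo)%E & 0 < v x] by near: x.
have sx : 0 <= s x by near: x.
have dx : 0 < d x by near: x.
have vV : 0 <= (v x)^-1 by rewrite invr_ge0 ltW.
have dsx : d x * s x <= dl by near: x; exact: (cvgr_le _ cds).
have ds0 : 0 <= d x * s x by rewrite mulr_ge0// ltW.
have up : (1 - laplace (mu_ x) (d x * s x / v x)) / d x <=
    s x * (fine (mean (mu_ x)) / v x).
  rewrite ler_pdivrMr// -m2.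
  apply: le_trans (laplace_lipschitz m1 m3 (lexx 0) _) _; first by rewrite mulr_ge0.
  by rewrite subr0; lra.
have lo : s x * ((1 - laplace (mu_ x) (dl / v x)) / dl) <=
    (1 - laplace (mu_ x) (d x * s x / v x)) / d x.
  rewrite ler_pdivlMr// mulrA mulrAC ler_pdivrMr//.
  have := @laplace_chord _ _ m1 (d x * s x / v x) (dl / v x).
  rewrite mulr_ge0// ler_wpM2r// m2 => /(_ isT isT).
  rewrite (mulrAC (d x * s x)) (mulrAC dl) ler_pM2r ?invr_gt0//.
  by lra.
have h1 : s x * (fine (mean (mu_ x)) / v x) <= s0 * fine (mean mu0) + e.
  by near: x; apply: (cvgr_le _ ub); rewrite ltrDl.
have h2 : s0 * ((1 - laplace mu0 dl) / dl) - e / 2 <=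
    s x * ((1 - laplace (mu_ x) (dl / v x)) / dl).
  by near: x; apply: (cvgr_ge _ lb); rewrite ltrBlDr ltrDl.
by rewrite ler_norml; apply/andP; split; lra.
Unshelve. all: by end_near. Qed.

End Raw.

(** * Removal of virtual transitions under limits *)

Section RemoveVirtual.
Context (phi psi : T -> R -> R) (phi0 psi0 : R -> R) (m mp : R) (p : T -> R) (p0 : R).
Hypotheses (p_ok : \forall x \near F, 0 <= p x < 1) (cp : p x @[x --> F] --> p0).
Hypotheses (cphi : laplace_cvg phi phi0) (cpsi : laplace_cvg psi psi0).
Hypotheses (phi00 : phi0 0 = 1) (psi01 : forall t, 0 <= t -> 0 <= psi0 t <= 1).
Hypotheses (mpsi : slope_cvg psi mp) (mp_ge0 : 0 <= mp).

(** Transform of a geometric number of self-sojourns, each with transform [psi], followed by an exit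
    with transform [phi], time being rescaled by [1 - p x]. *)
Definition remove_virtual_family x t : R :=
  (1 - p x) * phi x ((1 - p x) * t) / (1 - p x * psi x ((1 - p x) * t)).

(** Dividing by [1 - p x] exposes a slope of [psi] at 0 with step [1 - p x]; this form keeps a
    meaning as [p x] tends to 1. *)
Let pE x t : 0 <= p x < 1 -> remove_virtual_family x t =
  phi x ((1 - p x) * t) / (1 + p x * ((1 - psi x ((1 - p x) * t)) / (1 - p x))).
Proof.
move=> /andP[px0 px1]; have q0 : 1 - p x != 0 by rewrite subr_eq0 gt_eqF.
rewrite /remove_virtual_family.
set a := phi _ _; set b := psi _ _.
have -> : 1 + p x * ((1 - b) / (1 - p x)) = (1 - p x * b) / (1 - p x).
  by field.
by rewrite invf_div mulrA; congr (_ / _); exact: mulrC.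
Qed.

Let p00 : 0 <= p0.
Proof. by apply: cvg_ge0_lim cp; apply: filterS p_ok => x /andP[]. Qed.

Let p01 : p0 <= 1.
Proof.
rewrite -subr_ge0; apply: (@cvg_ge0_lim (fun x => 1 - p x)); last first.
  by apply: cvgB => //; exact: cvg_cst.
by apply: filterS p_ok => x /andP[_ /ltW]; rewrite subr_ge0.
Qed.

Let cq : 1 - p x @[x --> F] --> 1 - p0.
Proof. by apply: cvgB => //; exact: cvg_cst. Qed.

(** For [p0 < 1] the denominator stays away from 0. For [p0 = 1], in the form [pE], the numerator
    tends to [phi0 0 = 1] and the slope to [mp * s0], which is the exponential limit. *)
Lemma remove_virtual_laplace_cvg : laplace_cvg remove_virtual_family
  (remove_virtual_laplace true p0 mp phi0 psi0).
Proof.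
move=> s s0 s_ge0 cs; have s00 := cvg_ge0_lim s_ge0 cs.
have cqs : (1 - p x) * s x @[x --> F] --> (1 - p0) * s0 by exact: cvgM.
have qs_ge0 : \forall x \near F, 0 <= (1 - p x) * s x.
  near=> x; have /andP[_ /ltW px] : 0 <= p x < 1 by near: x.
  by rewrite mulr_ge0// ?subr_ge0//; near: x.
rewrite /remove_virtual_laplace/=; have [p1|p1] := ltP p0 1.
  apply: cvgM; first by apply: cvgM => //; exact: cphi.
  apply: cvgV; last first.
    by apply: cvgB; [exact: cvg_cst|apply: cvgM => //; exact: cpsi].
  have /andP[h1 h2] : 0 <= psi0 ((1 - p0) * s0) <= 1.
    by apply: psi01; rewrite mulr_ge0// subr_ge0 ltW.
  by rewrite gt_eqF// subr_gt0 (le_lt_trans _ p1)// ler_piMr.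
have p0E : p0 = 1 by apply/le_anti; rewrite p1 p01.
apply: (@cvg_trans _ (phi x ((1 - p x) * s x) /
  (1 + p x * ((1 - psi x ((1 - p x) * s x)) / (1 - p x))) @[x --> F])).
  by apply: near_eq_cvg; near=> x; rewrite pE//; near: x.
rewrite -(mul1r (_)^-1); apply: cvgM.
  by apply: cvg_trans (cphi qs_ge0 cqs) _; rewrite p0E subrr mul0r phi00.
apply: cvgV; first by rewrite gt_eqF// ltr_pwDl// mulr_ge0.
apply: cvgD; first exact: cvg_cst.
have q_gt0 : \forall x \near F, 0 < 1 - p x.
  by near=> x; have /andP[_] : 0 <= p x < 1 by [near: x]; rewrite subr_gt0.
have cq0 : 1 - p x @[x --> F] --> (0 : R).
  by apply: cvg_trans cq _; rewrite p0E subrr.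
by apply: cvg_trans (cvgM cp (mpsi q_gt0 cq0 s_ge0 cs)) _; rewrite p0E mul1r.
Unshelve. all: by end_near. Qed.

Hypothesis mphi : slope_cvg phi m.

(** Limit of [(1 - p) * (m + p / (1 - p) * mp)], the rescaled mean of the geometric sum. The step
    [(1 - p x) * d x] tends to 0 whatever [p0] is, so both cases are treated at once. *)
Lemma remove_virtual_slope_cvg :
  slope_cvg remove_virtual_family ((1 - p0) * m + p0 * mp).
Proof.
move=> d s s0 d_gt0 cd s_ge0 cs; have s00 := cvg_ge0_lim s_ge0 cs.
have q_gt0 : \forall x \near F, 0 < 1 - p x.
  by near=> x; have /andP[_] : 0 <= p x < 1 by [near: x]; rewrite subr_gt0.
pose A x := (1 - psi x ((1 - p x) * d x * s x)) / ((1 - p x) * d x).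
pose B x := (1 - phi x (d x * ((1 - p x) * s x))) / d x.
have cA : A x @[x --> F] --> mp * s0.
  apply: mpsi => //.
    by near=> x; rewrite mulr_gt0//; near: x.
  by rewrite -(mulr0 (1 - p0)); exact: cvgM.
have cB : B x @[x --> F] --> m * ((1 - p0) * s0).
  apply: mphi => //; last exact: cvgM.
  by near=> x; rewrite mulr_ge0//; [apply: ltW|]; near: x.
have cC : 1 + p x * d x * A x @[x --> F] --> (1 : R).
  rewrite -[X in _ --> X]addr0 -(mul0r (mp * s0)) -(mulr0 p0).
  by apply: cvgD; [exact: cvg_cst|do 2! apply: cvgM => //].
have C_gt0 : \forall x \near F, 0 < 1 + p x * d x * A x.
  by apply: (cvgr_gt _ cC); exact: ltr01.
apply: (@cvg_trans _ ((p x * A x + B x) / (1 + p x * d x * A x) @[x --> F])).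
  apply: near_eq_cvg; near=> x.
  have px : 0 <= p x < 1 by near: x.
  have q0 : 1 - p x != 0 by rewrite gt_eqF//; near: x.
  have d0 : d x != 0 by rewrite gt_eqF//; near: x.
  have nz : 1 + p x * d x * A x != 0.
    by rewrite gt_eqF//; near: x; exact: C_gt0.
  have e1 : p x * ((1 - psi x ((1 - p x) * (d x * s x))) / (1 - p x)) =
      p x * d x * A x.
    by rewrite /A -(mulrA (1 - p x)); field; rewrite d0 q0.
  rewrite pE// e1 /B (mulrCA (d x)); set a := phi _ _; set c := A x in nz *.
  by field; rewrite nz d0.
have -> : ((1 - p0) * m + p0 * mp) * s0 = (p0 * (mp * s0) + m * ((1 - p0) * s0)) / 1.
  by rewrite divr1; ring.
apply: cvgM; first by apply: cvgD => //; exact: cvgM.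
by apply: cvgV => //; exact: oner_neq0.
Unshelve. all: by end_near. Qed.

End RemoveVirtual.

Lemma mul_laplace_cvg phi psi (phi0 psi0 : R -> R) w (w0 : R) :
  laplace_cvg phi phi0 -> laplace_cvg psi psi0 ->
  (\forall x \near F, 0 <= w x) -> w x @[x --> F] --> w0 ->
  laplace_cvg (fun x t => phi x t * psi x (w x * t)) (fun t => phi0 t * psi0 (w0 * t)).
Proof.
move=> cphi cpsi w_ge0 cw s s0 s_ge0 cs.
apply: cvgM; first exact: cphi.
apply: cpsi; last exact: cvgM.
by near=> x; rewrite mulr_ge0//; near: x.
Unshelve. all: by end_near. Qed.

(** Product rule at 0: [1 - a * b = (1 - a) + a * (1 - b)]. *)
Lemma mul_slope_cvg phi psi (phi0 : R -> R) (m mp : R) w (w0 : R) :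
  laplace_cvg phi phi0 -> phi0 0 = 1 -> slope_cvg phi m -> slope_cvg psi mp ->
  (\forall x \near F, 0 <= w x) -> w x @[x --> F] --> w0 ->
  slope_cvg (fun x t => phi x t * psi x (w x * t)) (m + w0 * mp).
Proof.
move=> cphi phi00 mphi mpsi w_ge0 cw d s s0 d_gt0 cd s_ge0 cs.
have ds_ge0 : \forall x \near F, 0 <= d x * s x.
  by near=> x; rewrite mulr_ge0//; [apply: ltW|]; near: x.
have -> : (m + w0 * mp) * s0 = m * s0 + 1 * (mp * (w0 * s0)) by ring.
apply: (@cvg_trans _ ((1 - phi x (d x * s x)) / d x +
   phi x (d x * s x) * ((1 - psi x (d x * (w x * s x))) / d x) @[x --> F])).
  apply: near_eq_cvg; near=> x.
  by rewrite (mulrCA (w x)); lra.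
apply: cvgD; first exact: mphi.
apply: cvgM.
  by rewrite -phi00 -(mul0r s0); apply: cphi => //; exact: cvgM.
apply: mpsi => //; last exact: cvgM.
by near=> x; rewrite mulr_ge0//; near: x.
Unshelve. all: by end_near. Qed.

End LimitCalculus.

(** * The continuity theorem *)

Lemma exists_nat_near (R : realType) (c : R) : 0 <= c ->
  exists m : nat, c <= m%:R <= c + 1.
Proof.
move=> c0; exists (Num.truncn c).+1.
have /andP[h1 h2] := truncn_itv c0.
by rewrite ltW//= -natr1 lerD2r.
Qed.

Lemma expR_opp_le (R : realType) (u : R) : 0 <= u -> expR (- u) <= (1 + u)^-1.
Proof.
by move=> u0; rewrite expRN lef_pV2 ?expR_ge1Dx// posrE ?expR_gt0// ltr_wpDr.
Qed.

Lemma bernoulli_le (R : realType) (u : R) m : 0 <= u <= 1 ->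
  1 - m%:R * u <= (1 - u) ^+ m.
Proof.
move=> /andP[u0 u1]; elim: m => [|m IH]; first by rewrite mul0r subr0 expr0.
rewrite exprS -natr1.
have h : (1 - u) * (1 - m%:R * u) <= (1 - u) * (1 - u) ^+ m.
  by rewrite ler_wpM2l// subr_ge0.
have : 0 <= m%:R * u * u by rewrite !mulr_ge0.
by lra.
Qed.

(* The step is [1 - (1 - e^{- n t})^m] with [m ~ e^{n a}] and [x < a < y]: the
   double exponential switches from 1 to 0 around [t = a]. *)
Lemma exponential_step (R : realType) (x y eta : R) : 0 <= x -> x < y -> 0 < eta ->
  exists l : seq (R * R), all (fun a => 0 <= a.2) l /\
    forall t, 0 <= t -> let g := \sum_(a <- l) a.1 * expR (- (a.2 * t)) in
    [/\ 0 <= g <= 1, t <= x -> 1 - eta <= g & y <= t -> g <= eta].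
Proof.
(* [b] is the distance from the midpoint [a] to [x] and [y]; [n] is taken so large that [exp (- (n
   b)) <= 1 / (1 + n b) <= eta / 2]. *)
move=> x0 xy eta0; pose a := (x + y) / 2; pose b := (y - x) / 2.
have b0 : 0 < b by rewrite divr_gt0// subr_gt0.
have [n n1] : exists n : nat, 2 / eta <= n%:R * b.
  have c0 : 0 <= 2 / eta / b by rewrite ltW// divr_gt0// divr_gt0.
  have [n /andP[h _]] := exists_nat_near c0.
  by exists n; rewrite -ler_pdivrMr.
have nb0 : 0 <= n%:R * b by rewrite mulr_ge0// ltW.
have small : (1 + n%:R * b)^-1 <= eta / 2.
  rewrite -(invf_div 2 eta) lef_pV2 ?posrE ?divr_gt0// ?ltr_wpDr//.
  by apply: le_trans n1 _; rewrite lerDr.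
have [m /andP[m1 m2]] := exists_nat_near (expR_ge0 (n%:R * a)).
(* The constant 1, then the binomial expansion of [(1 - exp (- (n t))) ^+ m] with opposite sign. *)
pose l : seq (R * R) :=
  (1, 0) :: [seq (- ((-1) ^+ i * 'C(m, i)%:R), n%:R * i%:R) | i <- iota 0 m.+1].
have lE t : \sum_(a <- l) a.1 * expR (- (a.2 * t)) =
    1 - (1 - expR (- (n%:R * t))) ^+ m.
  rewrite big_cons big_map/= mul0r oppr0 expR0 mul1r; congr (_ + _).
  rewrite exprBn -sumrN -(big_mkord predT (fun i => - ((-1) ^+ i * 1 ^+ (m - i) *
     expR (- (n%:R * t)) ^+ i *+ 'C(m, i)))) /index_iota subn0.
  apply: eq_bigr => i _; rewrite expr1n mulr1 mulNr; congr (- _).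
  rewrite -[RHS]mulr_natr [LHS]mulrAC; congr (_ * _ * _).
  by rewrite -expRM_natl; congr expR; ring.
exists l; split.
  apply/allP => z; rewrite inE => /orP[/eqP ->//|/mapP[i _ ->]] /=.
  by rewrite mulr_ge0.
move=> t t0 /=; rewrite lE; set u := expR (- (n%:R * t)).
have u01 : 0 <= u <= 1.
  by rewrite expR_ge0/= -expR0 ler_expR oppr_le0 mulr_ge0.
have /andP[u0 u1] := u01.
have v01 : 0 <= (1 - u) ^+ m <= 1.
  by rewrite exprn_ge0 ?subr_ge0//= exprn_ile1// ?subr_ge0// gerBl.
split; first by lra.
(* With [a - t >= b]: [(1 - u) ^+ m <= exp (- (m u))] and [m u >= exp (n (a - t)) >= n b]. *)
- move=> tx; suff : (1 - u) ^+ m <= eta by lra.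
  apply: (@le_trans _ _ (eta / 2)); last by lra.
  apply: le_trans small; apply: le_trans (expR_opp_le nb0).
  apply: (@le_trans _ _ (expR (- u) ^+ m)).
    by rewrite lerXn2r ?nnegrE ?subr_ge0 ?expR_ge0//; have := expR_ge1Dx (- u).
  rewrite -expRM_natl ler_expR mulrN lerN2.
  apply: (@le_trans _ _ (expR (n%:R * a) * u)); last by rewrite ler_wpM2r.
  rewrite /u -expRD.
  apply: le_trans (expR_ge1Dx _); apply: (@le_trans _ _ (n%:R * a - n%:R * t)); last first.
    by rewrite lerDr.
  rewrite -mulrBr ler_wpM2l//; rewrite /a /b; lra.
(* Bernoulli, then [m <= exp (n a) + 1 <= 2 exp (n a)] and [t - a >= b]. *)
- move=> yt; apply: (@le_trans _ _ (m%:R * u)).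
    by have := bernoulli_le m u01; lra.
  apply: (@le_trans _ _ (2 * expR (n%:R * a) * u)).
    rewrite ler_wpM2r//; have : 1 <= expR (n%:R * a); last by lra.
    rewrite -expR0 ler_expR mulr_ge0// /a; lra.
  rewrite /u -mulrA -expRD.
  suff : expR (n%:R * a - n%:R * t) <= eta / 2 by lra.
  apply: le_trans small; apply: le_trans (expR_opp_le nb0).
  rewrite ler_expR -mulrBr -mulrN ler_wpM2l// /a /b; lra.
Qed.

(** * Distribution functions between exponential sums *)

Section TailBounds.
Context (R : realType) (mu : {measure set (measurableTypeR R) -> \bar R}) (v : R).
Hypotheses (mu1 : (mu setT <= 1)%E) (mu0 : mu `]-oo, 0[%classic = 0%E) (v0 : 0 < v).

Local Notation Rp := (`[0%R, +oo[%classic : set R).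

Let mufin := le1_lty mu1.

Lemma dfun_lt0 x : x < 0 -> dfun mu x = 0.
Proof.
move=> x0; rewrite /dfun; suff -> : mu `]-oo, x]%classic = 0%E by [].
apply/eqP; rewrite -measure_le0 -mu0; apply: le_measure; rewrite ?inE//.
by apply: subset_itvl; rewrite bnd_simp.
Qed.

Lemma mass_laplace0 : fine (mu setT) = laplace mu 0.
Proof. by rewrite laplace0 measure_setI_ge0 ?setTI. Qed.

Let I (x t : R) : R := (t <= x * v)%R%:R.

Let mI x : measurable_fun setT (I x).
Proof.
rewrite (_ : I x = \1_(`]-oo, x * v]%classic)); first exact: measurable_indic.
apply/funext => t; rewrite indicE; congr (nat_of_bool _)%:R.
by apply/idP/idP; rewrite inE/= in_itv.
Qed.

Let iI (c d x : R) : mu.-integrable Rp (EFin \o (fun t => c + d * I x t)).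
Proof.
apply: (@integrable_bounded _ _ mufin _ (`|c| + `|d|)).
  apply: measurable_funD => //; apply: measurable_funM => //; exact: mI.
move=> t _; apply: le_trans (ler_normD _ _) _; rewrite lerD2l normrM ler_piMr//.
by rewrite /I; case: (t <= x * v); rewrite ?normr1 ?normr0.
Qed.

Let IE c d x : \int[mu]_(t in Rp) (c + d * I x t) = c * laplace mu 0 + d * dfun mu (x * v).
Proof.
have E : \int[mu]_(t in Rp) I x t = dfun mu (x * v).
  rewrite /Rintegral /dfun; congr fine.
  rewrite measure_setI_ge0// -integral_indic//; apply: eq_integral => t _.
  rewrite indicE; congr ((nat_of_bool _)%:R%:E).
  by apply/idP/idP; rewrite inE/= in_itv.
have iI1 : mu.-integrable Rp (EFin \o I x).
  apply: (@integrable_bounded _ _ mufin _ 1) => // t _.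
  by rewrite /I; case: (t <= x * v); rewrite ?normr1 ?normr0.
rewrite RintegralD//; last 2 first.
- exact: (@integrable_bounded _ _ mufin _ `|c|).
- exact: (integrableZl _ d iI1).
rewrite RintegralZl// E; congr (_ + _).
by rewrite (_ : \int[mu]_(t in Rp) c = c * fine (mu Rp)) ?laplace0// Rintegral_cst.
Qed.

Let scaleE (l : seq (R * R)) t :
  \sum_(a <- [seq (a.1, a.2 / v) | a <- l]) a.1 * expR (- (a.2 * t)) =
  \sum_(a <- l) a.1 * expR (- (a.2 * (t / v))).
Proof. by rewrite big_map/=; apply: eq_bigr => a _; rewrite mulrAC mulrA. Qed.

(** A pointwise sandwich between affine functions of indicators is integrated. The constants are
    weighted by the total mass [laplace mu 0], since the measure may be improper. *)
Lemma laplace_sum_between (l : seq (R * R)) c1 d1 x1 c2 d2 x2 :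
  all (fun a => 0 <= a.2) l ->
  (forall t, 0 <= t -> let g := \sum_(a <- l) a.1 * expR (- (a.2 * t)) in
     c1 + d1 * (t <= x1)%R%:R <= g <= c2 + d2 * (t <= x2)%R%:R) ->
  c1 * laplace mu 0 + d1 * dfun mu (x1 * v) <= \sum_(a <- l) a.1 * laplace mu (a.2 / v)
    <= c2 * laplace mu 0 + d2 * dfun mu (x2 * v).
Proof.
move=> l0 gb.
have l0' : all (fun a => 0 <= a.2) [seq (a.1, a.2 / v) | a <- l].
  apply/allP => _ /mapP[a al ->] /=; rewrite divr_ge0 ?(ltW v0)//.
  exact: (allP l0).
have [il El] := laplace_sum mufin l0'; rewrite big_map/= in El.
rewrite -El -!IE.
have gb' t : 0 <= t -> c1 + d1 * I x1 t <=
  \sum_(a <- [seq (a.1, a.2 / v) | a <- l]) a.1 * expR (- (a.2 * t)) <= c2 + d2 * I x2 t.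
  move=> t0; rewrite scaleE /I -!ler_pdivrMr//; apply: gb.
  by rewrite divr_ge0// ltW.
apply/andP; split; apply: le_Rintegral => //.
- by move=> t /=; rewrite in_itv/= andbT => /gb' /andP[].
- by move=> t /=; rewrite in_itv/= andbT => /gb' /andP[].
Qed.

Lemma laplace0_le1 : laplace mu 0 <= 1.
Proof.
by rewrite -mass_laplace0 -lee_fin fineK// fin_num_finite_measure.
Qed.

Lemma dfun_step_between (x y eta : R) (l : seq (R * R)) : 0 < eta ->
  all (fun a => 0 <= a.2) l ->
  (forall t, 0 <= t -> let g := \sum_(a <- l) a.1 * expR (- (a.2 * t)) in
    [/\ 0 <= g <= 1, t <= x -> 1 - eta <= g & y <= t -> g <= eta]) ->
  dfun mu (x * v) <= \sum_(a <- l) a.1 * laplace mu (a.2 / v) + eta /\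
  \sum_(a <- l) a.1 * laplace mu (a.2 / v) - eta <= dfun mu (y * v).
Proof.
move=> eta0 l0 gP.
have gb t : 0 <= t -> let g := \sum_(a <- l) a.1 * expR (- (a.2 * t)) in
    - eta + 1 * (t <= x)%R%:R <= g <= eta + 1 * (t <= y)%R%:R.
  move=> t0 /=; have [/andP[g0 g1] gx gy] := gP t t0.
  apply/andP; split.
    by have [/gx|_] := leP t x; rewrite /= ?mulr1n ?mulr0n; lra.
  by have [_|/ltW /gy] := leP t y; rewrite /= ?mulr1n ?mulr0n; lra.
have := laplace_sum_between l0 gb; rewrite !mul1r => /andP[h1 h2].
have le1 := laplace0_le1.
have h3 : eta * laplace mu 0 <= eta by rewrite ler_piMr// ltW.
by split; lra.
Qed.

(** The sum [2 (1 - exp (- (s t)))] dominates the indicator of [t > x]: the mass beyond [x] is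
    controlled by the oscillation of the transform at 0. *)
Lemma tail_le_laplace (s x : R) : 0 <= s -> expR (- (s * x)) <= 1 / 2 ->
  laplace mu 0 - dfun mu (x * v) <= 2 * (laplace mu 0 - laplace mu (s / v)).
Proof.
move=> s0 sx.
pose l : seq (R * R) := [:: (2, 0); (-2, s)].
have l0 : all (fun a => 0 <= a.2) l by rewrite /= lexx s0.
have gb t : 0 <= t -> let g := \sum_(a <- l) a.1 * expR (- (a.2 * t)) in
    1 + -1 * (t <= x)%R%:R <= g <= 2 + 0 * (t <= x)%R%:R.
  move=> t0 /=; rewrite !big_cons big_nil/= mul0r oppr0 expR0.
  have e0 := expR_ge0 (- (s * t)).
  have e1 : expR (- (s * t)) <= 1 by rewrite -expR0 ler_expR oppr_le0 mulr_ge0.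
  apply/andP; split; last by lra.
  have [_|/ltW xt] := leP t x; rewrite /= ?mulr1n ?mulr0n; first by lra.
  have : expR (- (s * t)) <= expR (- (s * x)) by rewrite ler_expR lerN2 ler_wpM2l.
  by lra.
have /andP[+ _] := laplace_sum_between l0 gb.
by rewrite !big_cons big_nil/= mul0r; lra.
Qed.

End TailBounds.

(** * Measures with a given distribution function *)

Section CumulativeOf.
Context (R : realType) (f : R -> R).

(** An alias of [f] that carries the proofs, for the inference of the cumulative structures. *)
Definition cumulative_of (_ : {homo f : x y / x <= y}) (_ : right_continuous f)
  (_ : f x @[x --> -oo] --> (0 : R)) (_ : f x @[x --> +oo] --> (1 : R)) : R -> R := f.

Context (f_nd : {homo f : x y / x <= y}) (f_rc : right_continuous f)
  (fNy : f x @[x --> -oo] --> (0 : R)) (fy : f x @[x --> +oo] --> (1 : R)).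

HB.instance Definition _ := isCumulative.Build R _ R
  (cumulative_of f_nd f_rc fNy fy) f_nd f_rc.
HB.instance Definition _ := isCumulativeBounded.Build R 0 1
  (cumulative_of f_nd f_rc fNy fy) fNy fy.

Lemma probability_of_dfun : exists mu : probability (measurableTypeR R) R,
  forall x, dfun mu x = f x.
Proof.
pose g : cumulativeBounded (0 : R) (1 : R) := cumulative_of f_nd f_rc fNy fy.
exists (lebesgue_stieltjes_measure g) => x.
by have := cdf_lebesgue_stieltjes_id g x; rewrite /dfun /cdf/= /distribution/pushforward/= => ->.
Qed.

End CumulativeOf.

Section SubprobabilityOf.
Context d (T : measurableType d) (R : realType) (mu : {measure set T -> \bar R}).

Definition subprobability_of (_ : (mu setT <= 1)%E) : set T -> \bar R := mu.

Context (mu1 : (mu setT <= 1)%E).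

HB.instance Definition _ := Measure.copy (subprobability_of mu1) mu.
HB.instance Definition _ := Measure_isSubProbability.Build _ _ _
  (subprobability_of mu1) mu1.

End SubprobabilityOf.

(** The probability with distribution function [f / c] is scaled by [c]; if [c = 0] then [f]
    vanishes and the Dirac mass serves. The negative half-line is a countable union of half-lines on
    which [f] gives mass 0. *)
Lemma subprobability_of_dfun (R : realType) (f : R -> R) (c : R) :
  0 <= c <= 1 -> {homo f : x y / x <= y} -> right_continuous f ->
  (forall x, x < 0 -> f x = 0) -> f x @[x --> +oo] --> c ->
  exists mu : subprobability (measurableTypeR R) R,
    mu `]-oo, 0[%classic = 0%E /\ forall x, dfun mu x = f x.
Proof.
move=> /andP[c0 c1] f_nd f_rc f_lt0 fy.
have f0 x : 0 <= f x.
  have [x0|x0] := ltP x 0; first by rewrite f_lt0.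
  by rewrite -(f_lt0 (-1)) ?ltrN10//; apply: f_nd; exact: le_trans x0.
have fc x : f x <= c.
  rewrite -(cvg_lim (@Rhausdorff R) fy); apply: limr_ge; first by apply/cvg_ex; exists c.
  by near=> y; apply: f_nd; near: y; apply: nbhs_pinfty_ge; exact: num_real.
have [mu muE] : exists mu : probability (measurableTypeR R) R,
    forall x, c * dfun mu x = f x.
  have [c00|cn0] := eqVneq c 0.
    exists (@dirac _ (measurableTypeR R) 0 R) => x.
    by rewrite c00 mul0r; apply/le_anti; rewrite f0 -c00 fc.
  pose g x := f x / c.
  have [] // := @probability_of_dfun R g.
  - by move=> x y xy; rewrite ler_wpM2r ?invr_ge0//; exact: f_nd.
  - by move=> x; apply: cvgM => //; exact: cvg_cst.
  - apply: cvg_near_cst; near=> x.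
    have x0 : x < 0 by near: x; apply: nbhs_ninfty_lt; exact: num_real.
    by rewrite /g f_lt0// mul0r.
  - by rewrite -(mulfV cn0); apply: cvgM => //; exact: cvg_cst.
  - by move=> mu muE; exists mu => x; rewrite muE /g mulrC divfK.
pose m : {measure set (measurableTypeR R) -> \bar R} := mscale (NngNum c0) mu.
have mT : m setT = c%:E by rewrite -[LHS]/(c%:E * mu setT)%E probability_setT mule1.
have m1 : (m setT <= 1)%E by rewrite mT lee_fin.
have mE x : dfun m x = f x.
  rewrite -muE /dfun /m /mscale/= fineM//.
  by apply: fin_num_measure.
exists (subprobability_of m1); split => //.
rewrite -[LHS]/(m `]-oo, 0[%classic).
have -> : `]-oo, 0[%classic = \bigcup_n `]-oo, - n.+1%:R^-1]%classic :> set R.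
  apply/seteqP; split => x /=; rewrite ?in_itv/=.
    move=> x0; have xV : 0 <= (- x)^-1 by rewrite invr_ge0 oppr_ge0 ltW.
    have [n /andP[hn _]] := exists_nat_near xV.
    exists n => //=; rewrite in_itv/= lerNr.
    rewrite invf_ple ?posrE ?oppr_gt0//; apply: le_trans hn _.
    by rewrite ler_nat.
  by move=> [n _] /=; rewrite in_itv/= => /le_lt_trans; apply; rewrite oppr_lt0 invr_gt0.
apply/eqP; rewrite -measure_le0.
apply: (@le_trans _ _ (\sum_(0 <= n <oo) m `]-oo, (- n.+1%:R^-1)%R]%classic)%E).
  by apply: measure_sigma_subadditive => //; exact: bigcup_measurable.
rewrite eseries0// => n _ _.
have : dfun m (- n.+1%:R^-1) = 0 by rewrite mE f_lt0// oppr_lt0 invr_gt0.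
rewrite /dfun => h; rewrite -[LHS]fineK ?h//.
by apply: fin_num_finite_measure => //; exact: le1_lty.
Unshelve. all: by end_near. Qed.

(** * From transforms to weak convergence *)

Section ContinuityTheorem.
Context (R : realType) (mu_ : R -> {measure set (measurableTypeR R) -> \bar R})
  (v : R -> R) (Psi : R -> R).
Hypothesis mu_ok : forall e, 0 < e <= 1 -> [/\ (mu_ e setT <= 1)%E,
     mu_ e `]-oo, 0[%classic = 0%E & 0 < v e].
Hypothesis Psi_cvg : forall s, 0 <= s ->
  laplace (mu_ e) (s / v e) @[e --> 0^'+] --> Psi s.
Hypothesis Psi_cont0 : Psi s @[s --> 0^'+] --> Psi 0.

Let G e t := dfun (mu_ e) (t * v e).

Let near_ok : \forall e \near (0 : R)^'+, 0 < e <= 1.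
Proof.
near=> e; apply/andP; split; near: e; first exact: nbhs_right_gt.
exact: nbhs_right_le.
Unshelve. all: by end_near. Qed.

Let G_ge0 e t : 0 <= G e t.
Proof. exact: dfun_ge0. Qed.

Let G_nd e x y : 0 < e <= 1 -> x <= y -> G e x <= G e y.
Proof.
move=> /mu_ok[h1 _ v0] xy; apply: dfun_nd; first exact: le1_lty.
by rewrite ler_pM2r.
Qed.

Let mass_cvg : laplace (mu_ e) 0 @[e --> 0^'+] --> Psi 0.
Proof.
have := Psi_cvg (lexx 0); apply: cvg_trans; apply: near_eq_cvg.
by near=> e; rewrite mul0r.
Unshelve. all: by end_near. Qed.

Let Psi0_01 : 0 <= Psi 0 <= 1.
Proof.
apply/andP; split; rewrite -(cvg_lim (@Rhausdorff R) mass_cvg).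
  by apply: limr_ge; [apply/cvg_ex; exists (Psi 0)|near=> e; exact: laplace_ge0].
apply: limr_le; first by apply/cvg_ex; exists (Psi 0).
near=> e; have [h1 h2 h3] : [/\ (mu_ e setT <= 1)%E,
     mu_ e `]-oo, 0[%classic = 0%E & 0 < v e] by apply: mu_ok; near: e.
exact: laplace0_le1.
Unshelve. all: by end_near. Qed.

(** One number bounds [G e x] from above and [G e y] from below: the limit of the transforms of an
    exponential step falling from 1 to 0 between [x] and [y]. *)
Let sandwich x y eta : x < y -> 0 < eta -> exists l : R,
  (\forall e \near 0^'+, G e x <= l + eta) /\ (\forall e \near 0^'+, l - eta <= G e y).
Proof.
move=> xy eta0; have [x0|x0] := ltP x 0.
  exists 0; split; near=> e; last by rewrite sub0r (le_trans _ (G_ge0 e y))// oppr_le0 ltW.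
  have [h1 h2 v0] : [/\ (mu_ e setT <= 1)%E,
     mu_ e `]-oo, 0[%classic = 0%E & 0 < v e] by apply: mu_ok; near: e.
  by rewrite /G dfun_lt0 ?add0r ?(ltW eta0)// pmulr_llt0.
have eta20 : 0 < eta / 2 by rewrite divr_gt0.
have [l [l0 lP]] := exponential_step x0 xy eta20.
have cS : \sum_(a <- l) a.1 * laplace (mu_ e) (a.2 / v e) @[e --> 0^'+] -->
    \sum_(a <- l) a.1 * Psi a.2.
  elim: l l0 {lP} => [_|a l IH /= /andP[a0 l0]].
    by rewrite big_nil; under eq_fun do rewrite big_nil; exact: cvg_cst.
  rewrite big_cons; under eq_fun do rewrite big_cons.
  by apply: cvgD; [apply: cvgM; [exact: cvg_cst|exact: Psi_cvg]|exact: IH].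
pose S e := \sum_(a <- l) a.1 * laplace (mu_ e) (a.2 / v e).
exists (\sum_(a <- l) a.1 * Psi a.2); split; near=> e.
- have [h1 h2 v0] : [/\ (mu_ e setT <= 1)%E,
     mu_ e `]-oo, 0[%classic = 0%E & 0 < v e] by apply: mu_ok; near: e.
  have [h _] := dfun_step_between h1 h2 v0 eta20 l0 lP.
  have : S e <= \sum_(a <- l) a.1 * Psi a.2 + eta / 2.
    by near: e; apply: (cvgr_le _ cS); rewrite ltrDl.
  by rewrite /S /G; lra.
- have [h1 h2 v0] : [/\ (mu_ e setT <= 1)%E,
     mu_ e `]-oo, 0[%classic = 0%E & 0 < v e] by apply: mu_ok; near: e.
  have [_ h] := dfun_step_between h1 h2 v0 eta20 l0 lP.
  have : \sum_(a <- l) a.1 * Psi a.2 - eta / 2 <= S e.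
    by near: e; apply: (cvgr_ge _ cS); rewrite ltrBlDr ltrDl.
  by rewrite /S /G; lra.
Unshelve. all: by end_near. Qed.

(* [inf (A x)] is the right-continuous version of the upper limit of [G]. *)
Let A x := [set z | exists2 y, x < y & \forall e \near 0^'+, G e y <= z].

Let A_lb x c : (\forall e \near 0^'+, c <= G e x) -> lbound (A x) c.
Proof.
move=> hc z [y xy hz]; near (0 : R)^'+ => e.
apply: (@le_trans _ _ (G e x)); first by near: e.
apply: (@le_trans _ _ (G e y)); last by near: e.
by apply: G_nd; [near: e|exact: ltW].
Unshelve. all: by end_near. Qed.

Let A_inf x : has_inf (A x).
Proof.
split; last by exists 0; apply: A_lb; near=> e; exact: G_ge0.
exists 1; exists (x + 1); first by rewrite ltrDl.
near=> e; have [h1 _ _] : [/\ (mu_ e setT <= 1)%E,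
     mu_ e `]-oo, 0[%classic = 0%E & 0 < v e] by apply: mu_ok; near: e.
exact: dfun_le1.
Unshelve. all: by end_near. Qed.

Let G0 x := inf (A x).

Let G0_le x z : A x z -> G0 x <= z.
Proof. by move=> Az; apply: ge_inf => //; have [] := A_inf x. Qed.

Let G0_ge x c : (\forall e \near 0^'+, c <= G e x) -> c <= G0 x.
Proof. by move=> /A_lb h; apply: lb_le_inf => //; have [] := A_inf x. Qed.

Let G0_nd : {homo G0 : x y / x <= y}.
Proof.
move=> x y xy; apply: lb_le_inf; first by have [] := A_inf y.
by move=> z [t yt hz]; apply: G0_le; exists t => //; exact: le_lt_trans yt.
Qed.

Let G0_upper x eps : 0 < eps -> exists2 y, x < y &
  \forall e \near 0^'+, G e y <= G0 x + eps.
Proof.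
move=> eps0; have [z [y xy hz] zlt] := inf_adherent eps0 (A_inf x).
exists y => //; apply: filterS hz => e h; exact: le_trans h (ltW zlt).
Qed.

Let G0_rc : right_continuous G0.
Proof.
move=> x; apply/cvgrPdist_le => eps eps0.
have [y xy hy] := G0_upper x eps0.
near=> t; have xt : x < t by near: t; exact: nbhs_right_gt.
have ty : t < y by near: t; exact: nbhs_right_lt.
rewrite distrC ger0_norm ?subr_ge0; last exact: (G0_nd (ltW xt)).
rewrite lerBlDl.
by apply: G0_le; exists y.
Unshelve. all: by end_near. Qed.

(** [G0] is built from upper limits; [sandwich], applied to an intermediate point [z], makes it
    bound the lower limits to its right as well. *)
Let G0_lower x y eps : x < y -> 0 < eps ->
  \forall e \near 0^'+, G0 x - eps <= G e y.
Proof.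
move=> xy eps0; pose z := (x + y) / 2.
have eps20 : 0 < eps / 2 by rewrite divr_gt0.
have zy : z < y by rewrite /z; lra.
have [l [h1 h2]] := sandwich zy eps20.
have h3 : G0 x <= l + eps / 2.
  by apply: G0_le; exists z => //; rewrite /z; lra.
by apply: filterS h2 => e; lra.
Qed.

Let G0_lt0 x : x < 0 -> G0 x = 0.
Proof.
move=> x0; apply/le_anti/andP; split; last by apply: G0_ge; near=> e; exact: G_ge0.
apply: G0_le; exists (x / 2); first by lra.
near=> e; have [h1 h2 v0] : [/\ (mu_ e setT <= 1)%E,
     mu_ e `]-oo, 0[%classic = 0%E & 0 < v e] by apply: mu_ok; near: e.
by rewrite /G dfun_lt0// pmulr_llt0//; lra.
Unshelve. all: by end_near. Qed.

(** No mass escapes: continuity at 0 provides [s] with [Psi s] close to [Psi 0], and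
    [tail_le_laplace] then bounds the mass beyond [x]. The errors add up to
    [eps / 16 + 2 * (eps / 4 + eps / 8)], less than [eps]. *)
Let G0_cvgy : G0 x @[x --> +oo] --> Psi 0.
Proof.
apply/cvgrPdist_le => eps eps0.
have eps40 : 0 < eps / 4 by rewrite divr_gt0.
have [s s0 hs] : exists2 s, 0 < s & Psi 0 - Psi s <= eps / 4.
  move/cvgrPdist_le : Psi_cont0 => /(_ _ eps40) h.
  near (0 : R)^'+ => s; exists s; first by near: s; exact: nbhs_right_gt.
  by apply: le_trans (ler_norm _) _; near: s.
near=> x.
have up : G0 x <= Psi 0.
  apply/ler_addgt0Pr => d d0; apply: G0_le; exists (x + 1); first by rewrite ltrDl.
  near=> e; have [h1 h2 v0] : [/\ (mu_ e setT <= 1)%E,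
     mu_ e `]-oo, 0[%classic = 0%E & 0 < v e] by apply: mu_ok; near: e.
  apply: le_trans (dfun_le (le1_lty h1) _) _; rewrite mass_laplace0//.
  by near: e; apply: (cvgr_le _ mass_cvg); rewrite ltrDl.
rewrite ger0_norm ?subr_ge0// lerBlDl -lerBlDr; apply: G0_ge.
near=> e; have [h1 h2 v0] : [/\ (mu_ e setT <= 1)%E,
     mu_ e `]-oo, 0[%classic = 0%E & 0 < v e] by apply: mu_ok; near: e.
(* For [x >= 1 / s], [exp (- (s x)) <= 1 / (1 + s x) <= 1 / 2]. *)
have sx : expR (- (s * x)) <= 1 / 2.
  have x1 : 1 <= s * x.
    by rewrite mulrC -ler_pdivrMr//; near: x; apply: nbhs_pinfty_ge; exact: num_real.
  apply: le_trans (expR_opp_le (le_trans ler01 x1)) _.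
  by rewrite div1r lef_pV2 ?posrE//; lra.
have := tail_le_laplace h1 h2 v0 (ltW s0) sx.
have a1 : Psi 0 - eps / 16 <= laplace (mu_ e) 0.
  by near: e; apply: (cvgr_ge _ mass_cvg); lra.
have a2 : laplace (mu_ e) 0 <= Psi 0 + eps / 16.
  by near: e; apply: (cvgr_le _ mass_cvg); lra.
have a3 : Psi s - eps / 16 <= laplace (mu_ e) (s / v e).
  by near: e; apply: (cvgr_ge _ (Psi_cvg (ltW s0))); lra.
by rewrite /G; lra.
Unshelve. all: by end_near. Qed.

Theorem laplace_continuity : exists mu0 : subprobability (measurableTypeR R) R,
  [/\ mu0 `]-oo, 0[%classic = 0%E,
      weak_cvg (fun e t => dfun (mu_ e) (t * v e)) (dfun mu0) &
      forall s, 0 <= s -> laplace mu0 s = Psi s].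
Proof.
have [mu0 [m0 mE]] := subprobability_of_dfun Psi0_01 G0_nd G0_rc G0_lt0 G0_cvgy.
have m1 : (mu0 setT <= 1)%E by exact: sprobability_setT.
have tm : total_mass (dfun mu0) = Psi 0.
  by rewrite (_ : dfun mu0 = G0); [exact: cvg_lim|exact/funext].
have wc t : {for t, continuous (dfun mu0)} -> G e t @[e --> 0^'+] --> dfun mu0 t.
  have -> : dfun mu0 = G0 by apply/funext.
  move=> ct; apply/cvgrPdist_le => eps eps0.
  have eps20 : 0 < eps / 2 by rewrite divr_gt0.
  have [y ty hy] := G0_upper t eps0.
  (* Left continuity of the limit at [t] costs [eps / 2]; passing from [G0 x] to [G e t] costs the
     other half. *)
  have [x xt hx] : exists2 x, x < t & G0 t - eps / 2 <= G0 x.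
    have cl : G0 x @[x --> t^'-] --> G0 t by apply: cvg_at_left_filter.
    have /cvgrPdist_le /(_ _ eps20) h := cl.
    near t^'- => x; exists x; first by near: x; exact: nbhs_left_lt.
    have : `|G0 t - G0 x| <= eps / 2 by near: x.
    by have := ler_norm (G0 t - G0 x); lra.
  have lo := G0_lower xt eps20.
  near=> e; have eok : 0 < e <= 1 by near: e.
  have h1 : G e t <= G0 t + eps.
    by apply: le_trans (G_nd eok (ltW ty)) _; near: e.
  have h2 : G0 x - eps / 2 <= G e t by near: e.
  by rewrite ler_norml; apply/andP; split; lra.
exists mu0; split => //.
- split => //.
  rewrite tm; apply: cvg_trans mass_cvg; apply: near_eq_cvg; near=> e.
  have [h1 h2 v0] : [/\ (mu_ e setT <= 1)%E,
     mu_ e `]-oo, 0[%classic = 0%E & 0 < v e] by apply: mu_ok; near: e.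
  rewrite -mass_laplace0//; apply/esym/cvg_lim => //.
  apply: cvg_comp (dfun_cvg_mass (le1_lty h1)).
  apply/cvgryPge => a; near=> t; rewrite -ler_pdivrMr//.
- move=> s; rewrite le_eqVlt => /orP[/eqP <-|s0].
    by rewrite -mass_laplace0// -total_mass_dfun ?tm//; exact: le1_lty.
  (* Weak convergence to [mu0] makes the transforms tend to that of [mu0], while they tend to [Psi]
     by hypothesis. *)
  apply: (@cvg_unique _ (@Rhausdorff R) (laplace (mu_ e) (s / v e) @[e --> 0^'+])).
    exact: weak_cvg_laplace.
  exact/Psi_cvg/ltW.
Unshelve. all: by end_near. Qed.

End ContinuityTheorem.

(** * Jump probabilities *)

Lemma probability_lty (R : realType) (mu : probability (measurableTypeR R) R) :
  (mu setT < +oo)%E.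
Proof. by rewrite probability_setT ltry. Qed.

Section JumpProbabilities.
Context (R : realType) (M : nat) (X : markov_renewal_process R M).
Local Notation Q := (mrp_Q X).
Local Notation p := (jump_prob X).

Lemma jump_prob_ge0 r j : 0 <= p r j.
Proof. exact: fine_ge0. Qed.

Lemma sum_jump_prob r : \sum_j p r j = 1.
Proof.
apply: EFin_inj; rewrite -sumEFin -(mrp_Q_total X r); apply: eq_bigr => j _.
by rewrite /jump_prob fineK// fin_num_finite_measure// mrp_Q_lty.
Qed.

Lemma jump_prob_pair r a b : a != b -> p r a + p r b <= 1.
Proof.
move=> ab; rewrite -(sum_jump_prob r) (bigD1 a)//= (bigD1 b) 1?eq_sym//=.
by rewrite addrA lerDl sumr_ge0// => j _; exact: jump_prob_ge0.
Qed.

Lemma jump_prob_triple r a b c : a != b -> a != c -> b != c ->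
  p r a + p r b + p r c <= 1.
Proof.
move=> ab ac bc; rewrite -(sum_jump_prob r) (bigD1 a)//= (bigD1 b) 1?eq_sym//=.
rewrite (bigD1 c)/=; last by rewrite (eq_sym c a) (eq_sym c b) ac bc.
by rewrite !addrA lerDl sumr_ge0// => j _; exact: jump_prob_ge0.
Qed.

Lemma cond_sojournE r j A : 0 < p r j ->
  cond_sojourn X r j A = ((p r j)^-1%:E * Q r j A)%E.
Proof.
move=> pj; have fQ := mrp_Q_lty X r j.
transitivity (mnormalize (Q r j) (@dirac _ (measurableTypeR R) 0 R) A); first by [].
rewrite /mnormalize ifF.
  by rewrite muleC.
apply/negbTE; rewrite negb_or (lt_eqF fQ) andbT.
by apply: contraTneq pj => h; rewrite /jump_prob h ltxx.
Qed.

Lemma laplace_cond_sojourn r j s : 0 < p r j -> 0 <= s ->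
  laplace (Q r j) s = p r j * laplace (cond_sojourn X r j) s.
Proof.
move=> pj s0; apply: EFin_inj; rewrite EFinM !laplaceE//; last 2 first.
- exact: probability_lty.
- exact: mrp_Q_lty.
have pV : 0 <= (p r j)^-1 by rewrite invr_ge0 ltW.
rewrite [in RHS](@eq_measure_integral _ _ _ _ (mscale (NngNum pV) (Q r j))); last first.
  by move=> A mA _; exact: (cond_sojournE A pj).
rewrite ge0_integral_mscale//; last first.
  by apply/measurable_funTS/measurable_EFinP; exact: measurable_laplace_kernel.
by rewrite muleA -EFinM mulfV ?mul1e// gt_eqF.
Qed.

Lemma laplace_jump_prob0 r j s : p r j = 0 -> 0 <= s -> laplace (Q r j) s = 0.
Proof.
move=> pj s0; apply/le_anti; rewrite laplace_ge0 andbT -pj.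
exact: laplace_le_jump_prob.
Qed.

Lemma cond_sojourn_neg r j : 0 < p r j -> cond_sojourn X r j `]-oo, 0[%classic = 0%E.
Proof. by move=> pj; rewrite cond_sojournE// mrp_Q_ge0 mule0. Qed.

End JumpProbabilities.

Lemma probability_laplace0 (R : realType) (mu : probability (measurableTypeR R) R) :
  mu `]-oo, 0[%classic = 0%E -> laplace mu 0 = 1.
Proof.
by move=> h; rewrite -mass_laplace0//; exact: (congr1 fine (probability_setT mu)).
Qed.

Lemma probability_laplace01 (R : realType) (mu : probability (measurableTypeR R) R) s :
  0 <= s -> 0 <= laplace mu s <= 1.
Proof.
move=> s0; have fm := probability_lty mu.
rewrite laplace_ge0/=; apply: (@le_trans _ _ (laplace mu 0)).
  by apply: laplace_decr => //; rewrite lexx.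
rewrite laplace0 -lee_fin fineK ?fin_num_finite_measure//.
exact: probability_le1.
Qed.

(** * Exits from the two transient states *)

Section Exits.
Context (R : realType) (M : nat) (D : {set 'I_M}) (p : 'I_M -> 'I_M -> R) (r u : 'I_M).
Hypothesis (DC : forall y, y \notin D -> y = r \/ y = u).
Hypothesis p_ge0 : forall a b, 0 <= p a b.

(** The last state before [D] is [r] or [u]. If [r] has no exit in one step it is [u], and the step
    from [r] to [u] has positive probability, as otherwise the chain would remain at [r]. *)
Lemma chain_exit : (exists (n : nat) (c : nat -> 'I_M),
    [/\ (0 < n)%N, c 0%N = r, forall l, (0 < l < n)%N -> c l \notin D, c n \in D &
        0 < \prod_(1 <= l < n.+1) p (c l.-1) (c l)]) ->
  (exists2 j, j \in D & 0 < p r j) \/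
  (0 < p r u /\ exists2 j, j \in D & 0 < p u j).
Proof.
move=> [n [c [n0 c0 cD cn pr]]].
have step l : (l < n)%N -> 0 < p (c l) (c l.+1).
  move=> ln; rewrite lt_neqAle p_ge0 andbT eq_sym.
  apply: contraTneq pr => h; rewrite big_add1/= big_mkord (bigD1 (Ordinal ln))//=.
  by rewrite h mul0r ltxx.
have [n' nE] : exists n', n = n'.+1 by exists n.-1; rewrite prednK.
have [|noexit] := pselect (exists2 j, j \in D & 0 < p r j); first by left.
right; have last : exists2 j, j \in D & 0 < p (c n') j.
  by exists (c n) => //; rewrite nE; apply: step; rewrite nE.
have stay l : p r u = 0 -> (l <= n')%N -> c l = r.
  move=> pu; elim: l => [//|l IH ln]; have cl := IH (ltnW ln).
  have : c l.+1 \notin D by apply: cD; rewrite nE /= ltnS.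
  move=> /DC[//|cu]; have := step l; rewrite cl cu pu ltxx nE ltnS (ltnW ln).
  by move=> /(_ isT).
have pu : 0 < p r u.
  rewrite lt_neqAle p_ge0 andbT eq_sym; apply/eqP => pu; apply: noexit.
  by rewrite -(stay n' pu (leqnn _)).
split => //; have [|cn'] : c n' = r \/ c n' = u; last by rewrite -cn'.
  have [n'0|n'0] := posnP n'; first by left; rewrite n'0.
  by apply: DC; apply: cD; rewrite n'0 nE leqnn.
by move=> cr; case: noexit; rewrite -cr.
Qed.

End Exits.

(** An exit makes one of [p i k <= 1 - p i i] and [p k i <= 1 - p k k] strict, the row sums giving
    both weak inequalities; multiplying them keeps the strictness because the diagonal entries are
    below 1. *)
Lemma det_jump_prob_gt0 (R : realType) (M : nat) (X : markov_renewal_process R M)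
    (D : {set 'I_M}) (i k : 'I_M) : i != k -> i \notin D -> k \notin D ->
  (exists2 j, j \in D & 0 < jump_prob X i j) \/
    (0 < jump_prob X i k /\ exists2 j, j \in D & 0 < jump_prob X k j) ->
  (exists2 j, j \in D & 0 < jump_prob X k j) \/
    (0 < jump_prob X k i /\ exists2 j, j \in D & 0 < jump_prob X i j) ->
  [/\ jump_prob X i i < 1, jump_prob X k k < 1 &
   0 < (1 - jump_prob X i i) * (1 - jump_prob X k k) -
     jump_prob X i k * jump_prob X k i].
Proof.
move=> ik iD kD hi hk; set p := jump_prob X in hi hk *.
have neq r j : r \notin D -> j \in D -> r != j.
  by move=> rD jD; apply: contraNneq rD => ->.
have p0 a b : 0 <= p a b := jump_prob_ge0 X a b.
have ri := jump_prob_pair X i ik; rewrite -/p in ri.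
have rk := jump_prob_pair X k ik; rewrite -/p in rk.
have exit_i j : j \in D -> 0 < p i j -> p i k < 1 - p i i.
  move=> jD pj; have := jump_prob_triple X i ik (neq _ _ iD jD) (neq _ _ kD jD).
  by rewrite -/p; lra.
have exit_k j : j \in D -> 0 < p k j -> p k i < 1 - p k k.
  move=> jD pj; have := jump_prob_triple X k ik (neq _ _ iD jD) (neq _ _ kD jD).
  by rewrite -/p; lra.
have i1 : p i i < 1.
  by case: hi => [[j jD /(exit_i _ jD)]|[]]; have := p0 i k; lra.
have k1 : p k k < 1.
  by case: hk => [[j jD /(exit_k _ jD)]|[]]; have := p0 k i; lra.
split => //.
have [h|h] : p i k < 1 - p i i \/ p k i < 1 - p k k.
- by case: hi => [[j jD /(exit_i _ jD)]|[_ [j jD /(exit_k _ jD)]]]; [left|right].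
- have : p i k * (1 - p k k) < (1 - p i i) * (1 - p k k) by rewrite ltr_pM2r// subr_gt0.
  have : p i k * p k i <= p i k * (1 - p k k) by rewrite ler_wpM2l//; lra.
  by lra.
- have : (1 - p i i) * p k i < (1 - p i i) * (1 - p k k) by rewrite ltr_pM2l// subr_gt0.
  have : p i k * p k i <= (1 - p i i) * p k i by rewrite ler_wpM2r//; lra.
  by lra.
Qed.

(** * Limits of the reduced transforms *)

(** Condition (B) for one entry: a boolean read off at epsilon = 1 decides between positive and
    zero. *)
Definition supported_by (R : realType) (b : bool) (a : R) : Prop :=
  if b then is_true (0 < a) else a = 0.

Section Assembly.
Context (R : realType) (M : nat) (i k : 'I_M) (p1 p0 pt0 : 'I_M -> 'I_M -> R)
  (F0 : 'I_M -> 'I_M -> probability (measurableTypeR R) R)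
  (kpt0 q0 : 'I_M -> R) (w0 : R).
Context (T : Type) (F : set_system T) {FF : ProperFilter F}
  (p : T -> 'I_M -> 'I_M -> R) (f : T -> 'I_M -> 'I_M -> R -> R) (w : T -> R).
Local Notation transient r := ((r == i) || (r == k)).
Local Notation pt x := (remove_virtual (p x)).
Local Notation kp x := (exclude (pt x) k).
Local Notation kpt x := (remove_virtual (kp x)).
Local Notation kp1 := (exclude (remove_virtual p1) k).

Hypothesis ik : i != k.
Hypothesis p1_ok : forall r j, transient r -> 0 <= p1 r j /\ p1 r r < 1.
Hypothesis p_ok : \forall x \near F, forall r, transient r -> p x r r < 1 /\
  forall j, supported_by (reachable p1 r j) (p x r j).
Hypothesis kp_ok : \forall x \near F, kp x i i < 1.
Hypothesis f_ok : \forall x \near F, forall r j, transient r -> reachable p1 r j ->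
  forall t, 0 <= t -> 0 <= f x r j t <= 1.
Hypothesis p_cvg : forall r j, transient r -> p x r j @[x --> F] --> p0 r j.
Hypothesis pt_cvg : forall r j, transient r -> pt x r j @[x --> F] --> pt0 r j.
Hypothesis kpt_cvg : forall j, j != k -> kpt x i j @[x --> F] --> kpt0 j.
Hypothesis q_cvg : forall j, j != k -> reachable kp1 i j ->
  pt x i j / kp x i j @[x --> F] --> q0 j.
Hypothesis w_ge0 : \forall x \near F, 0 <= w x.
Hypothesis w_cvg : w x @[x --> F] --> w0.
Hypothesis F0_neg : forall r j, transient r -> reachable p1 r j ->
  F0 r j `]-oo, 0[%classic = 0%E.
Hypothesis f_cvg : forall r j, transient r -> reachable p1 r j ->
  laplace_cvg F (fun x => f x r j) (phi0 F0 r j).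
Hypothesis f_slope : forall r j, transient r -> reachable p1 r j ->
  slope_cvg F (fun x => f x r j) (e0 F0 r j).

(** [phit], [kphi] and [kphit] are the counterparts of [phit0], [kphi0] and [kphit0] before the
    limit, with the case distinctions on reachability kept, so that each case converges
    separately. *)
Definition phit x r j t : R :=
  if reachable p1 r r then
    remove_virtual_family (fun x => f x r j) (fun x => f x r r) (fun x => p x r r) x t
  else f x r j t.

Definition kphi x j t : R :=
  if reachable_neq p1 i j then
    if reachable_neq p1 i k && reachable_neq p1 k j then
      phit x i j t * (pt x i j / kp x i j) +
      phit x i k t * phit x k j (w x * t) * (1 - pt x i j / kp x i j)
    else phit x i j t
  else phit x i k t * phit x k j (w x * t).

Definition kphit x j t : R :=
  if reachable kp1 i i then
    remove_virtual_family (kphi^~ j) (kphi^~ i) (fun x => kp x i i) x t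
  else kphi x j t.

Let ti : transient i. Proof. by rewrite eqxx. Qed.
Let tk : transient k. Proof. by rewrite eqxx orbT. Qed.

Lemma remove_virtual_self (q : 'I_M -> 'I_M -> R) r : remove_virtual q r r = 0.
Proof. by rewrite /remove_virtual eqxx !mul0r. Qed.

Local Notation p_supported x := (forall r, transient r -> p x r r < 1 /\
  forall j, supported_by (reachable p1 r j) (p x r j)).

Lemma pt_supported x : p_supported x -> forall r j, transient r ->
  supported_by (reachable_neq p1 r j) (pt x r j).
Proof.
move=> h r j tr; have [pr pj] := h r tr.
rewrite /reachable_neq /remove_virtual; case: (j == r) => /=; first by rewrite /supported_by !mul0r.
rewrite mul1r; have := pj j; rewrite /supported_by; case: ifP => _; last first.
  by move=> ->; rewrite mul0r.
by move=> pj0; rewrite divr_gt0// subr_gt0.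
Qed.

Lemma pt1_reachable r j : transient r ->
  supported_by (reachable_neq p1 r j) (remove_virtual p1 r j).
Proof.
move=> tr; have [p1j pr] := p1_ok j tr.
rewrite /reachable_neq /remove_virtual; case: (j == r) => /=; first by rewrite /supported_by !mul0r.
rewrite mul1r /reachable /supported_by; case: ltP => h; first by rewrite divr_gt0// subr_gt0.
by rewrite (_ : p1 r j = 0) ?mul0r//; apply/le_anti; rewrite h p1j.
Qed.

(** Nonnegative terms cannot cancel. It is stated for any [q] as it serves both at epsilon = 1 and
    at the parameter [x]. *)
Let reach_gen (q : 'I_M -> 'I_M -> R) j :
  (forall r j, transient r -> supported_by (reachable_neq p1 r j) (q r j)) ->
  supported_by (reachable_neq p1 i j || (reachable_neq p1 i k && reachable_neq p1 k j))
    (exclude q k i j).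
Proof.
move=> h; have := h i j ti; have := h i k ti; have := h k j tk; rewrite /exclude /supported_by.
case: (reachable_neq p1 i j); case: (reachable_neq p1 i k);
  case: (reachable_neq p1 k j) => /= h1 h2 h3; rewrite ?h1 ?h2 ?h3 ?mul0r ?mulr0 ?addr0 ?add0r//.
- by rewrite addr_gt0// mulr_gt0.
- by rewrite mulr_gt0.
Qed.

Lemma kp1_reachable j : reachable kp1 i j =
  reachable_neq p1 i j || (reachable_neq p1 i k && reachable_neq p1 k j).
Proof.
have := @reach_gen (remove_virtual p1) j pt1_reachable.
by rewrite /supported_by /reachable; case: ifP => _ ->; rewrite ?ltxx.
Qed.

Lemma kp_supported x : p_supported x -> forall j,
  supported_by (reachable kp1 i j) (kp x i j).
Proof. by move=> h j; rewrite kp1_reachable; apply: reach_gen; exact: pt_supported. Qed.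

Lemma pt_reachable : \forall x \near F, forall r j, transient r ->
  supported_by (reachable_neq p1 r j) (pt x r j).
Proof. by apply: filterS p_ok => x; exact: pt_supported. Qed.

Lemma kp_reachable : \forall x \near F, forall j,
  supported_by (reachable kp1 i j) (kp x i j).
Proof. by apply: filterS p_ok => x; exact: kp_supported. Qed.

Let phi00 r j : transient r -> reachable p1 r j -> phi0 F0 r j 0 = 1.
Proof. by move=> tr rj; apply: probability_laplace0; exact: F0_neg. Qed.

Let phi01 r j t : 0 <= t -> 0 <= phi0 F0 r j t <= 1.
Proof. exact: probability_laplace01. Qed.

Let e0_ge0 r j : 0 <= e0 F0 r j.
Proof. exact: mean_ge0. Qed.

Let p_self r : transient r -> \forall x \near F, 0 <= p x r r < 1.
Proof.
move=> tr; apply: filterS p_ok => x h; have [-> pj] := h r tr.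
by have := pj r; rewrite andbT /supported_by; case: ifP => [_ /ltW//|_ ->].
Qed.

Lemma phit_cvg r j : transient r -> reachable p1 r j ->
  laplace_cvg F (fun x => phit x r j) (phit0 p1 p0 F0 r j).
Proof.
move=> tr rj; rewrite /phit /phit0.
have [rr|rr] := boolP (reachable p1 r r); last first.
  rewrite /remove_virtual_laplace/=; exact: f_cvg.
apply: remove_virtual_laplace_cvg.
- exact: p_self.
- exact: p_cvg.
- exact: f_cvg.
- exact: f_cvg.
- exact: phi00.
- by move=> t; exact: phi01.
- exact: f_slope.
- exact: e0_ge0.
Qed.

Lemma phit_slope r j : transient r -> reachable p1 r j ->
  slope_cvg F (fun x => phit x r j) (et0 p1 p0 F0 r j).
Proof.
move=> tr rj; rewrite /phit /et0.
have [rr|rr] := boolP (reachable p1 r r); last exact: f_slope.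
apply: remove_virtual_slope_cvg.
- exact: p_self.
- exact: p_cvg.
- exact: f_slope.
- exact: f_slope.
Qed.

Lemma phit_ok : \forall x \near F, forall r j, transient r -> reachable p1 r j ->
  forall t, 0 <= t -> 0 <= phit x r j t <= 1.
Proof.
near=> x => r j tr rj t t0; rewrite /phit.
have fx : forall r j, transient r -> reachable p1 r j ->
  forall t, 0 <= t -> 0 <= f x r j t <= 1 by near: x.
case: ifP => rr; last exact: fx.
have px : forall r, transient r -> p x r r < 1 /\
  forall j, supported_by (reachable p1 r j) (p x r j) by near: x.
have [pr1 /(_ r)] := px r tr; rewrite rr /supported_by => pr0.
have qt : 0 <= (1 - p x r r) * t by rewrite mulr_ge0// subr_ge0 ltW.
rewrite /remove_virtual_family.
have /andP[a0 a1] := fx r j tr rj _ qt; have /andP[b0 b1] := fx r r tr rr _ qt.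
have pb : p x r r * f x r r ((1 - p x r r) * t) <= p x r r by rewrite ler_piMr// ltW.
have d0 : 0 < 1 - p x r r * f x r r ((1 - p x r r) * t) by lra.
rewrite divr_ge0 ?mulr_ge0 ?subr_ge0 ?(ltW pr1) ?(ltW d0)//=; last by lra.
rewrite ler_pdivrMr// mul1r.
have : (1 - p x r r) * f x r j ((1 - p x r r) * t) <= 1 - p x r r.
  by rewrite ler_piMr// subr_ge0 ltW.
by lra.
Unshelve. all: by end_near. Qed.

Lemma phit0_at0 r j : transient r -> reachable p1 r j -> phit0 p1 p0 F0 r j 0 = 1.
Proof.
move=> tr rj; rewrite /phit0 /remove_virtual_laplace.
have [rr|rr] := boolP (reachable p1 r r); last exact: phi00.
rewrite /= !mulr0 addr0 invr1 !phi00// !mulr1; case: ltP => // h.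
by rewrite divff// subr_eq0 gt_eqF.
Qed.

(** The bounds pass to the limit along the constant argument [t], which avoids the cases of the
    limiting formula. *)
Lemma phit0_01 r j t : transient r -> reachable p1 r j -> 0 <= t ->
  0 <= phit0 p1 p0 F0 r j t <= 1.
Proof.
move=> tr rj t0.
have c : phit x r j t @[x --> F] --> phit0 p1 p0 F0 r j t.
  by apply: (phit_cvg tr rj (s := fun=> t)); [near=> x|exact: cvg_cst].
apply/andP; split; rewrite -(cvg_lim (@Rhausdorff R) c).
  apply: limr_ge; first by apply/cvg_ex; eexists; exact: c.
  by near=> x; have /andP[] : 0 <= phit x r j t <= 1;
    [move: r j tr rj t t0 {c}; near: x; exact: phit_ok|].
apply: limr_le; first by apply/cvg_ex; eexists; exact: c.
by near=> x; have /andP[] : 0 <= phit x r j t <= 1;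
    [move: r j tr rj t t0 {c}; near: x; exact: phit_ok|].
Unshelve. all: by end_near. Qed.

Lemma et0_ge0 r j : transient r -> reachable p1 r j -> 0 <= et0 p1 p0 F0 r j.
Proof.
move=> tr rj; rewrite /et0; case: ifP => // rr.
have c := @p_cvg r r tr.
have pr0 : 0 <= p0 r r.
  by apply: cvg_ge0_lim c; apply: filterS (p_self tr) => x /andP[].
have pr1 : 0 <= 1 - p0 r r.
  apply: (@cvg_ge0_lim _ _ F _ (fun x => 1 - p x r r)); last first.
    by apply: cvgB => //; exact: cvg_cst.
  by apply: filterS (p_self tr) => x /andP[_ /ltW]; rewrite subr_ge0.
by rewrite addr_ge0// mulr_ge0.
Qed.

Let rneq r j : reachable_neq p1 r j -> reachable p1 r j.
Proof. by move=> /andP[]. Qed.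

Lemma kphi_cvg j : j != k -> reachable kp1 i j ->
  laplace_cvg F (kphi^~ j) (kphi0 p1 p0 F0 q0 w0 i k j).
Proof.
move=> jk kj; have := kj; rewrite kp1_reachable /kphi /kphi0.
have [rij _|rij] := boolP (reachable_neq p1 i j); last first.
  move=> /= /andP[rik rkj].
  exact: (mul_laplace_cvg (phit_cvg ti (rneq rik)) (phit_cvg tk (rneq rkj)) w_ge0 w_cvg).
have [/andP[rik rkj]|_] := boolP (reachable_neq p1 i k && reachable_neq p1 k j);
  last by apply: phit_cvg => //; exact: rneq.
move=> s s0 s_ge0 cs; apply: cvgD; apply: cvgM.
- by apply: phit_cvg => //; exact: rneq.
- exact: q_cvg.
- exact: (mul_laplace_cvg (phit_cvg ti (rneq rik)) (phit_cvg tk (rneq rkj)) w_ge0 w_cvg).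
- by apply: cvgB; [exact: cvg_cst|exact: q_cvg].
Qed.

Lemma kphi0_at0 j : reachable kp1 i j -> kphi0 p1 p0 F0 q0 w0 i k j 0 = 1.
Proof.
rewrite kp1_reachable /kphi0 mulr0.
have [rij _|rij] := boolP (reachable_neq p1 i j); last first.
  by move=> /= /andP[rik rkj]; rewrite !phit0_at0 ?mulr1//; exact: rneq.
case: ifP => [/andP[rik rkj]|_]; last by rewrite phit0_at0//; exact: rneq.
by rewrite !phit0_at0//; try exact: rneq; ring.
Qed.

Let self_ik : reachable kp1 i i -> reachable_neq p1 i k /\ reachable_neq p1 k i.
Proof. by rewrite kp1_reachable {1}/reachable_neq eqxx/= => /andP[]. Qed.

Let kphi_selfE : kphi^~ i = fun x t => phit x i k t * phit x k i (w x * t).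
Proof. by apply/funext => x; apply/funext => t; rewrite /kphi /reachable_neq eqxx. Qed.

Let kphi0_selfE t : kphi0 p1 p0 F0 q0 w0 i k i t =
  phit0 p1 p0 F0 i k t * phit0 p1 p0 F0 k i (w0 * t).
Proof. by rewrite /kphi0 {1}/reachable_neq eqxx. Qed.

Let kp_cvg j : kp x i j @[x --> F] --> exclude pt0 k i j.
Proof. by apply: cvgD; [|apply: cvgM]; exact: pt_cvg. Qed.

Let w0_ge0 : 0 <= w0.
Proof. exact: cvg_ge0_lim w_ge0 w_cvg. Qed.

(** Second removal of virtual transitions, now for [i] in the chain without [k]. A self-transition
    is an excursion from [i] to [k] and back; its transform is a product, whose slope is [ke0]. *)
Lemma kphit_cvg j : j != k -> reachable kp1 i j ->
  laplace_cvg F (kphit^~ j) (kphit0 p1 p0 F0 pt0 q0 w0 i k j).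
Proof.
move=> jk kj; rewrite /kphit /kphit0.
have [ii|ii] := boolP (reachable kp1 i i); last first.
  by rewrite /remove_virtual_laplace/=; exact: kphi_cvg.
have [rik rki] := self_ik ii.
apply: remove_virtual_laplace_cvg.
- near=> x; apply/andP; split; last by near: x.
  have : forall j, supported_by (reachable kp1 i j) (kp x i j).
    by near: x; exact: kp_reachable.
  by move=> /(_ i); rewrite ii => /ltW.
- exact: kp_cvg.
- exact: kphi_cvg.
- exact: kphi_cvg.
- exact: kphi0_at0.
- move=> t t0; rewrite kphi0_selfE.
  have /andP[a0 a1] := phit0_01 ti (rneq rik) t0.
  have /andP[b0 b1] := phit0_01 tk (rneq rki) (mulr_ge0 w0_ge0 t0).
  by rewrite mulr_ge0//= mulr_ile1.
- rewrite kphi_selfE; exact: (mul_slope_cvg (phit_cvg ti (rneq rik)) (phit0_at0 ti (rneq rik))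
    (phit_slope ti (rneq rik)) (phit_slope tk (rneq rki)) w_ge0 w_cvg).
- by rewrite addr_ge0 ?mulr_ge0// et0_ge0//; exact: rneq.
Unshelve. all: by end_near. Qed.

(** An unreachable [j] has probability 0 before the limit, which forces [kpt0 j = 0] and makes the
    value of [kphit0] there immaterial. *)
Lemma Psi_i_cvg j (s : T -> R) s0 : j != k -> (\forall x \near F, 0 <= s x) ->
  s x @[x --> F] --> s0 ->
  kpt x i j * kphit x j (s x) @[x --> F] --> Psi_i0 p1 p0 F0 pt0 kpt0 q0 w0 i k j s0.
Proof.
move=> jk s_ge0 cs; rewrite /Psi_i0.
have [kj|kj] := boolP (reachable kp1 i j).
  by rewrite mulrC; apply: cvgM; [exact: kpt_cvg|exact: kphit_cvg].
have kpt_0 : \forall x \near F, kpt x i j = 0.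
  near=> x; have : forall j, supported_by (reachable kp1 i j) (kp x i j).
    by near: x; exact: kp_reachable.
  by move=> /(_ j); rewrite (negbTE kj) /remove_virtual => ->; rewrite mulr0 mul0r.
have -> : kpt0 j = 0.
  apply: (@cvg_unique _ (@Rhausdorff R) (kpt x i j @[x --> F])); first exact: kpt_cvg.
  exact: cvg_near_cst.
rewrite mulr0; apply: cvg_near_cst; near=> x.
by have -> : kpt x i j = 0; [near: x|rewrite mul0r].
Unshelve. all: by end_near. Qed.

Lemma pt_phit_cvg r j (s : T -> R) s0 : transient r -> j != r ->
  (\forall x \near F, 0 <= s x) -> s x @[x --> F] --> s0 ->
  pt x r j * phit x r j (s x) @[x --> F] --> phit0 p1 p0 F0 r j s0 * pt0 r j.
Proof.
move=> tr jr s_ge0 cs.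
have [rj|rj] := boolP (reachable p1 r j).
  by rewrite mulrC; apply: cvgM; [exact: pt_cvg|exact: phit_cvg].
have pt_0 : \forall x \near F, pt x r j = 0.
  near=> x; have h : forall r j, transient r ->
    supported_by (reachable_neq p1 r j) (pt x r j).
    by near: x; exact: pt_reachable.
  by have := h r j tr; rewrite /reachable_neq (negbTE rj) andbF.
have -> : pt0 r j = 0.
  apply: (@cvg_unique _ (@Rhausdorff R) (pt x r j @[x --> F])); first exact: pt_cvg.
  exact: cvg_near_cst.
rewrite mulr0; apply: cvg_near_cst; near=> x.
by have -> : pt x r j = 0; [near: x|rewrite mul0r].
Unshelve. all: by end_near. Qed.

(* Solving the two-state system is the same as excluding [k] and then removing
   the virtual transitions of [i]. *)
Lemma kphit_identity x j s : p_supported x -> kp x i i < 1 -> j != i ->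
  let d := 1 - kp x i i in
  let Z r a t := pt x r a * phit x r a t in
  (Z i j (d * s) + Z i k (d * s) * Z k j (w x * (d * s))) /
    (1 - Z i k (d * s) * Z k i (w x * (d * s))) = kpt x i j * kphit x j s.
Proof.
move=> px kp_lt1 ji d Z.
have d0 : d != 0 by rewrite subr_eq0 gt_eqF.
have numE t : Z i j t + Z i k t * Z k j (w x * t) = kp x i j * kphi x j t.
  have := kp_supported px j; rewrite /kphi kp1_reachable /Z.
  have := pt_supported px j ti; have := pt_supported px k ti.
  have := pt_supported px j tk.
  case: (reachable_neq p1 i j); case: (reachable_neq p1 i k);
    case: (reachable_neq p1 k j); rewrite /supported_by /= => h1 h2 h3 h4;
    rewrite ?h1 ?h2 ?h3 ?h4 ?mul0r ?mulr0 ?addr0 ?add0r//.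
  (* With both the direct route and the route through [k], the ratio [pt / kp] in [kphi] is the
     weight of the direct one; clearing it uses [kp != 0]. *)
  - have kp0 : pt x i j + pt x i k * pt x k j != 0 by rewrite gt_eqF.
    by rewrite /exclude; field.
  - by rewrite /exclude h1 mulr0 addr0.
  - by rewrite /exclude h2 mul0r addr0.
  - by rewrite /exclude h2 mul0r addr0.
  - by rewrite /exclude h3; ring.
have denE t : Z i k t * Z k i (w x * t) = kp x i i * kphi x i t.
  rewrite (congr1 (fun g => g x t) kphi_selfE)/= /exclude remove_virtual_self /Z.
  by ring.
have kptE : kpt x i j = kp x i j / d by rewrite /remove_virtual ji mul1r.
rewrite numE denE /kphit kptE.
have := kp_supported px i; rewrite /supported_by.
have [ii _|ii kp0] := boolP (reachable kp1 i i).
  by rewrite /remove_virtual_family -/d mulrA (mulrA (_ / d)) divfK.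
by rewrite /d kp0 subr0 mul1r mul0r subr0 !divr1.
Qed.

(** Time is in units of the reduced scale of [i]; passing to the scale of [k] multiplies the
    argument by [w x * (1 - kp x i i)], whose limit is [c]. *)
Lemma Psi_k_cvg_pos j (s : T -> R) s0 : j != i -> j != k -> 0 < pt0 k i ->
  (\forall x \near F, 0 <= s x) -> s x @[x --> F] --> s0 ->
  pt x k j * phit x k j (w x * ((1 - kp x i i) * s x)) +
  pt x k i * phit x k i (w x * ((1 - kp x i i) * s x)) * (kpt x i j * kphit x j (s x))
    @[x --> F] --> Psi_k0 p1 p0 F0 pt0 kpt0 q0 w0 i k j s0.
Proof.
move=> ji jk pki s_ge0 cs; rewrite /Psi_k0 pki.
set c := (1 - _) * w0.
have cE : w0 * ((1 - exclude pt0 k i i) * s0) = c * s0 by rewrite /c; ring.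
have cw : w x * ((1 - kp x i i) * s x) @[x --> F] --> c * s0.
  rewrite -cE; apply: cvgM => //; apply: cvgM => //.
  by apply: cvgB; [exact: cvg_cst|exact: kp_cvg].
have cw_ge0 : \forall x \near F, 0 <= w x * ((1 - kp x i i) * s x).
  near=> x; rewrite mulr_ge0//; first by near: x.
  rewrite mulr_ge0//; last by near: x.
  by rewrite subr_ge0 ltW//; near: x.
apply: cvgD; first exact: pt_phit_cvg.
rewrite -mulrA mulrC; apply: cvgM; last exact: Psi_i_cvg.
exact: pt_phit_cvg.
Unshelve. all: by end_near. Qed.

(** [L] stands for the transform from [i], whose argument may be unbounded on the scale of [k];
    bounded by 1, it is killed by [pt x k i]. *)
Lemma Psi_k_cvg_zero j (s L : T -> R) s0 : j != k -> pt0 k i = 0 ->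
  (\forall x \near F, 0 <= s x) -> s x @[x --> F] --> s0 ->
  (\forall x \near F, 0 <= L x <= 1) ->
  pt x k j * phit x k j (s x) + pt x k i * phit x k i (s x) * L x
    @[x --> F] --> Psi_k0 p1 p0 F0 pt0 kpt0 q0 w0 i k j s0.
Proof.
move=> jk pki s_ge0 cs L01; rewrite /Psi_k0 pki ltxx -[X in _ --> X]addr0.
apply: cvgD; first exact: pt_phit_cvg.
apply: (@squeeze_cvgr _ _ _ _ (cst 0) (fun x => pt x k i)).
- near=> x; have /andP[L0 L1] : 0 <= L x <= 1 by near: x.
  have px : p_supported x by near: x.
  have := pt_supported px i tk; rewrite /supported_by.
  have [rki pt_gt0|rki ->] := boolP (reachable_neq p1 k i); last first.
    by rewrite !mul0r lexx.
  have phx : forall r j, transient r -> reachable p1 r j ->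
    forall t, 0 <= t -> 0 <= phit x r j t <= 1 by near: x; exact: phit_ok.
  have sx : 0 <= s x by near: x.
  have /andP[f0 f1] := phx k i tk (rneq rki) _ sx.
  apply/andP; split; first by rewrite /=; apply: mulr_ge0 => //; apply: mulr_ge0 => //; exact: ltW.
  by rewrite -mulrA ler_piMr ?(ltW pt_gt0)//; exact: mulr_ile1.
- exact: cvg_cst.
- by rewrite -pki; exact: pt_cvg.
Unshelve. all: by end_near. Qed.

End Assembly.

(** * Weak convergence of the hitting times *)

Section Main.
Context (R : realType) (M : nat) (D : {set 'I_M}) (i k : 'I_M)
  (X : R -> markov_renewal_process R M) (v : R -> 'I_M -> R)
  (p0 : 'I_M -> 'I_M -> R)
  (F0 : 'I_M -> 'I_M -> probability (measurableTypeR R) R)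
  (pt0 : 'I_M -> 'I_M -> R) (kpt0 q0 : 'I_M -> R) (w0 : R).
Local Notation p e := (jump_prob (X e)).
Local Notation pt e := (remove_virtual (p e)).
Local Notation vt e r := ((1 - p e r r)^-1 * v e r).
Local Notation kp e := (exclude (pt e) k).
Local Notation kpt e := (remove_virtual (kp e)).
Local Notation transient r := ((r == i) || (r == k)).

Hypotheses (ik : i != k) (DC : ~: D = [set i; k]%SET).
Hypothesis v_ge1 : forall e r, 0 < e <= 1 -> r \notin D -> 1 <= v e r.
Hypothesis p_sign : forall r j, r \notin D ->
  (forall e, 0 < e <= 1 -> 0 < p e r j) \/ (forall e, 0 < e <= 1 -> p e r j = 0).
Hypothesis p_chain : forall r, r \notin D ->
  exists (n : nat) (c : nat -> 'I_M),
    [/\ (0 < n)%N, c 0%N = r, forall l, (0 < l < n)%N -> c l \notin D, c n \in D &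
        0 < \prod_(1 <= l < n.+1) p 1 (c l.-1) (c l)].
Hypothesis p_lim : forall r j, r \notin D -> p e r j @[e --> 0^'+] --> p0 r j.
Hypothesis F_lim : forall r j, r \notin D -> reachable (p 1) r j ->
  [/\ F0 r j `]-oo, 0[%classic = 0%E, dfun (F0 r j) 0 < 1 &
      weak_cvg (fun e t => dfun (cond_sojourn (X e) r j) (t * v e r)) (dfun (F0 r j))].
Hypothesis mean_lim : forall r j, r \notin D -> reachable (p 1) r j ->
  [/\ forall e, 0 < e <= 1 -> (mean (cond_sojourn (X e) r j) < +oo)%E,
      (mean (F0 r j) < +oo)%E &
      fine (mean (cond_sojourn (X e) r j)) / v e r @[e --> 0^'+] --> fine (mean (F0 r j))].
Hypothesis pt_lim : forall r j, r \notin D ->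
  0 <= pt0 r j <= 1 /\ pt e r j @[e --> 0^'+] --> pt0 r j.
Hypothesis kpt_lim : forall j, j != k ->
  0 <= kpt0 j <= 1 /\ kpt e i j @[e --> 0^'+] --> kpt0 j.
Hypothesis q_lim : forall j, j != k -> reachable (kp 1) i j ->
  0 <= q0 j <= 1 /\ pt e i j / kp e i j @[e --> 0^'+] --> q0 j.
Hypothesis w_lim : vt e k / vt e i @[e --> 0^'+] --> w0.

Let w e := vt e k / vt e i.
Let f e r j t := laplace (cond_sojourn (X e) r j) (t / v e r).

Let notinD r : (r \notin D) = transient r.
Proof. exact: (notin_two_states DC). Qed.

Let one_ok : ((0 : R) < (1 : R)) && ((1 : R) <= 1).
Proof. by rewrite ltr01 lexx. Qed.

Lemma jump_prob_supported e r j : 0 < e <= 1 -> transient r ->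
  supported_by (reachable (p 1) r j) (p e r j).
Proof.
move=> eok; rewrite -notinD => rD; rewrite /supported_by /reachable.
by have [h|h] := p_sign j rD; rewrite (h 1 one_ok) ?ltxx h.
Qed.

Let exits r u : r \notin D -> (forall y, y \notin D -> y = r \/ y = u) -> u \notin D ->
  forall e, 0 < e <= 1 -> (exists2 j, j \in D & 0 < p e r j) \/
  (0 < p e r u /\ exists2 j, j \in D & 0 < p e u j).
Proof.
move=> rD h uD e eok.
have pos a b : a \notin D -> 0 < p 1 a b -> 0 < p e a b.
  rewrite notinD => ta ab; have := jump_prob_supported b eok ta.
  by rewrite /supported_by /reachable ab.
have [[j jD pj]|[pru [j jD pj]]] :=
    chain_exit h (jump_prob_ge0 (X 1)) (p_chain rD).
  by left; exists j => //; exact: pos.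
by right; split; [exact: pos|exists j => //; exact: pos].
Qed.

Lemma det_gt0 e : 0 < e <= 1 -> [/\ p e i i < 1, p e k k < 1 &
  0 < (1 - p e i i) * (1 - p e k k) - p e i k * p e k i].
Proof.
move=> eok; have iD : i \notin D by rewrite notinD eqxx.
have kD : k \notin D by rewrite notinD eqxx orbT.
apply: (det_jump_prob_gt0 ik iD kD); apply: exits => // y; rewrite notinD.
- by case/orP => /eqP ->; [left|right].
- by case/orP => /eqP ->; [right|left].
Qed.

Let p_supp e : 0 < e <= 1 -> forall r, transient r -> p e r r < 1 /\
  forall j, supported_by (reachable (p 1) r j) (p e r j).
Proof.
move=> eok r tr; split; last by move=> j; exact: jump_prob_supported.
by have [h1 h2 _] := det_gt0 eok; case/orP: tr => /eqP ->.
Qed.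

Let v_gt0 e r : 0 < e <= 1 -> transient r -> 0 < v e r.
Proof. by rewrite -notinD => eok rD; exact: lt_le_trans ltr01 (v_ge1 eok rD). Qed.

Let vt_gt0 e r : 0 < e <= 1 -> transient r -> 0 < vt e r.
Proof.
move=> eok tr; rewrite mulr_gt0 ?v_gt0// invr_gt0 subr_gt0.
by have [] := p_supp eok tr.
Qed.

Let ti : transient i. Proof. by rewrite eqxx. Qed.
Let tk : transient k. Proof. by rewrite eqxx orbT. Qed.

Let kp_selfE e : 0 < e <= 1 ->
  kp e i i = p e i k * p e k i / ((1 - p e i i) * (1 - p e k k)).
Proof.
move=> eok; have [h1 h2 _] := det_gt0 eok.
rewrite /exclude remove_virtual_self /remove_virtual (eq_sym k i) ik !mul1r add0r.
by rewrite mulf_div.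
Qed.

Lemma kp_self_lt1 e : 0 < e <= 1 -> kp e i i < 1.
Proof.
move=> eok; have [h1 h2 h3] := det_gt0 eok; rewrite kp_selfE//.
rewrite ltr_pdivrMr; last by rewrite mulr_gt0// subr_gt0.
by rewrite mul1r -subr_gt0.
Qed.

Let Z e r j t := pt e r j * phit (p 1) (fun e => p e) f e r j t.

(** Geometric summation over the self-transitions of [r]; on the scale [vt e r] the quotient becomes
    the reduced probability times the reduced transform. *)
Let ZE e r j s : 0 < e <= 1 -> transient r -> j != r -> 0 <= s ->
  laplace (mrp_Q (X e) r j) s / (1 - laplace (mrp_Q (X e) r r) s) = Z e r j (s * vt e r).
Proof.
move=> eok tr jr s0.
have [pr1 psupp] := p_supp eok tr; have v0 := v_gt0 eok tr.
have q0' : 1 - p e r r != 0 by rewrite subr_eq0 gt_eqF.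
have arg : (1 - p e r r) * (s * vt e r) / v e r = s by field; rewrite q0' gt_eqF.
have cond a : reachable (p 1) r a -> laplace (mrp_Q (X e) r a) s =
    p e r a * f e r a ((1 - p e r r) * (s * vt e r)).
  move=> ra; rewrite /f arg laplace_cond_sojourn//.
  by have := psupp a; rewrite /supported_by ra.
have zero a : ~~ reachable (p 1) r a -> p e r a = 0 /\ laplace (mrp_Q (X e) r a) s = 0.
  move=> /negbTE ra; have := psupp a; rewrite /supported_by ra => pa; split => //.
  exact: laplace_jump_prob0.
rewrite /Z /phit /remove_virtual_family {1}/remove_virtual jr mul1r.
have [rj|/zero[-> ->]] := boolP (reachable (p 1) r j); last by rewrite !mul0r.
rewrite cond//; have [rr|/zero[e1 ->]] := boolP (reachable (p 1) r r).
  by rewrite cond// [RHS]mulrA (mulrA (p e r j / (1 - p e r r))) divfK.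
by rewrite e1 !subr0 mul1r !divr1.
Qed.

(** Each equation of the system is divided by its diagonal coefficient. [L] is the transform from
    [i]; it is at most 1 because the rows of transforms sum to at most 1. *)
Lemma hitting_laplaceE e j s : 0 < e <= 1 -> j \in D -> 0 <= s ->
  let L := (Z e i j (s * vt e i) + Z e i k (s * vt e i) * Z e k j (s * vt e k)) /
    (1 - Z e i k (s * vt e i) * Z e k i (s * vt e k)) in
  hitting_laplace i k j (fun a b => laplace (mrp_Q (X e) a b) s) =
  Z e k j (s * vt e k) + Z e k i (s * vt e k) * L /\ 0 <= L <= 1.
Proof.
move=> eok jD s0 L; have [h1 h2 h3] := det_gt0 eok.
have [q1 q2 q3] := det_laplace_gt0 h1 h2 h3 s0.
have ji : j != i by apply: contraTneq jD => ->; rewrite notinD eqxx.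
have jk : j != k by apply: contraTneq jD => ->; rewrite notinD eqxx orbT.
have ki : k != i by rewrite eq_sym.
rewrite /L -!ZE// /hitting_laplace.
set qii := laplace (mrp_Q (X e) i i) s in q1 q3 *.
set qkk := laplace (mrp_Q (X e) k k) s in q2 q3 *.
set qik := laplace (mrp_Q (X e) i k) s in q3 *.
set qki := laplace (mrp_Q (X e) k i) s in q3 *.
set qij := laplace (mrp_Q (X e) i j) s; set qkj := laplace (mrp_Q (X e) k j) s.
have n1 : 1 - qii != 0 by rewrite subr_eq0 gt_eqF.
have n2 : 1 - qkk != 0 by rewrite subr_eq0 gt_eqF.
have n3 : (1 - qii) * (1 - qkk) - qik * qki != 0 by rewrite gt_eqF.
have LE : (qij / (1 - qii) + qik / (1 - qii) * (qkj / (1 - qkk))) /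
    (1 - qik / (1 - qii) * (qki / (1 - qkk))) =
    (qij * (1 - qkk) + qik * qkj) / ((1 - qii) * (1 - qkk) - qik * qki).
  by field; rewrite n1 n2 n3.
rewrite LE; split; first by field; rewrite n2 n3.
have g a b : 0 <= laplace (mrp_Q (X e) a b) s := laplace_ge0 _ _.
have le a b := laplace_le_jump_prob (X e) a b s0.
have ri : qii + qik + qij <= 1.
  have := jump_prob_triple (X e) i ik (_ : i != j) (_ : k != j).
  rewrite ![_ == j]eq_sym ji jk => /(_ isT isT).
  by have := le i i; have := le i k; have := le i j; rewrite -/qii -/qik -/qij; lra.
have rk : qki + qkk + qkj <= 1.
  have := jump_prob_triple (X e) k ik (_ : i != j) (_ : k != j).
  rewrite ![_ == j]eq_sym ji jk => /(_ isT isT).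
  by have := le k i; have := le k k; have := le k j; rewrite -/qki -/qkk -/qkj; lra.
have d0 : 0 <= 1 - qkk by rewrite subr_ge0 ltW.
have num0 : 0 <= qij * (1 - qkk) + qik * qkj.
  by apply: addr_ge0; apply: mulr_ge0 => //; exact: g.
rewrite (divr_ge0 num0 (ltW q3))/= ler_pdivrMr// mul1r.
have a1 : qij * (1 - qkk) <= (1 - qii - qik) * (1 - qkk) by rewrite ler_wpM2r//; lra.
have a2 : qik * qkj <= qik * (1 - qkk - qki).
  by rewrite ler_wpM2l//; [exact: g|lra].
by lra.
Qed.

Definition hitting_scale e : R :=
  if 0 < pt0 k i then (1 - kp e i i)^-1 * (1 - p e i i)^-1 * v e i else vt e k.

Lemma hitting_scale_gt0 e : 0 < e <= 1 -> 0 < hitting_scale e.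
Proof.
move=> eok; rewrite /hitting_scale; case: ifP => _; last exact: vt_gt0.
by rewrite -mulrA mulr_gt0 ?vt_gt0// invr_gt0 subr_gt0 kp_self_lt1.
Qed.

(** * Convergence along any filter that drives epsilon to 0 *)

Section Along.
Context (T : Type) (F : set_system T) {FF : ProperFilter F} (e_ : T -> R).
Hypothesis e_lim : e_ x @[x --> F] --> (0 : R)^'+.

Let e_ok : \forall x \near F, 0 < e_ x <= 1.
Proof.
have h : \forall e \near (0 : R)^'+, 0 < e <= 1.
  near=> e; apply/andP; split; near: e; first exact: nbhs_right_gt.
  exact: nbhs_right_le.
exact: (e_lim h).
Unshelve. all: by end_near. Qed.

Let along (g : R -> R) (l : R) : g e @[e --> 0^'+] --> l -> g (e_ x) @[x --> F] --> l.
Proof. exact: cvg_comp e_lim. Qed.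

Let mu_ok r j : transient r -> reachable (p 1) r j -> \forall x \near F,
  [/\ (cond_sojourn (X (e_ x)) r j setT < +oo)%E, laplace (cond_sojourn (X (e_ x)) r j) 0 = 1,
     (mean (cond_sojourn (X (e_ x)) r j) < +oo)%E & 0 < v (e_ x) r].
Proof.
move=> tr rj; have rD : r \notin D by rewrite notinD.
apply: filterS e_ok => x eok; split.
- exact: probability_lty.
- apply: probability_laplace0; apply: cond_sojourn_neg.
  by have := jump_prob_supported j eok tr; rewrite /supported_by rj.
- by have [h _ _] := mean_lim rD rj; exact: h.
- exact: v_gt0.
Qed.

Let mu0_ok r j : transient r -> reachable (p 1) r j ->
  [/\ (F0 r j setT < +oo)%E, laplace (F0 r j) 0 = 1 & (mean (F0 r j) < +oo)%E].
Proof.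
rewrite -notinD => rD rj; have [h1 _ _] := F_lim rD rj; have [_ h2 _] := mean_lim rD rj.
by split; [exact: probability_lty|exact: probability_laplace0|].
Qed.

Let mu_cvg r j : transient r -> reachable (p 1) r j -> forall t : R, 0 < t ->
  laplace (cond_sojourn (X (e_ x)) r j) (t / v (e_ x) r) @[x --> F] --> laplace (F0 r j) t.
Proof.
move=> tr rj t t0; have rD : r \notin D by rewrite notinD.
apply: (along (g := fun e => laplace (cond_sojourn (X e) r j) (t / v e r))).
have [h1 _ [h2 _]] := F_lim rD rj.
apply: (weak_cvg_laplace (mu_ := fun e => cond_sojourn (X e) r j) (v := fun e => v e r)) => //.
- move=> e eok; split.
  + by rewrite probability_le1.
  + apply: cond_sojourn_neg.
    by have := jump_prob_supported j eok tr; rewrite /supported_by rj.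
  + exact: v_gt0.
- by rewrite probability_le1.
Qed.

Let mean_cvg r j : transient r -> reachable (p 1) r j ->
  fine (mean (cond_sojourn (X (e_ x)) r j)) / v (e_ x) r @[x --> F] -->
  fine (mean (F0 r j)).
Proof.
move=> tr rj; have rD : r \notin D by rewrite notinD.
apply: (along (g := fun e => fine (mean (cond_sojourn (X e) r j)) / v e r)).
by have [] := mean_lim rD rj.
Qed.

Let hp1 r j : transient r -> 0 <= p 1 r j /\ p 1 r r < 1.
Proof. by move=> tr; split; [exact: jump_prob_ge0|have [] := p_supp one_ok tr]. Qed.

Let hp : \forall x \near F, forall r, transient r -> p (e_ x) r r < 1 /\
  forall j, supported_by (reachable (p 1) r j) (p (e_ x) r j).
Proof. by apply: filterS e_ok => x; exact: p_supp. Qed.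

Let hkp : \forall x \near F, kp (e_ x) i i < 1.
Proof. by apply: filterS e_ok => x; exact: kp_self_lt1. Qed.

Let hf : \forall x \near F, forall r j, transient r -> reachable (p 1) r j ->
  forall t, 0 <= t -> 0 <= f (e_ x) r j t <= 1.
Proof.
apply: filterS e_ok => x eok r j tr _ t t0; apply: probability_laplace01.
by rewrite divr_ge0// ltW// v_gt0.
Qed.

Let hpc r j : transient r -> p (e_ x) r j @[x --> F] --> p0 r j.
Proof. by rewrite -notinD => rD; apply: (along (g := fun e => p e r j)); exact: p_lim. Qed.

Let hptc r j : transient r -> pt (e_ x) r j @[x --> F] --> pt0 r j.
Proof.
by rewrite -notinD => rD; apply: (along (g := fun e => pt e r j)); have [] := pt_lim j rD.
Qed.

Let hkptc j : j != k -> kpt (e_ x) i j @[x --> F] --> kpt0 j.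
Proof. by move=> jk; apply: (along (g := fun e => kpt e i j)); have [] := kpt_lim jk. Qed.

Let hqc j : j != k -> reachable (kp 1) i j ->
  pt (e_ x) i j / kp (e_ x) i j @[x --> F] --> q0 j.
Proof.
move=> jk kj; apply: (along (g := fun e => pt e i j / kp e i j)).
by have [] := q_lim jk kj.
Qed.

Let hw : \forall x \near F, 0 <= w (e_ x).
Proof. by apply: filterS e_ok => x eok; rewrite ltW// divr_gt0// vt_gt0. Qed.

Let hwc : w (e_ x) @[x --> F] --> w0.
Proof. exact: along. Qed.

Let hF0 r j : transient r -> reachable (p 1) r j -> F0 r j `]-oo, 0[%classic = 0%E.
Proof. by rewrite -notinD => rD rj; have [] := F_lim rD rj. Qed.

Let hfc r j : transient r -> reachable (p 1) r j ->
  laplace_cvg F (fun x => f (e_ x) r j) (phi0 F0 r j).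
Proof.
move=> tr rj; exact: (laplace_cvg_raw (mu_ok tr rj) (mu0_ok tr rj) (mu_cvg tr rj)
  (mean_cvg tr rj)).
Qed.

Let hfs r j : transient r -> reachable (p 1) r j ->
  slope_cvg F (fun x => f (e_ x) r j) (e0 F0 r j).
Proof.
move=> tr rj; exact: (slope_cvg_raw (mu_ok tr rj) (mu0_ok tr rj) (mu_cvg tr rj)
  (mean_cvg tr rj)).
Qed.

Lemma hitting_laplace_cvg (s : T -> R) (s0 : R) j : j \in D ->
  (\forall x \near F, 0 <= s x) -> s x @[x --> F] --> s0 ->
  hitting_laplace i k j
    (fun a b => laplace (mrp_Q (X (e_ x)) a b) (s x / hitting_scale (e_ x)))
    @[x --> F] --> Psi_k0 (p 1) p0 F0 pt0 kpt0 q0 w0 i k j s0.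
Proof.
move=> jD s_ge0 cs.
have ji : j != i by apply: contraTneq jD => ->; rewrite notinD eqxx.
have jk : j != k by apply: contraTneq jD => ->; rewrite notinD eqxx orbT.
have kD : k \notin D by rewrite notinD eqxx orbT.
have [/andP[pki0 _] _] := pt_lim i kD.
have [pki|pki] := ltP 0 (pt0 k i).
- have := Psi_k_cvg_pos (FF := FF) (p := fun x => p (e_ x)) (f := fun x => f (e_ x))
    (w := fun x => w (e_ x)) ik hp1 hp hkp hf hpc hptc hkptc hqc hw hwc hF0 hfc hfs
    ji jk pki s_ge0 cs.
  apply: cvg_trans; apply: near_eq_cvg; near=> x.
  have eok : 0 < e_ x <= 1 by near: x.
  have sx : 0 <= s x by near: x.
  have kv0 := hitting_scale_gt0 eok.
  have [h1 _] := hitting_laplaceE eok jD (divr_ge0 sx (ltW kv0)).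
  rewrite h1.
  have vi0 := vt_gt0 eok ti; have vk0 := vt_gt0 eok tk.
  have d0 : 1 - kp (e_ x) i i != 0 by rewrite subr_eq0 gt_eqF// kp_self_lt1.
  (* [a1] and [a2] convert [s] to the scales of [i] and [k], giving the arguments that occur in
     [kphit_identity]. *)
  have a1 : s x / hitting_scale (e_ x) * vt (e_ x) i = (1 - kp (e_ x) i i) * s x.
    have -> : hitting_scale (e_ x) = (1 - kp (e_ x) i i)^-1 * vt (e_ x) i.
      by rewrite /hitting_scale pki mulrA.
    have unscale (a b c : R) : b != 0 -> c != 0 -> a / (b^-1 * c) * c = b * a.
      by move=> b0 c0; field; rewrite b0.
    by apply: unscale => //; rewrite gt_eqF.
  have a2 : s x / hitting_scale (e_ x) * vt (e_ x) k =
      w (e_ x) * ((1 - kp (e_ x) i i) * s x).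
    have swap (a b c : R) : c != 0 -> a * b = b / c * (a * c) by move=> c0; field.
    by rewrite -a1 /w; apply: swap; rewrite gt_eqF.
  have := @kphit_identity _ _ _ _ _ _ (fun x => p (e_ x)) (fun x => f (e_ x))
    (fun x => w (e_ x)) hp1 x _ (s x) (p_supp eok) (kp_self_lt1 eok) ji.
  by rewrite /= a1 a2 => <-.
- have pki_0 : pt0 k i = 0 by apply/le_anti; rewrite pki pki0.
  pose sg x := s x / hitting_scale (e_ x).
  pose L x := (Z (e_ x) i j (sg x * vt (e_ x) i) +
      Z (e_ x) i k (sg x * vt (e_ x) i) * Z (e_ x) k j (sg x * vt (e_ x) k)) /
    (1 - Z (e_ x) i k (sg x * vt (e_ x) i) * Z (e_ x) k i (sg x * vt (e_ x) k)).
  have HL : \forall x \near F, hitting_laplace i k j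
      (fun a b => laplace (mrp_Q (X (e_ x)) a b) (sg x)) =
      Z (e_ x) k j (sg x * vt (e_ x) k) + Z (e_ x) k i (sg x * vt (e_ x) k) * L x /\
      0 <= L x <= 1.
    near=> x; have eok : 0 < e_ x <= 1 by near: x.
    have sx : 0 <= s x by near: x.
    exact: hitting_laplaceE eok jD (divr_ge0 sx (ltW (hitting_scale_gt0 eok))).
  have L01 : \forall x \near F, 0 <= L x <= 1 by apply: filterS HL => x [].
  have := Psi_k_cvg_zero (FF := FF) (p := fun x => p (e_ x)) (f := fun x => f (e_ x))
    (kpt0 := kpt0) (q0 := q0) (w0 := w0) hp hf hpc hptc hF0 hfc hfs jk pki_0 s_ge0 cs L01.
  apply: cvg_trans; apply: near_eq_cvg; near=> x.
  have eok : 0 < e_ x <= 1 by near: x.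
  have [-> _] : hitting_laplace i k j
      (fun a b => laplace (mrp_Q (X (e_ x)) a b) (sg x)) =
      Z (e_ x) k j (sg x * vt (e_ x) k) + Z (e_ x) k i (sg x * vt (e_ x) k) * L x /\
      0 <= L x <= 1 by near: x.
  have -> : sg x * vt (e_ x) k = s x.
    by rewrite /sg /hitting_scale ltNge pki/= divfK// gt_eqF// vt_gt0.
  by [].
Unshelve. all: by end_near. Qed.

End Along.

Hypothesis k_gt0 : forall e, 0 < e <= 1 -> (0 < mrp_prob (X e) (starts_from k))%E.

Lemma hitting_time_weak_cvg j : j \in D ->
  exists G0 : subprobability (measurableTypeR R) R,
    [/\ G0 `]-oo, 0[%classic = 0%E,
        weak_cvg (fun e t => hitting_dfun (X e) D k j (t * hitting_scale e)) (dfun G0) &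
        forall s, 0 <= s ->
          laplace G0 s = Psi_k0 (p 1) p0 F0 pt0 kpt0 q0 w0 i k j s].
Proof.
move=> jD; pose Psi s := Psi_k0 (p 1) p0 F0 pt0 kpt0 q0 w0 i k j s.
pose g e s := hitting_laplace i k j
  (fun a b => laplace (mrp_Q (X e) a b) (s / hitting_scale e)).
have HH e : exists H : {measure set (measurableTypeR R) -> \bar R}, 0 < e <= 1 ->
    [/\ (H setT <= 1)%E, H `]-oo, 0[%classic = 0%E,
      forall t, dfun H t = hitting_dfun (X e) D k j t &
      forall s, 0 <= s -> laplace H s =
        hitting_laplace i k j (fun a b => laplace (mrp_Q (X e) a b) s)].
  (* [choice] asks for a measure at every real [e]; outside []0, 1]] it is a dummy. *)
  have [eok|ne] := pselect (0 < e <= 1); last by exists (mrp_Q (X e) k k).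
  have [h1 h2 h3] := det_gt0 eok.
  have [H0 H0P] := hitting_law_two_states ik DC jD (k_gt0 eok) h1 h2 h3.
  by exists H0.
have [H HP] := choice HH.
have near_ok : \forall e \near (0 : R)^'+, 0 < e <= 1.
  near=> e; apply/andP; split; near: e; first exact: nbhs_right_gt.
  exact: nbhs_right_le.
have g_cvg s : 0 <= s -> g e s @[e --> 0^'+] --> Psi s.
  move=> s0; apply: (@hitting_laplace_cvg R (0 : R)^'+ _ id _ (fun=> s) s j jD) => //.
  - by near=> e.
  - exact: cvg_cst.
have Psi_cvg s : 0 <= s -> laplace (H e) (s / hitting_scale e) @[e --> 0^'+] --> Psi s.
  move=> s0; apply: cvg_trans (g_cvg s s0); apply: near_eq_cvg; near=> e.
  have eok : 0 < e <= 1 by near: e.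
  have [_ _ _ ->] := HP e eok; first by [].
  by rewrite divr_ge0// ltW// hitting_scale_gt0.
have Psi_cont0 : Psi s @[s --> 0^'+] --> Psi 0.
  have joint : g z.1 z.2 @[z --> filter_prod (0 : R)^'+ (0 : R)^'+] --> Psi 0.
    apply: (@hitting_laplace_cvg (R * R)%type (filter_prod (0 : R)^'+ (0 : R)^'+) _
      fst _ snd 0 j jD) => //.
    - exact: cvg_fst.
    - have h : \forall s \near (0 : R)^'+, 0 <= s.
        by near=> s; apply: ltW; near: s; exact: nbhs_right_gt.
      exact: (cvg_snd h).
    - apply: cvg_trans (_ : (0 : R)^'+ --> (0 : R)); last exact: cvg_within.
      exact: cvg_snd.
  apply/cvgrPdist_le => eps eps0.
  move/cvgrPdist_le : joint => /(_ _ eps0)[[A B] /= [hA hB] AB].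
  near=> s.
  have sB : B s by near: s.
  have s0 : 0 <= s by apply: ltW; near: s; exact: nbhs_right_gt.
  (* Epsilon tends to 0 with [s] fixed in [B], and the joint bound [eps] is inherited by the
     limit. *)
  have c : `|Psi 0 - g e s| @[e --> 0^'+] --> `|Psi 0 - Psi s|.
    by apply: cvg_norm; apply: cvgB; [exact: cvg_cst|exact: g_cvg].
  rewrite -(cvg_lim (@Rhausdorff R) c); apply: limr_le.
    by apply/cvg_ex; eexists; exact: c.
  by near=> e; apply: (AB (e, s)); split => //=; near: e.
have mu_ok e : 0 < e <= 1 -> [/\ (H e setT <= 1)%E,
     H e `]-oo, 0[%classic = 0%E & 0 < hitting_scale e].
  by move=> eok; have [h1 h2 _ _] := HP e eok; split => //; exact: hitting_scale_gt0.
have [G0 [G0n [wc tm] Gl]] := laplace_continuity mu_ok Psi_cvg Psi_cont0.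
exists G0; split => //; split.
- move=> t ct; apply: cvg_trans (wc t ct); apply: near_eq_cvg; near=> e.
  have eok : 0 < e <= 1 by near: e.
  by have [_ _ -> _] := HP e eok.
- apply: cvg_trans tm; apply: near_eq_cvg; near=> e.
  have eok : 0 < e <= 1 by near: e.
  by have [_ _ hd _] := HP e eok; congr total_mass; apply/funext => t; rewrite hd.
Unshelve. all: by end_near. Qed.

End Main.

Theorem theorem3 (R : realType) (M : nat) (D : {set 'I_M}) (i k : 'I_M)
    (X : R -> markov_renewal_process R M) (v : R -> 'I_M -> R)
    (p0 : 'I_M -> 'I_M -> R)
    (F0 : 'I_M -> 'I_M -> probability (measurableTypeR R) R)
    (v0 : 'I_M -> \bar R)
    (pt0 : 'I_M -> 'I_M -> R) (kpt0 q0 : 'I_M -> R) (w0 : R) :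
  let p := fun e => jump_prob (X e) in
  let pt := fun e => remove_virtual (p e) in
  let vt := fun e r => (1 - p e r r)^-1 * v e r in
  let kp := fun e => exclude (pt e) k in
  let kpt := fun e => remove_virtual (kp e) in
  (* the state space and the domain *)
  D != finset.set0 -> i != k -> ~: D = [set i; k]%SET ->
  (* the conditional law given eta_0 = k is defined *)
  (forall e, 0 < e <= 1 -> (0 < mrp_prob (X e) (starts_from k))%E) ->
  (forall e r, 0 < e <= 1 -> r \notin D -> 1 <= v e r) ->
  (* A *)
  (forall e r, 0 < e <= 1 -> sojourn_dfun (X e) r 0 < 1) ->
  (* B *)
  (forall r j, r \notin D ->
     (forall e, 0 < e <= 1 -> 0 < p e r j) \/
     (forall e, 0 < e <= 1 -> p e r j = 0)) ->
  (forall r, r \notin D ->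
     exists (n : nat) (c : nat -> 'I_M),
       [/\ (0 < n)%N, c 0%N = r,
           forall l, (0 < l < n)%N -> c l \notin D,
           c n \in D &
           0 < \prod_(1 <= l < n.+1) p 1 (c l.-1) (c l)]) ->
  (* C *)
  (forall r j, r \notin D -> p e r j @[e --> 0^'+] --> p0 r j) ->
  (* D *)
  (forall r j, r \notin D -> reachable (p 1) r j ->
     [/\ F0 r j `]-oo, 0[%classic = 0%E, dfun (F0 r j) 0 < 1 &
         weak_cvg (fun e t => dfun (cond_sojourn (X e) r j) (t * v e r))
                  (dfun (F0 r j))]) ->
  (forall r, r \notin D ->
     (1 <= v0 r)%E /\ (v e r)%:E @[e --> 0^'+] --> v0 r) ->
  (* E *)
  (forall r j, r \notin D -> reachable (p 1) r j ->
     [/\ forall e, 0 < e <= 1 -> (mean (cond_sojourn (X e) r j) < +oo)%E,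
         (mean (F0 r j) < +oo)%E &
         fine (mean (cond_sojourn (X e) r j)) / v e r @[e --> 0^'+]
           --> fine (mean (F0 r j))]) ->
  (* C~ *)
  (forall r j, r \notin D ->
     0 <= pt0 r j <= 1 /\ pt e r j @[e --> 0^'+] --> pt0 r j) ->
  (* kC~ *)
  (forall j, j != k ->
     0 <= kpt0 j <= 1 /\ kpt e i j @[e --> 0^'+] --> kpt0 j) ->
  (* kC^ *)
  (forall j, j != k -> reachable (kp 1) i j ->
     0 <= q0 j <= 1 /\ pt e i j / kp e i j @[e --> 0^'+] --> q0 j) ->
  (* kF^ *)
  0 <= w0 -> vt e k / vt e i @[e --> 0^'+] --> w0 ->
  let kvt := fun e => (1 - kp e i i)^-1 * (1 - p e i i)^-1 * v e i in
  let kvc := fun e => if 0 < pt0 k i then kvt e else vt e k in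
  forall j, j \in D ->
  exists G0 : subprobability (measurableTypeR R) R,
    [/\ G0 `]-oo, 0[%classic = 0%E,
        weak_cvg (fun e t => hitting_dfun (X e) D k j (t * kvc e)) (dfun G0) &
        forall s, 0 <= s ->
          laplace G0 s = Psi_k0 (p 1) p0 F0 pt0 kpt0 q0 w0 i k j s].
Proof.
move=> p pt vt kp kpt _ ik DC k_gt0 v_ge1 _ p_sign p_chain p_lim F_lim _ mean_lim.
move=> pt_lim kpt_lim q_lim _ w_lim kvt kvc j jD.
exact: (hitting_time_weak_cvg ik DC v_ge1 p_sign p_chain p_lim F_lim mean_lim
  pt_lim kpt_lim q_lim w_lim k_gt0 jD).
Qed.
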